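(* Let $p\in[1,\infty)$, $1/p+1/q=1$, $\alpha\in(0,1]$, and let $f\in L^p(\mathbb{R}^n)$. Then $V^{p,\alpha}(f)<\infty$ if and only if $U^{p,\alpha}(f)<\infty$. Moreover, $$U^{p,\alpha}(f)\le n^{\frac{1-\alpha}{2}}V^{p,\alpha}(f),\qquad V^{p,\alpha}(f)\le(4\sqrt n\,\alpha^{-1}+1)\,U^{p,\alpha}(f).$$
   Context: $|\cdot|$ is the Euclidean norm on $\mathbb{R}^n$; $\|\cdot\|_p$ is the $L^p$-norm with respect to Lebesgue measure on $\mathbb{R}^n$ and $\|\cdot\|_\infty$ the sup-norm; if $p=1$ then $q=\infty$. For a vector field $\Phi$, $\|\Phi\|_q$ is the $L^q$-norm of $|\Phi|$. For $f\in L^p(\mathbb{R}^n)$, $V^{p,\alpha}(f)$ is the infimum of all $C\ge0$ such that $\int_{\mathbb{R}^n}\mathrm{div}\Phi(x)f(x)\,dx\le C\|\Phi\|_q^\alpha\|\mathrm{div}\Phi\|_q^{1-\alpha}$ for all $\Phi\in C_0^\infty(\mathbb{R}^n,\mathbb{R}^n)$ (smooth compactly supported vector fields); the infimum of the empty set is $+\infty$, and $0^0=1$. The heat semigroup is $P_tf(x):=(2\pi t)^{-n/2}\int_{\mathbb{R}^n}f(y)\exp\bigl(-\frac{|x-y|^2}{2t}\bigr)\,dy$ for $t>0$, and $U^{p,\alpha}(f):=\sup_{t>0}t^{\frac{1-\alpha}{2}}\|\nabla P_tf\|_p$. *)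

(* Defs.v *)
From HB Require Import structures.
From mathcomp Require Import all_boot all_order all_algebra.
From mathcomp Require Import all_classical all_reals all_analysis.
Set Implicit Arguments.
Unset Strict Implicit.
Unset Printing Implicit Defensive.
Import Order.TTheory GRing.Theory Num.Theory.
Import numFieldNormedType.Exports.
Local Open Scope classical_set_scope.
Local Open Scope ring_scope.

(* The space R^n is 'rV[R]_n. The library gives it the topology of the
   max-norm `|x|, which is the usual topology of R^n; the Euclidean norm is
   [enorm] below. Its sigma-algebra is the one generated by the coordinates. *)

Definition rV_display : measure_display.
Proof. exact: default_measure_display. Qed.

Section rV_measurable.
Context (R : realType) (n : nat).

Let coord (i : 'I_n) (x : 'rV[R]_n) : R := x ord0 i.

Let rV_set0 : g_sigma_preimage coord set0.
Proof. exact: sigma_algebra0. Qed.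

Let rV_setC A : g_sigma_preimage coord A -> g_sigma_preimage coord (~` A).
Proof. exact: sigma_algebraC. Qed.

Let rV_bigcup (F : (set 'rV[R]_n)^nat) :
  (forall i, g_sigma_preimage coord (F i)) ->
  g_sigma_preimage coord (\bigcup_i (F i)).
Proof. exact: sigma_algebra_bigcup. Qed.

HB.instance Definition _ := @isMeasurable.Build rV_display
  'rV[R]_n (g_sigma_preimage coord) rV_set0 rV_setC rV_bigcup.

Lemma measurable_coord (i : 'I_n) :
  measurable_fun [set: 'rV[R]_n] (fun x : 'rV[R]_n => x ord0 i).
Proof.
move=> _ Y mY; rewrite setTI; apply: sub_sigma_algebra => /=.
rewrite -bigcup_seq/=; exists i => /=; first by rewrite mem_index_enum.
by exists Y => //; rewrite setTI.
Qed.

Lemma measurable_fun_rV d (T : measurableType d) (f : T -> 'rV[R]_n) :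
  (forall i, measurable_fun [set: T] (fun t => f t ord0 i)) ->
  measurable_fun [set: T] f.
Proof.
move=> mf.
have H : g_sigma_preimage (fun i => coord i \o f) `<=` measurable.
  apply: smallest_sub; first exact: sigma_algebra_measurable.
  rewrite -bigcup_seq/= => A [i _ [B mB <-]]; exact: mf.
by move: H; rewrite g_sigma_preimage_comp => H _ A mA; apply: H; exists A.
Qed.

End rV_measurable.

Section lebesgue_rV.
Context (R : realType).

Definition cons_rV n (p : measurableTypeR R * 'rV[R]_n) : 'rV[R]_n.+1 := row_mx p.1%:M p.2.

Definition uncons_rV n (x : 'rV[R]_n.+1) : measurableTypeR R * 'rV[R]_n :=
  (x ord0 ord0, rsubmx (x : 'rV_(1 + n))).

Lemma cons_rV0 n (p : measurableTypeR R * 'rV[R]_n) : cons_rV p ord0 ord0 = p.1.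
Proof.
rewrite /cons_rV (_ : ord0 = lshift n (ord0 : 'I_1)); last exact/val_inj.
by apply: etrans (row_mxEl _ _ _ _) _; rewrite mxE eqxx mulr1n.
Qed.

Lemma cons_rVS n (p : measurableTypeR R * 'rV[R]_n) i :
  cons_rV p ord0 (lift ord0 i) = p.2 ord0 i.
Proof.
rewrite /cons_rV (_ : lift ord0 i = rshift 1 i); last exact/val_inj.
exact: row_mxEr.
Qed.

Lemma cons_rVK n : cancel (@cons_rV n) (@uncons_rV n).
Proof.
by move=> p; rewrite /uncons_rV cons_rV0 /cons_rV row_mxKr -surjective_pairing.
Qed.

Lemma uncons_rVK n : cancel (@uncons_rV n) (@cons_rV n).
Proof.
move=> x; apply/rowP => i; case: (unliftP ord0 i) => [j|] ->.
  by rewrite cons_rVS mxE; congr (x _ _); exact/val_inj.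
by rewrite cons_rV0.
Qed.

Lemma measurable_cons_rV n : measurable_fun [set: measurableTypeR R * 'rV[R]_n] (@cons_rV n).
Proof.
apply: measurable_fun_rV => i; case: (unliftP ord0 i) => [j|] ->.
  rewrite [X in measurable_fun _ X](_ : _ = (fun x : 'rV[R]_n => x ord0 j) \o snd).
    exact: (measurableT_comp (measurable_coord j)).
  by apply/funext => p; rewrite /= cons_rVS.
rewrite [X in measurable_fun _ X](_ : _ = fst) //.
by apply/funext => p; rewrite /= cons_rV0.
Qed.

Lemma measurable_uncons_rV n :
  measurable_fun [set: 'rV[R]_n.+1] (@uncons_rV n).
Proof.
apply/measurable_fun_pairP; split; first exact: measurable_coord.
apply: measurable_fun_rV => i.
rewrite [X in measurable_fun _ X](_ : _ =
  (fun x : 'rV[R]_n.+1 => x ord0 (lift ord0 i))); first exact: measurable_coord.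
by apply/funext => x; rewrite /= mxE; congr (x _ _); exact/val_inj.
Qed.

(* Lebesgue measure on R^n, as the n-fold product of Lebesgue measure on R. *)
Fixpoint lebesgue_rV n : set 'rV[R]_n -> \bar R :=
  match n with
  | 0 => dirac (0 : 'rV[R]_0)
  | m.+1 => pushforward (lebesgue_measure \x @lebesgue_rV m)%E (@cons_rV m)
  end.


Arguments lebesgue_rV : clear implicits.

Section pushforward_cons_rV.
Context n (m : {sigma_finite_measure set 'rV[R]_n -> \bar R}).

Let push : set 'rV[R]_n.+1 -> \bar R :=
  pushforward (lebesgue_measure \x m)%E (@cons_rV n).

Let push0 : push set0 = 0%E.
Proof. by rewrite /push/= measure0//; exact: measurable_cons_rV. Qed.

Let push_ge0 A : (0 <= push A)%E.
Proof. by rewrite measure_ge0//; exact: measurable_cons_rV. Qed.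

Let push_sigma_additive : semi_sigma_additive push.
Proof. by apply: measure_semi_sigma_additive; exact: measurable_cons_rV. Qed.

#[local] HB.instance Definition _ :=
  isMeasure.Build _ _ _ push push0 push_ge0 push_sigma_additive.

Let push_sigma_finite : sigma_finite setT push.
Proof.
have /sigma_finiteP[F [TF ndF Foo]] := sigma_finiteT (@lebesgue_measure R).
have /sigma_finiteP[G [TG ndG Goo]] := sigma_finiteT m.
exists (fun k => @uncons_rV n @^-1` (F k `*` G k)).
  rewrite -preimage_bigcup (_ : \bigcup_k (F k `*` G k) = setT) ?preimage_setT//.
  rewrite -setXTT TF TG predeqE => -[x y]; split.
    by move=> [n0 _ []/= ? ?]; split; exists n0.
  move=> [/= [i _ Fix] [j _ Gjy]]; exists (maxn i j) => //; split.
  - by move: x Fix; exact/subsetPset/ndF/leq_maxl.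
  - by move: y Gjy; exact/subsetPset/ndG/leq_maxr.
move=> k; have [mF Fk] := Foo k; have [mG Gk] := Goo k; split.
  rewrite -[X in measurable X]setTI; apply: measurable_uncons_rV => //.
  exact: measurableX.
rewrite /push /pushforward -comp_preimage (_ : _ \o _ = id); last first.
  by apply/funext => p /=; exact: cons_rVK.
by rewrite preimage_id product_measure1E// lte_mul_pinfty// ge0_fin_numE.
Qed.

#[local] HB.instance Definition _ :=
  @Measure_isSigmaFinite.Build _ _ _ push push_sigma_finite.

Lemma pushforward_cons_rV :
  exists mu : {sigma_finite_measure set 'rV[R]_n.+1 -> \bar R},
    mu = pushforward (lebesgue_measure \x m)%E (@cons_rV n) :> (set _ -> \bar R).
Proof. by exists push. Qed.

End pushforward_cons_rV.

Lemma lebesgue_rV_bundle n :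
  exists mu : {sigma_finite_measure set 'rV[R]_n -> \bar R},
    mu = lebesgue_rV n :> (set _ -> \bar R).
Proof.
elim: n => [|n [mu muE]]; first by exists (dirac (0 : 'rV[R]_0)).
have [nu nuE] := pushforward_cons_rV mu.
by exists nu; rewrite nuE muE.
Qed.

Section lebesgue_rV_measure.
Context (n : nat).

Let lebesgue_rV0 : lebesgue_rV n set0 = 0%E.
Proof. by have [mu <-] := lebesgue_rV_bundle n; exact: measure0. Qed.

Let lebesgue_rV_ge0 A : (0 <= lebesgue_rV n A)%E.
Proof. by have [mu <-] := lebesgue_rV_bundle n; exact: measure_ge0. Qed.

Let lebesgue_rV_sigma_additive : semi_sigma_additive (lebesgue_rV n).
Proof.
by have [mu <-] := lebesgue_rV_bundle n; exact: measure_semi_sigma_additive.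
Qed.

HB.instance Definition _ := isMeasure.Build _ _ _ (lebesgue_rV n)
  lebesgue_rV0 lebesgue_rV_ge0 lebesgue_rV_sigma_additive.

Let lebesgue_rV_sigma_finite : sigma_finite setT (lebesgue_rV n).
Proof. by have [mu <-] := lebesgue_rV_bundle n; exact: sigma_finiteT. Qed.

HB.instance Definition _ := @Measure_isSigmaFinite.Build _ _ _
  (lebesgue_rV n) lebesgue_rV_sigma_finite.

End lebesgue_rV_measure.

Lemma lebesgue_rV_box n (A : 'I_n -> set R) : (forall i, measurable (A i)) ->
  lebesgue_rV n [set x | forall i, A i (x ord0 i)] =
  (\prod_(i < n) lebesgue_measure (A i))%E.
Proof.
elim: n A => [|n IHn] A mA.
  by rewrite big_ord0 /= diracE mem_set// => -[].
have mB : measurable [set x : 'rV[R]_n | forall i, A (lift ord0 i) (x ord0 i)].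
  rewrite [X in measurable X](_ : _ = \big[setI/setT]_(i < n)
      ((fun x : 'rV[R]_n => x ord0 i) @^-1` A (lift ord0 i))).
    apply: bigsetI_measurable => i _.
    by rewrite -[X in measurable X]setTI; exact: measurable_coord.
  rewrite -bigcap_seq; apply/seteqP; split => x /= h i.
    by move=> _; exact: h.
  by apply: h => /=; rewrite mem_index_enum.
rewrite big_ord_recl -IHn// -product_measure1E//=.
congr ((lebesgue_measure \x lebesgue_rV n)%E _).
apply/seteqP; split=> [p /= h|p [/= h0 hS] i].
  split=> [|i] /=; first by rewrite -(cons_rV0 p).
  by rewrite -(cons_rVS p).
by case: (unliftP ord0 i) => [j|] ->; rewrite ?cons_rV0 ?cons_rVS.
exact: mA.
Qed.

End lebesgue_rV.
Arguments lebesgue_rV : clear implicits.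

Section functionals.
Context (R : realType) (n : nat).
Implicit Types (f g : 'rV[R]_n -> R) (Phi : 'rV[R]_n -> 'rV[R]_n).

Definition enorm (x : 'rV[R]_n) : R := Num.sqrt (\sum_(i < n) x ord0 i ^+ 2).

Definition partial (i : 'I_n) g : 'rV[R]_n -> R :=
  fun x => 'D_(delta_mx ord0 i) g x.

Definition gradient g : 'rV[R]_n -> 'rV[R]_n :=
  fun x => \row_(i < n) partial i g x.

Definition divergence Phi : 'rV[R]_n -> R :=
  fun x => \sum_(i < n) partial i (fun y => Phi y ord0 i) x.

(* All iterated partial derivatives exist and are continuous: the sequence s
   lists the directions of differentiation, and s = [::] is g itself. *)
Definition smooth g := forall s : seq 'I_n,
  continuous (foldr partial g s) /\
  forall (i : 'I_n) x, derivable (foldr partial g s) x (delta_mx ord0 i).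

Definition test_field Phi :=
  (forall i : 'I_n, smooth (fun x => Phi x ord0 i)) /\
  compact (closure [set x | Phi x != 0]).

(* For p = +oo this is the sup-norm, whereas the library's 'N[mu]_+oo[g] is
   the essential supremum. *)
Definition Lp_norm (p : \bar R) g : \bar R :=
  match p with
  | +oo%E => ereal_sup [set (`|g x|)%:E | x in [set: 'rV[R]_n]]
  | _ => ('N[lebesgue_rV R n]_p[EFin \o g])%E
  end.

(* Here 0 `^ 0 = 1 by [poweRe0], and [ereal_inf set0 = +oo]. *)
Definition V (p alpha : R) f : \bar R :=
  let q := hoelder_conjugate p%:E in
  ereal_inf [set C%:E | C in [set C : R | 0 <= C /\
    forall Phi, test_field Phi ->
      (\int[lebesgue_rV R n]_x (divergence Phi x * f x)%:E <=
       C%:E * Lp_norm q (enorm \o Phi) `^ alpha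
            * Lp_norm q (divergence Phi) `^ (1 - alpha))%E]].

Definition heat (t : R) f : 'rV[R]_n -> R := fun x =>
  (2 * pi * t) `^ (- (n%:R / 2)) *
  \int[lebesgue_rV R n]_y (f y * expR (- (enorm (x - y) ^+ 2 / (2 * t)))).

Definition U (p alpha : R) f : \bar R :=
  ereal_sup [set ((t `^ ((1 - alpha) / 2))%:E *
                  Lp_norm p%:E (enorm \o gradient (heat t f)))%E
            | t in [set t : R | 0 < t]].

End functionals.

(* Main.v *)
(* U <= n^((1-alpha)/2) V. If Psi is bounded and integrable, then
   int <grad P_t f, Psi> = - int f div (P_t Psi), where ||P_t Psi||_q <= ||Psi||_q and
   ||div P_t Psi||_q <= sqrt (n / t) ||Psi||_q by Young's inequality and the first moment
   of the Gaussian. Cutoffs turn P_t Psi into test fields, and the resulting bound on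
   int <grad P_t f, Psi> is dual to a bound on ||grad P_t f||_p.

   V <= (4 sqrt n / alpha + 1) U. For u = div Phi, the semigroup law and the fundamental
   theorem of calculus along segments give
     |int u P_s f - int u P_2s f| <= sqrt (n s) ||grad P_s f||_p ||u||_q
                                  <= sqrt n s^(alpha/2) U ||u||_q.
   Summing over s = t / 2, t / 4, ... bounds int u f - int u P_t f, while
   int u P_t f = - int <Phi, grad P_t f> <= t^(-(1-alpha)/2) U ||Phi||_q. The choice
   t = (||Phi||_q / ||u||_q)^2 concludes. *)

From HB Require Import structures.
Require Import Defs.
From mathcomp Require Import all_boot all_order all_algebra.
From mathcomp Require Import all_classical all_reals all_analysis.
From mathcomp Require Import measurable_realfun ring lra.
Set Implicit Arguments.
Unset Strict Implicit.
Unset Printing Implicit Defensive.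
Import Order.TTheory GRing.Theory Num.Theory.
Import numFieldNormedType.Exports.
Local Open Scope classical_set_scope.
Local Open Scope ring_scope.

(** * Measurability and invariance of Lebesgue measure on R^n *)

(** The normalisation of [heat] gives each coordinate variance [t], so |x| has first moment at most
    sqrt (n t) under the Gaussian; both factors sqrt n come from here. The differentiated kernel has
    size |x| / t times the Gaussian, hence mass at most sqrt (n / t), and the power of t in [U]
    cancels the one in (n / t)^((1-alpha)/2). Conversely, with r = 2^(-alpha/2) the dyadic
    increments sum to r / (1 - r) <= 4 / alpha; comparing times s and 2s replaces differentiation in
    time.

    The obstacle is that [f] is only in L^p while test fields need continuous partial derivatives of
    every order. Estimates are run on two dual classes, L^1 + L^oo for [f] and bounded integrable
    functions for what is paired with it, where all convolutions converge absolutely. Smoothness is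
    obtained algebraically: expanding |x - y|^2 writes [heat t f] as a Gaussian times a Laplace
    transform, and such functions generate, with the coordinates, an algebra closed under partial
    derivatives. As the norm at q = oo is a true supremum, convolution bounds are proved at every
    point. *)

Lemma continuous_measurable_rV (R : realType) n (f : 'rV[R]_n -> R) :
  continuous f -> measurable_fun [set: 'rV[R]_n] f.
Proof.
move=> /continuousP cf.
apply: (measurability _ (RGenOpens.measurableE R)).
move=> _ [_ [a [b ->] <-]]; rewrite setTI.
have oA : open (f @^-1` `]a, b[%classic) by exact/cf/interval_open.
move: (f @^-1` _) oA => A oA.
(* The sigma-algebra is generated by the coordinates, so the open set is written as the countable
   union of the cubes with rational centre and half-side 1 / (k + 1) that it contains. *)
pose box (k : 'rV[rat]_n * nat) := [set x : 'rV[R]_n |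
  forall i, `|x ord0 i - ratr (k.1 ord0 i)| < k.2.+1%:R^-1].
have mbox k : measurable (box k).
  rewrite (_ : box k = \big[setI/setT]_(i < n)
     ((fun x : 'rV[R]_n => `|x ord0 i - ratr (k.1 ord0 i)|) @^-1`
        `]-oo, k.2.+1%:R^-1[)); last first.
    rewrite -bigcap_seq; apply/seteqP; split => [x /= h i _|x /= h i].
      by rewrite /= in_itv/=.
    by have := h i (mem_index_enum i); rewrite /= in_itv.
  apply: bigsetI_measurable.
  move=> i _; rewrite -[X in measurable X]setTI.
  have mm : measurable_fun setT
      (fun x : 'rV[R]_n => `|x ord0 i - ratr (k.1 ord0 i)|).
    apply: measurableT_comp => //; apply: measurable_funB => //.
    exact: measurable_coord.
  exact: mm.
suff -> : A = \bigcup_k (if `[< box k `<=` A >] then box k else set0).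
  apply: countable_bigcupT_measurable; first exact: countableP.
  by move=> k; case: ifP.
apply/seteqP; split => [x Ax|x [k _]]; last by case: ifPn => // /asboolP; apply.
have /nbhs_ballP[e /= e0 eA] : nbhs x A by exact: open_nbhs_nbhs.
(* The factor 2 appears because [x] and [y] will both be within 1 / (k + 1) of a rational centre,
   hence within [e] of each other. *)
have [k ke] : exists k, k.+1%:R^-1 < e / 2.
  by have [k] := ltr_add_invr (divr_gt0 e0 (ltr0Sn _ 1)); rewrite add0r; exists k.
have /choice[q qP] : forall i : 'I_n, exists q : rat,
    `|x ord0 i - ratr q| < k.+1%:R^-1.
  move=> i; have k0 : 0 < k.+1%:R^-1 :> R by rewrite invr_gt0.
  have lt : x ord0 i - k.+1%:R^-1 < x ord0 i + k.+1%:R^-1.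
    by rewrite ltrD2l (lt_trans _ k0)// oppr_lt0.
  have [q /itvP qi] := rat_in_itvoo lt.
  by exists q; rewrite distrC ltr_distl !qi.
exists (\row_i q i, k) => //.
rewrite ifT; first by move=> i /=; rewrite mxE.
apply/asboolP => y /= yb; apply: eA; split => // i j.
rewrite /ball/= (ord1 i); have := yb j; have := qP j; rewrite mxE => h1 h2.
have -> : x ord0 j - y ord0 j =
  (x ord0 j - ratr (q j)) - (y ord0 j - ratr (q j)) by ring.
rewrite (le_lt_trans (ler_normB _ _))// (lt_le_trans (ltrD h1 h2))// [leRHS]splitr lerD// ltW//.
Qed.

Section integral_rV.
Context (R : realType).
Local Open Scope ereal_scope.

Lemma ge0_integral_rVS n (F : 'rV[R]_n.+1 -> \bar R) :
  measurable_fun [set: 'rV[R]_n.+1] F -> (forall x, 0 <= F x) ->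
  \int[lebesgue_rV R n.+1]_x F x =
  \int[lebesgue_measure]_t \int[lebesgue_rV R n]_y F (cons_rV (t, y)).
Proof.
move=> mF F0.
transitivity (\int[lebesgue_measure \x lebesgue_rV R n]_p F (cons_rV p)).
  rewrite -(@ge0_integral_pushforward _ _ _ _ _ _ (@measurable_cons_rV R n)
    (lebesgue_measure \x lebesgue_rV R n) setT F)//.
rewrite fubini_tonelli1//.
by apply: measurableT_comp => //; exact: measurable_cons_rV.
Qed.

(** Only [a = 1] and [a = -1] occur, so the preimage of a half-open interval is an interval of the
    same length, and a measure with these values on half-open intervals is Lebesgue measure. *)
Lemma lebesgue_measure_affine (a b : R) (A : set R) : (`|a| = 1)%R ->
  measurable A -> lebesgue_measure [set t | A (a * t + b)%R] =
  lebesgue_measure A.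
Proof.
move=> a1 mA.
have mf : measurable_fun setT (fun t : measurableTypeR R => (a * t + b)%R : measurableTypeR R).
  by apply: measurable_funD => //; exact: mulrl_measurable.
pose m := isMeasurableFun.Build _ _ _ _ _ mf.
pose f : {mfun measurableTypeR R >-> measurableTypeR R} := HB.pack (fun t : measurableTypeR R => (a * t + b)%R : measurableTypeR R) m.
apply/esym/(@lebesgue_measure_unique _ (pushforward lebesgue_measure f)) => // _ [[c d]] _ <-.
rewrite /pushforward/= lebesgue_measure_itv/= lte_fin.
have [a0|a0] := leP 0%R a.
  have {a0 a1} -> : a = 1%R by rewrite -a1 ger0_norm.
  rewrite /pushforward.
    rewrite (_ : (_ @^-1` _) = `](c - b)%R, (d - b)%R]%classic); last first.
    by apply/seteqP; split => t /=; rewrite !in_itv/= mul1r ltrBlDr lerBrDr.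
  rewrite lebesgue_measure_itv/= lte_fin ltrD2r.
  by case: ifP => // _; rewrite -!EFinB; congr EFin; ring.
have {a0 a1} -> : a = (-1)%R by rewrite -a1 ltr0_norm ?opprK.
rewrite /pushforward.
rewrite (_ : (_ @^-1` _) = `[(b - d)%R, (b - c)%R[%classic); last first.
  apply/seteqP; split => t /=; rewrite !in_itv/= mulN1r => /andP[? ?];
  apply/andP; split; lra.
rewrite lebesgue_measure_itv/= lte_fin ltrD2l ltrN2.
by case: ifP => // _; rewrite -!EFinB; congr EFin; ring.
Qed.

Lemma ge0_integral_affine1 (a b : R) (F : R -> \bar R) : (`|a| = 1)%R ->
  measurable_fun [set: R] F -> (forall x, 0 <= F x) ->
  \int[lebesgue_measure]_t F (a * t + b)%R = \int[lebesgue_measure]_t F t.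
Proof.
move=> a1 mF F0.
have mf : measurable_fun setT (fun t : measurableTypeR R => (a * t + b)%R : measurableTypeR R).
  by apply: measurable_funD => //; exact: mulrl_measurable.
rewrite -(@ge0_integral_pushforward _ _ _ _ _ _ mf lebesgue_measure setT F)//.
by apply: eq_measure_integral => A mA _; exact: lebesgue_measure_affine.
Qed.

Lemma measurable_affine_rV n (a : R) (z : 'rV[R]_n) :
  measurable_fun setT (fun x : 'rV[R]_n => (a *: x + z)%R).
Proof.
apply: measurable_fun_rV => i.
rewrite (_ : (fun _ => _) = (fun x : 'rV[R]_n => a * x ord0 i + z ord0 i)%R).
  by apply: measurable_funD => //; apply: measurable_funM => //; exact: measurable_coord.
by apply/funext => x; rewrite !mxE.
Qed.

(** Induction on the dimension peels off one coordinate by Tonelli. With |a| = 1 there is no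
    Jacobian, and translations and the reflection x -> z - x are covered together. *)
Lemma ge0_integral_affine n (a : R) (z : 'rV[R]_n) (F : 'rV[R]_n -> \bar R) :
  (`|a| = 1)%R -> measurable_fun setT F -> (forall x, 0 <= F x) ->
  \int[lebesgue_rV R n]_x F (a *: x + z)%R = \int[lebesgue_rV R n]_x F x.
Proof.
move=> a1; elim: n z F => [|n IH] z F mF F0.
  apply: eq_integral => x _; congr F; apply/rowP => -[] //.
rewrite ge0_integral_rVS//; last first.
  by apply: measurableT_comp => //; exact: measurable_affine_rV.
rewrite [RHS]ge0_integral_rVS//.
have mF2 : measurable_fun setT (fun t => \int[lebesgue_rV R n]_y F (cons_rV (t, y))).
  apply: (@measurable_fun_fubini_tonelli_F _ _ (measurableTypeR R) _ R (lebesgue_rV R n) (fun p => F (cons_rV p))) => //.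
  by apply: measurableT_comp => //; exact: measurable_cons_rV.
rewrite -(ge0_integral_affine1 (z ord0 ord0) a1 mF2); last first.
  by move=> x; exact: integral_ge0.
apply: eq_integral => t _.
rewrite -(IH (rsubmx (z : 'rV_(1 + n))) (fun y => F (cons_rV (a * t + z ord0 ord0, y))%R)) //; last first.
  apply: (@measurableT_comp _ _ _ _ _ _ F _ (fun y => cons_rV (a * t + z ord0 ord0, y)%R)) => //.
  exact: (measurableT_comp (@measurable_cons_rV R n) (measurable_pair1 (a * t + z ord0 ord0 : measurableTypeR R)%R)).
apply: eq_integral => y _; congr F; apply/rowP => i.
case: (unliftP ord0 i) => [j|] ->.
  rewrite cons_rVS [LHS]mxE [X in (X + _)%R]mxE cons_rVS /= !mxE.
  by congr (_ + z _ _)%R; exact/val_inj.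
by rewrite cons_rV0 [LHS]mxE [X in (X + _)%R]mxE cons_rV0.
Qed.

Lemma integral_affine n (a : R) (z : 'rV[R]_n) (F : 'rV[R]_n -> \bar R) :
  (`|a| = 1)%R -> measurable_fun setT F ->
  \int[lebesgue_rV R n]_x F (a *: x + z)%R = \int[lebesgue_rV R n]_x F x.
Proof.
move=> a1 mF; rewrite integralE [RHS]integralE.
congr (_ - _).
  rewrite -[RHS](ge0_integral_affine z a1 (measurable_funepos mF)) => [|x].
    by apply: eq_integral => x _; rewrite !funeposE.
  exact: funepos_ge0.
rewrite -[RHS](ge0_integral_affine z a1 (measurable_funeneg mF)) => [|x].
  by apply: eq_integral => x _; rewrite !funenegE.
exact: funeneg_ge0.
Qed.

Lemma integral_translate n (z : 'rV[R]_n) (F : 'rV[R]_n -> \bar R) :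
  measurable_fun setT F ->
  \int[lebesgue_rV R n]_x F (x + z)%R = \int[lebesgue_rV R n]_x F x.
Proof.
move=> mF; rewrite -(integral_affine z (normr1 _) mF).
by apply: eq_integral => x _; rewrite scale1r.
Qed.

Lemma integral_reflect n (z : 'rV[R]_n) (F : 'rV[R]_n -> \bar R) :
  measurable_fun setT F ->
  \int[lebesgue_rV R n]_x F (z - x)%R = \int[lebesgue_rV R n]_x F x.
Proof.
move=> mF; rewrite -(integral_affine z (normrN1 _) mF).
by apply: eq_integral => x _; rewrite scaleN1r addrC.
Qed.

End integral_rV.

(** * Elementary inequalities for the exponential *)

Lemma expR_ge_taylor2 (R : realType) (y : R) : 0 <= y ->
  1 + y + y ^+ 2 / 2 <= expR y.
Proof.
move=> y0.
pose f (t : R) := expR t - (1 + t + t ^+ 2 / 2).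
have df (t : R) : is_derive t 1 f (expR t - (1 + t)).
  by apply: is_derive_eq; rewrite /GRing.scale/=; field.
suff : f 0 <= f y by rewrite /f expR0; lra.
apply: (@ger0_derive1_ndecry _ f 0) => //.
- move=> x _; rewrite derive1E (@derive_val _ _ _ _ _ _ _ (df x)) subr_ge0.
  exact: expR_ge1Dx.
- apply: continuous_subspaceT => x.
  by apply/differentiable_continuous/derivable1_diffP.
Qed.

(** This is cosh x >= 1 + x^2 / 2. With z = y / 2 one has e^y + e^-y - 2 = (e^z - e^-z)^2, so it
    suffices to square sinh z >= z. *)
Lemma cosh_ge (R : realType) (x : R) : 2 + x ^+ 2 <= expR x + expR (- x).
Proof.
suff H (y : R) : 0 <= y -> 2 + y ^+ 2 <= expR y + expR (- y).
  have [/H//|/ltW x0] := leP 0 x.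
  by have := H (- x); rewrite oppr_ge0 opprK sqrrN => /(_ x0); lra.
move=> y0.
have E1 := @expR_ge_taylor2 R (y / 2) (divr_ge0 y0 (ler0n _ 2)).
have -> : y = y / 2 + y / 2 by rewrite -splitr.
rewrite opprD !expRD !expRN; move: E1; move: (y / 2) (divr_ge0 y0 (ler0n R 2)) (expR_gt0 (y / 2)) => z z0.
move: (expR z) => E E0 E1.
suff H : 2 * z <= E - E^-1.
  have := ler_pM (mulr_ge0 (ler0n R 2) z0) (mulr_ge0 (ler0n R 2) z0) H H.
  have -> : (E - E^-1) * (E - E^-1) = E * E + E^-1 * E^-1 - 2.
    by field; rewrite gt_eqF.
  lra.
have A0 : 0 < 1 + z + z ^+ 2 / 2 by nra.
have : E^-1 <= (1 + z + z ^+ 2 / 2)^-1 by rewrite lef_pV2.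
suff : 2 * z <= (1 + z + z ^+ 2 / 2) - (1 + z + z ^+ 2 / 2)^-1 by lra.
rewrite -(ler_pM2r A0) mulrBl mulVf ?gt_eqF//.
(* The two sides differ by exactly z^4 / 4. *)
have : 0 <= z ^+ 4 by exact: exprn_ge0.
nra.
Qed.

(** * Euclidean inner product and norm *)

Section enorm.
Context (R : realType) (n : nat).
Implicit Types x y z : 'rV[R]_n.

Definition dotp x y := \sum_(i < n) x ord0 i * y ord0 i.

Lemma enorm_ge0 x : 0 <= enorm x. Proof. exact: sqrtr_ge0. Qed.

Lemma enorm_sqr x : enorm x ^+ 2 = dotp x x.
Proof.
rewrite /enorm sqr_sqrtr; first by apply: eq_bigr => i _; rewrite expr2.
by apply: sumr_ge0 => i _; exact: sqr_ge0.
Qed.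

Lemma dotpC x y : dotp x y = dotp y x.
Proof. by apply: eq_bigr => i _; rewrite mulrC. Qed.

Lemma dotpDl x y z : dotp (x + y) z = dotp x z + dotp y z.
Proof. by rewrite -big_split; apply: eq_bigr => i _; rewrite mxE mulrDl. Qed.

Lemma dotpZl a x y : dotp (a *: x) y = a * dotp x y.
Proof. by rewrite mulr_sumr; apply: eq_bigr => i _; rewrite mxE mulrA. Qed.

Lemma dotpDr x y z : dotp z (x + y) = dotp z x + dotp z y.
Proof. by rewrite dotpC dotpDl !(dotpC z). Qed.

Lemma dotpZr a x y : dotp y (a *: x) = a * dotp y x.
Proof. by rewrite dotpC dotpZl !(dotpC y). Qed.

Lemma dotpNl x y : dotp (- x) y = - dotp x y.
Proof. by rewrite -scaleN1r dotpZl mulN1r. Qed.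

Lemma dotpNr x y : dotp y (- x) = - dotp y x.
Proof. by rewrite -scaleN1r dotpZr mulN1r. Qed.

Lemma dotp_ge0 x : 0 <= dotp x x.
Proof. by rewrite -enorm_sqr sqr_ge0. Qed.

Lemma dotp_delta x i : dotp x (delta_mx ord0 i) = x ord0 i.
Proof.
rewrite /dotp (bigD1 i)//= big1 ?addr0; first by rewrite mxE !eqxx mulr1.
by move=> j ji; rewrite mxE (negbTE ji) andbF mulr0.
Qed.

Lemma enormN x : enorm (- x) = enorm x.
Proof. by congr Num.sqrt; apply: eq_bigr => i _; rewrite mxE sqrrN. Qed.

Lemma enorm0 : enorm (0 : 'rV[R]_n) = 0.
Proof. by apply/eqP; rewrite -sqrf_eq0 enorm_sqr /dotp big1// => i _; rewrite mxE mul0r. Qed.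

Lemma enormZ a x : enorm (a *: x) = `|a| * enorm x.
Proof.
rewrite /enorm -sqrtr_sqr -sqrtrM ?sqr_ge0// mulr_sumr.
by congr Num.sqrt; apply: eq_bigr => i _; rewrite mxE exprMn.
Qed.

Lemma coord_le_enorm x i : `|x ord0 i| <= enorm x.
Proof.
rewrite -ler_sqr ?nnegrE ?enorm_ge0// enorm_sqr -normrX ger0_norm ?sqr_ge0//.
rewrite /dotp (bigD1 i)//= expr2 lerDl.
by apply: sumr_ge0 => j _; rewrite -expr2 sqr_ge0.
Qed.

Lemma enorm_eq0 x : enorm x = 0 -> x = 0.
Proof.
move=> x0; apply/rowP => i; rewrite mxE; apply/eqP.
by rewrite -normr_eq0 eq_le normr_ge0 andbT (le_trans (coord_le_enorm x i))// x0.
Qed.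

(** Cauchy-Schwarz, by expanding the square of the norm of |y| x - |x| y and dividing by |x| |y|;
    this division is why the degenerate cases are treated apart. *)
Lemma dotp_le_enorm x y : `|dotp x y| <= enorm x * enorm y.
Proof.
wlog: x / 0 <= dotp x y => [H|xy].
  have [/H//|/ltW] := leP 0 (dotp x y); rewrite -oppr_ge0 -dotpNl => /H.
  by rewrite dotpNl normrN enormN.
rewrite ger0_norm//.
have [x0|x0] := eqVneq (enorm x) 0.
  by rewrite (enorm_eq0 x0) /dotp big1 ?mulr_ge0 ?enorm_ge0// => i _; rewrite mxE mul0r.
have [y0|y0] := eqVneq (enorm y) 0.
  by rewrite (enorm_eq0 y0) /dotp big1 ?mulr_ge0 ?enorm_ge0// => i _; rewrite mxE mulr0.
have := dotp_ge0 (enorm y *: x - enorm x *: y).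
rewrite !(dotpDl, dotpDr, dotpNl, dotpNr, dotpZl, dotpZr) -!enorm_sqr (dotpC y x).
have px : 0 < enorm x by rewrite lt0r x0 enorm_ge0.
have py : 0 < enorm y by rewrite lt0r y0 enorm_ge0.
have xy0 : 0 < enorm x * enorm y by exact: mulr_gt0.
move: (enorm x) (enorm y) xy0 => a b ab h.
rewrite -(ler_pM2l ab).
nra.
Qed.

Lemma enorm_triangle x y : enorm (x + y) <= enorm x + enorm y.
Proof.
rewrite -ler_sqr ?nnegrE ?addr_ge0 ?enorm_ge0// enorm_sqr !(dotpDl, dotpDr).
rewrite -!enorm_sqr (dotpC y x) sqrrD.
have := le_trans (ler_norm _) (dotp_le_enorm x y); lra.
Qed.

End enorm.

Section continuity.
Context (R : realType) (n : nat).

Lemma continuous_sum_rV (I : Type) (s : seq I) (F : I -> 'rV[R]_n -> R) :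
  (forall i, continuous (F i)) -> continuous (fun x => \sum_(i <- s) F i x).
Proof.
by move=> cF; apply: continuous_big => //; exact: add_continuous.
Qed.

Lemma continuous_enorm : continuous (@enorm R n).
Proof.
move=> x; apply: continuous_comp; last exact: sqrt_continuous.
apply: continuous_sum_rV => i y.
apply: (@continuous_comp _ _ _ (fun x : 'rV[R]_n => x ord0 i) (fun t => t ^+ 2)).
  exact: coord_continuous.
exact: exprn_continuous.
Qed.

Lemma measurable_enorm : measurable_fun setT (@enorm R n).
Proof. exact: (continuous_measurable_rV continuous_enorm). Qed.

End continuity.

(** * The Gaussian kernel: mass, semigroup identity and moments *)

Definition gauss (R : realType) n (s : R) (z : 'rV[R]_n) : R :=
  (2 * pi * s) `^ (- (n%:R / 2)) * expR (- (enorm z ^+ 2 / (2 * s))).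

Section gauss.
Context (R : realType) (n : nat).
Variable s : R.
Hypothesis s0 : 0 < s.
Implicit Types z : 'rV[R]_n.
Local Notation mu := (lebesgue_rV R n).

Lemma gauss_gt0 z : 0 < gauss s z.
Proof. by rewrite mulr_gt0 ?expR_gt0// powR_gt0// !mulr_gt0// pi_gt0. Qed.

Lemma gauss_ge0 z : 0 <= gauss s z.
Proof. exact/ltW/gauss_gt0. Qed.

Lemma gaussN z : gauss s (- z) = gauss s z.
Proof. by rewrite /gauss enormN. Qed.

Lemma continuous_gauss : continuous (@gauss R n s).
Proof.
move=> x; apply: (@continuousM _ _ (cst _)
  (fun z => expR (- (enorm z ^+ 2 / (2 * s))))); first exact: cst_continuous.
apply: (@continuous_comp _ _ _ (fun z => - (enorm z ^+ 2 / (2 * s))) expR);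
  last exact: continuous_expR.
apply: (@continuousN _ _ _ (fun z => enorm z ^+ 2 / (2 * s))).
apply: (@continuousM _ _ (fun z => enorm z ^+ 2) (cst (2 * s)^-1));
  last exact: cst_continuous.
apply: (@continuous_comp _ _ _ (@enorm R n) (fun t => t ^+ 2)).
  exact: continuous_enorm.
exact: exprn_continuous.
Qed.

Lemma measurable_gauss : measurable_fun setT (@gauss R n s).
Proof. exact: (continuous_measurable_rV continuous_gauss). Qed.

Lemma gauss_le z : gauss s z <= (2 * pi * s) `^ (- (n%:R / 2)).
Proof.
rewrite ler_piMr ?powR_ge0// expR_le1 oppr_le0 divr_ge0 ?sqr_ge0//.
by rewrite mulr_ge0// ltW.
Qed.

End gauss.

(** Reduces the normalisation to the one-dimensional normal density with standard deviation sqrt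
    s. *)
Lemma gauss_prod (R : realType) n (s : R) (z : 'rV[R]_n) : 0 < s ->
  gauss s z = \prod_(i < n) normal_pdf 0 (Num.sqrt s) (z ord0 i).
Proof.
move=> s0.
have s00 : Num.sqrt s != 0 by rewrite gt_eqF ?sqrtr_gt0.
rewrite normal_pdfE//= big_split/= /gauss; congr (_ * _).
  rewrite prodr_const card_ord /normal_peak sqr_sqrtr ?ltW//.
  rewrite -powR12_sqrt; last by rewrite mulrn_wge0 ?mulr_ge0 ?ltW// pi_gt0.
  rewrite -powRN -powR_mulrn ?powR_ge0// -powRrM; congr (_ `^ _).
    by rewrite -mulr_natr; ring.
  by field.
rewrite /normal_fun -expR_sum; congr expR.
rewrite enorm_sqr mulr_suml -sumrN.
apply: eq_bigr => i _; rewrite subr0 sqr_sqrtr ?ltW//.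
by rewrite -[s *+ 2]mulr_natl expr2 mulNr.
Qed.

Lemma integral_gauss (R : realType) n (s : R) : 0 < s ->
  (\int[lebesgue_rV R n]_z (gauss s z)%:E = 1)%E.
Proof.
move=> s0; elim: n => [|n IH].
  rewrite /= integral_dirac//= ?diracT; last by apply/measurable_EFinP; exact: measurable_gauss.
  by rewrite gauss_prod// big_ord0 mul1e.
rewrite ge0_integral_rVS; last 2 first.
- by apply/measurable_EFinP; exact: measurable_gauss.
- by move=> x; rewrite lee_fin gauss_ge0.
under eq_integral => t _.
  under eq_integral => y _.
    rewrite gauss_prod// big_ord_recl cons_rV0/=.
    under eq_bigr do rewrite cons_rVS/=.
    rewrite -gauss_prod// EFinM.
    over.
  rewrite ge0_integralZl_EFin//; last first.
  - by rewrite normal_pdf_ge0.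
  - by apply/measurable_EFinP; exact: measurable_gauss.
  - by move=> y _; rewrite lee_fin gauss_ge0.
  rewrite IH mule1.
  over.
exact: integral_normal_pdf.
Qed.

Lemma gauss_shift (R : realType) n (s : R) (z : 'rV[R]_n) (w : R) i : 0 < s ->
  gauss s (z + w *: delta_mx ord0 i) =
  gauss s z * expR (- (z ord0 i * w / s)) * expR (- (w ^+ 2 / (2 * s))).
Proof.
move=> s0; rewrite /gauss -[RHS]mulrA -expRD -[RHS]mulrA -expRD; congr (_ * expR _).
rewrite !enorm_sqr dotpDl !dotpDr !(dotpZl, dotpZr) (dotpC (delta_mx _ _) z).
by rewrite !dotp_delta mxE !eqxx mulr1; field; rewrite gt_eqF.
Qed.

(** The parallelogram law |x - y|^2 + |y - z|^2 = |x - z|^2 / 2 + 2 |y - (x + z) / 2|^2 leaves [y]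
    in a single Gaussian, so integrating over [y] gives P_s P_s = P_2s. *)
Lemma gauss_parallelogram (R : realType) n (s : R) (x y z : 'rV[R]_n) : 0 < s ->
  gauss s (x - y) * gauss s (y - z) =
  gauss (2 * s) (x - z) * gauss (s / 2) (y - 2^-1 *: (x + z)).
Proof.
move=> s0; rewrite /gauss mulrACA [RHS]mulrACA -!expRD.
have p0 := @pi_gt0 R.
congr (_ * expR _).
  rewrite -!powRM ?mulr_ge0 ?divr_ge0 ?(ltW p0) ?(ltW s0)//.
  by congr (_ `^ _); field.
rewrite !enorm_sqr.
rewrite !(dotpDl, dotpDr, dotpNl, dotpNr, dotpZl, dotpZr).
rewrite (dotpC y x) (dotpC z x) (dotpC z y).
by field; rewrite gt_eqF.
Qed.

Section moments.
Context (R : realType) (n : nat).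
Variable s : R.
Hypothesis s0 : 0 < s.
Implicit Types z : 'rV[R]_n.
Local Notation mu := (lebesgue_rV R n).

(* The Gaussian integrals translated by w e_i and - w e_i are both 1, and
   e^x + e^-x >= 2 + x^2 extracts the second moment from their sum, up to an error that
   vanishes as w tends to 0. *)
Lemma gauss_coord_moment2 (i : 'I_n) :
  (\int[mu]_z (gauss s z * z ord0 i ^+ 2)%:E <= s%:E)%E.
Proof.
have mg : measurable_fun setT (fun z : 'rV[R]_n => gauss s z) by exact: measurable_gauss.
have mc : measurable_fun setT (fun z : 'rV[R]_n => z ord0 i) by exact: measurable_coord.
have mF : measurable_fun setT (fun z => (gauss s z * z ord0 i ^+ 2)%:E).
  by apply/measurable_EFinP; apply: measurable_funM => //; exact: measurable_funX.
have FF0 z : 0 <= gauss s z * z ord0 i ^+ 2 by rewrite mulr_ge0 ?sqr_ge0 ?gauss_ge0.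
have F0 z : (0 <= (gauss s z * z ord0 i ^+ 2)%:E)%E by rewrite lee_fin.
set M := (\int[mu]_z _)%E.
have M0 : (0 <= M)%E by exact: integral_ge0.
have key a : 0 < a -> a < 1 -> (M * (2 * a / s)%:E <= (2 * (expR a - 1))%:E)%E.
  (* The shift is chosen so that the factor exp (- w^2 / (2 s)) in [gauss_shift] becomes e^-a. *)
  move=> a0 a1; pose w := Num.sqrt (2 * s * a).
  have ww : w ^+ 2 = 2 * s * a by rewrite sqr_sqrtr// !mulr_ge0// ltW.
  have Iw u : (\int[mu]_z (gauss s (z + u *: delta_mx ord0 i))%:E = 1)%E.
    apply: etrans (integral_gauss n s0).
    apply: (integral_translate (u *: delta_mx ord0 i) (F := EFin \o gauss s)).
    exact/measurable_EFinP.
  have c1 : 0 <= 2 * expR (- a) by rewrite mulr_ge0// expR_ge0.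
  have c2 : 0 <= expR (- a) * (2 * a / s).
    by rewrite !mulr_ge0 ?expR_ge0 ?invr_ge0// ltW.
  have : (\int[mu]_z ((2 * expR (- a))%:E * (gauss s z)%:E +
      (expR (- a) * (2 * a / s))%:E * (gauss s z * z ord0 i ^+ 2)%:E) <=
    \int[mu]_z ((gauss s (z + w *: delta_mx ord0 i))%:E +
       (gauss s (z + (- w) *: delta_mx ord0 i))%:E))%E.
    apply: ge0_le_integral => //.
    - by move=> z _; apply: adde_ge0; apply: mule_ge0 => //; rewrite lee_fin gauss_ge0.
    - by apply: emeasurable_funD; apply: measurable_funeM => //; apply/measurable_EFinP.
    - apply: emeasurable_funD; apply/measurable_EFinP; apply: measurableT_comp => //;
      under eq_fun do rewrite -[X in X + _]scale1r; exact: measurable_affine_rV.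
    - move=> z _; rewrite -!EFinM -!EFinD lee_fin !gauss_shift//.
      rewrite sqrrN ww.
      have -> : 2 * s * a / (2 * s) = a by field; rewrite gt_eqF.
      have -> : z ord0 i * - w / s = - (z ord0 i * w / s) by ring.
      rewrite opprK -mulrDl -mulrDr.
      have := cosh_ge (z ord0 i * w / s); rewrite [expR _ + _]addrC => h.
      have -> : 2 * expR (- a) * gauss s z +
         expR (- a) * (2 * a / s) * (gauss s z * z ord0 i ^+ 2) =
         gauss s z * (2 + (z ord0 i * w / s) ^+ 2) * expR (- a).
        by rewrite !exprMn ww; field; rewrite gt_eqF.
      by rewrite ler_wpM2r ?expR_ge0// ler_wpM2l// gauss_ge0.
  rewrite ge0_integralD//; last first.
  - by apply: measurable_funeM => //; apply/measurable_EFinP.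
  - by move=> z _; apply: mule_ge0.
  - by apply: measurable_funeM => //; apply/measurable_EFinP.
  - by move=> z _; apply: mule_ge0 => //; rewrite lee_fin gauss_ge0.
  rewrite [X in (_ <= X)%E]ge0_integralD//; last first.
  - apply/measurable_EFinP; apply: measurableT_comp => //;
    under eq_fun do rewrite -[X in X + _]scale1r; exact: measurable_affine_rV.
  - by move=> z _; rewrite lee_fin gauss_ge0.
  - apply/measurable_EFinP; apply: measurableT_comp => //;
    under eq_fun do rewrite -[X in X + _]scale1r; exact: measurable_affine_rV.
  - by move=> z _; rewrite lee_fin gauss_ge0.
  rewrite !Iw ge0_integralZl_EFin//; last 2 first.
  - by move=> z _; rewrite lee_fin gauss_ge0.
  - by apply/measurable_EFinP.
  rewrite (integral_gauss n s0) mule1 ge0_integralZl_EFin//.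
  rewrite -/M; case: M M0 => [m| |]//.
    rewrite -!EFinM -!EFinD !lee_fin => m0.
    rewrite expRN; have := expR_gt0 a; move: (expR a) => E E0.
    rewrite -(ler_pM2l E0).
    have -> : E * (2 * E^-1 + E^-1 * (2 * a / s) * m) = 2 + 2 * a / s * m.
      by field; rewrite !gt_eqF.
    lra.
  rewrite gt0_muley ?lte_fin ?mulr_gt0 ?expR_gt0 ?invr_gt0//.
(* The inequality at a = 1/2 already forces the moment to be finite. *)
have [m mE] : exists m, M = m%:E.
  have := key (1 / 2) (divr_gt0 ltr01 (ltr0n _ 2)) _.
  case: M M0 key => [m _ _ _|_ _ |//]; first by exists m.
  rewrite gt0_mulye ?lte_fin ?mulr_gt0 ?divr_gt0 ?invr_gt0//.
  by move=> /(_ _) -/(_ ltac:(lra)).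
rewrite mE lee_fin; rewrite mE in key.
have {}key a : 0 < a -> a < 1 -> m * (1 - a) <= s.
  move=> a0 a1; have := key a a0 a1; rewrite -EFinM lee_fin => h.
  have h2 : expR a <= (1 - a)^-1.
    rewrite -[expR a]invrK -expRN lef_pV2 ?posrE ?expR_gt0 ?subr_gt0//.
    exact: expR_ge1Dx.
  have a1' : 0 < 1 - a by rewrite subr_gt0.
  have h3 : m * (2 * a / s) <= 2 * ((1 - a)^-1 - 1) by nra.
  have e3 : (1 - a)^-1 - 1 = a / (1 - a) by field; rewrite gt_eqF.
  rewrite e3 in h3.
  have sa : 0 < s * (1 - a) / (2 * a) by rewrite divr_gt0 ?mulr_gt0.
  move: h3; rewrite -(ler_pM2r sa).
  have -> : m * (2 * a / s) * (s * (1 - a) / (2 * a)) = m * (1 - a).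
    by field; rewrite !gt_eqF.
  have -> : 2 * (a / (1 - a)) * (s * (1 - a) / (2 * a)) = s.
    by field; rewrite !gt_eqF.
  by [].
(* In place of the limit a -> 0: if m exceeded s, the choice a = (m - s) / (2 m) would give m (1 -
   a) = (m + s) / 2 > s. *)
rewrite leNgt; apply/negP => sm.
have m0 : 0 < m by exact: lt_trans sm.
have a0 : 0 < (m - s) / (2 * m) by rewrite divr_gt0 ?subr_gt0 ?mulr_gt0.
have a1 : (m - s) / (2 * m) < 1 by rewrite ltr_pdivrMr ?mulr_gt0//; move: s0 m0; lra.
have := key _ a0 a1.
have -> : m * (1 - (m - s) / (2 * m)) = (m + s) / 2 by field; rewrite gt_eqF.
lra.
Qed.

Lemma gauss_moment2 :
  (\int[mu]_z (gauss s z * enorm z ^+ 2)%:E <= (n%:R * s)%:E)%E.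
Proof.
have -> : (\int[mu]_z (gauss s z * enorm z ^+ 2)%:E =
  \int[mu]_z \sum_(i < n) (gauss s z * z ord0 i ^+ 2)%:E)%E.
  apply: eq_integral => z _; rewrite enorm_sqr mulr_sumr -sumEFin.
  by apply: eq_bigr => i _; rewrite expr2.
rewrite ge0_integral_sum//; last first.
  - by move=> i z _; rewrite lee_fin mulr_ge0 ?sqr_ge0 ?gauss_ge0.
  - move=> i; apply/measurable_EFinP; apply: measurable_funM; first exact: measurable_gauss.
    by apply: measurable_funX; exact: measurable_coord.
have -> : (n%:R * s)%:E = (\sum_(i < n) s%:E)%E.
  by rewrite sumEFin sumr_const card_ord mulr_natl.
by apply: lee_sum => i _; exact: gauss_coord_moment2.
Qed.

(** A pointwise substitute for Cauchy-Schwarz on integrals: |z| <= r / 2 + |z|^2 / (2 r), with r =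
    sqrt (n s) chosen so that each term contributes at most r / 2. *)
Lemma gauss_moment1 :
  (\int[mu]_z (gauss s z * enorm z)%:E <= (Num.sqrt (n%:R * s))%:E)%E.
Proof.
have mg := @measurable_gauss R n s.
have me := @measurable_enorm R n.
case: (posnP n) => [n0|n_gt0].
  have e0 z : enorm z = 0 by apply/eqP; rewrite -sqrf_eq0 enorm_sqr /dotp; subst n; rewrite big_ord0.
  rewrite (eq_integral (cst 0%E)) ?integral0 ?lee_fin ?sqrtr_ge0// => z _.
  by rewrite e0 mulr0.
set r := Num.sqrt _.
have r0 : 0 < r by rewrite sqrtr_gt0 mulr_gt0// ltr0n.
have rr : r ^+ 2 = n%:R * s by rewrite sqr_sqrtr// mulr_ge0// ltW.
have mG : measurable_fun setT (fun z => (gauss s z)%:E) by apply/measurable_EFinP.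
have mH : measurable_fun setT (fun z => (gauss s z * enorm z ^+ 2)%:E).
  by apply/measurable_EFinP; apply: measurable_funM => //; exact: measurable_funX.
have G0 z : (0 <= (gauss s z)%:E)%E by rewrite lee_fin gauss_ge0.
have H0 z : (0 <= (gauss s z * enorm z ^+ 2)%:E)%E.
  by rewrite lee_fin mulr_ge0 ?gauss_ge0 ?sqr_ge0.
have k1 : 0 <= r / 2 by rewrite divr_ge0// ltW.
have k2 : 0 <= (2 * r)^-1 by rewrite invr_ge0 mulr_ge0// ltW.
have : (\int[mu]_z (gauss s z * enorm z)%:E <=
  \int[mu]_z ((r / 2)%:E * (gauss s z)%:E + (2 * r)^-1%:E * (gauss s z * enorm z ^+ 2)%:E))%E.
  apply: ge0_le_integral => //.
  - by move=> z _; rewrite lee_fin mulr_ge0 ?gauss_ge0 ?enorm_ge0.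
  - by apply/measurable_EFinP; exact: measurable_funM.
  - by apply: emeasurable_funD; exact: measurable_funeM.
  - move=> z _; rewrite -!EFinM -EFinD lee_fin.
    rewrite [leRHS](_ : _ = gauss s z * (r / 2 + (2 * r)^-1 * enorm z ^+ 2)); last ring.
    rewrite ler_wpM2l ?gauss_ge0//.
    (* AM-GM: [2 |z| <= r + |z|^2 / r] *)
    rewrite -subr_ge0 [leRHS](_ : _ = (enorm z - r) ^+ 2 / (2 * r)).
      by rewrite divr_ge0 ?sqr_ge0// mulr_ge0// ltW.
    by field; rewrite gt_eqF.
move/le_trans; apply.
have Hk z : (0 <= (2 * r)^-1%:E * (gauss s z * enorm z ^+ 2)%:E)%E by apply: mule_ge0.
have Gk z : (0 <= (r / 2)%:E * (gauss s z)%:E)%E by apply: mule_ge0.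
rewrite ge0_integralD//; last 2 first.
- exact: measurable_funeM.
- exact: measurable_funeM.
rewrite !ge0_integralZl_EFin//.
rewrite (integral_gauss n s0) mule1.
apply: (@le_trans _ _ ((r / 2)%:E + ((2 * r)^-1)%:E * (n%:R * s)%:E)%E).
  by rewrite leeD2l// lee_wpmul2l ?gauss_moment2// lee_fin invr_ge0 mulr_ge0// ltW.
rewrite -EFinM -EFinD lee_fin -rr.
by rewrite le_eqVlt; apply/orP; left; apply/eqP; field; rewrite gt_eqF.
Qed.

End moments.

(** * Smoothness of heat extensions *)

Section derivatives.
Context (R : realType) (V : normedModType R).
Implicit Types (f : V -> R) (x v : V).

(** One criterion serves parametric integrals, [flat] at the origin and functions vanishing around a
    point: a quadratic remainder for steps |h| <= 1, with a constant allowed to depend on the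
    point. *)
Lemma is_derive_quadratic f x v (d C : R) :
  (forall h : R, `|h| <= 1 -> `|f (h *: v + x) - f x - h * d| <= C * h ^+ 2) ->
  is_derive x v f d.
Proof.
move=> H.
have C0 : 0 <= C.
  by have := le_trans (normr_ge0 _) (H 1 _); rewrite normr1 expr1n mulr1; exact.
suff cv : h^-1 *: ((f \o shift x) (h *: v) - f x) @[h --> 0^'] --> d.
  by apply: DeriveDef; [apply/cvg_ex; exists d|exact/cvg_lim].
apply/cvgrPdist_le => e e0; near=> h.
have h0 : h != 0 by near: h; exact: nbhs_dnbhs_neq.
rewrite distrC /= -[d](mulKf h0) -[_ *: _]/(_ * _) -mulrBr normrM normfV.
rewrite ler_pdivrMl ?normr_gt0// (le_trans (H _ _))//.
  by near: h; apply: dnbhs0_le.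
rewrite -[h ^+ 2]ger0_norm ?sqr_ge0// normrX expr2 mulrA mulrC ler_wpM2l//.
rewrite (@le_trans _ _ ((C + 1) * `|h|)) ?ler_wpM2r ?lerDl//.
rewrite -ler_pdivlMl ?ltr_wpDl// mulrC.
by near: h; apply: dnbhs0_le; rewrite divr_gt0// ltr_wpDl.
Unshelve. all: by end_near. Qed.

Lemma is_derive_line f x v (d : R) :
  is_derive (0 : R) 1 (fun h : R => f (h *: v + x)) d -> is_derive x v f d.
Proof.
have E : (fun h : R => h^-1 *: ((f \o shift x) (h *: v) - f x)) =
  (fun h : R => h^-1 *: (((fun h : R => f (h *: v + x)) \o shift (0 : R)) (h *: 1) -
     (fun h : R => f (h *: v + x)) 0)).
  apply/funext => h /=.
  by rewrite addr0 scale0r add0r [h *: 1]mulr1.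
by move=> [ex val]; apply: DeriveDef; rewrite /derivable /derive E.
Qed.

Lemma is_derive_at_line f x v (d : R) (h0 : R) : is_derive (h0 *: v + x) v f d ->
  is_derive h0 1 (fun h : R => f (h *: v + x)) d.
Proof.
have E : (fun h : R => h^-1 *: ((f \o shift (h0 *: v + x)) (h *: v) - f (h0 *: v + x))) =
  (fun h : R => h^-1 *: (((fun h : R => f (h *: v + x)) \o shift h0) (h *: 1) -
     (fun h : R => f (h *: v + x)) h0)).
  apply/funext => h /=.
  by rewrite [h *: 1]mulr1 scalerDl addrA.
by move=> [ex val]; apply: DeriveDef; rewrite /derivable /derive -E.
Qed.

End derivatives.

Section smooth_algebra.
Context (R : realType) (n : nat).
Implicit Types (g : 'rV[R]_n -> R).

Inductive algebra_of (G : set ('rV[R]_n -> R)) : set ('rV[R]_n -> R) :=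
| algebra_base g : G g -> algebra_of G g
| algebra_cst (c : R) : algebra_of G (cst c)
| algebraD f g : algebra_of G f -> algebra_of G g -> algebra_of G (f \+ g)
| algebraM f g : algebra_of G f -> algebra_of G g -> algebra_of G (f \* g).

Definition derivation_stable (G : set ('rV[R]_n -> R)) := forall g, G g ->
  continuous g /\ forall i : 'I_n, exists2 dg, algebra_of G dg &
    forall x, is_derive x (delta_mx ord0 i) g (dg x).

Lemma algebra_of_stable G g : derivation_stable G -> algebra_of G g ->
  continuous g /\ forall i : 'I_n, exists2 dg, algebra_of G dg &
    forall x, is_derive x (delta_mx ord0 i) g (dg x).
Proof.
move=> Gs; elim => {g} [g Gg|c|f g Gf [cf df] Gg [cg dg]|f g Gf [cf df] Gg [cg dg]].
- exact: Gs.
- split; first exact: cst_continuous.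
  by move=> i; exists (cst 0) => [|x]; [exact: algebra_cst|exact: is_derive_cst].
- split; first by move=> x; apply: continuousD; [exact: cf|exact: cg].
  move=> i; have [f' Gf' ff'] := df i; have [g' Gg' gg'] := dg i.
  by exists (f' \+ g'); [exact: algebraD|move=> x; exact: is_deriveD].
- split; first by move=> x; apply: continuousM; [exact: cf|exact: cg].
  move=> i; have [f' Gf' ff'] := df i; have [g' Gg' gg'] := dg i.
  exists (f \* g' \+ g \* f'); first by apply: algebraD; exact: algebraM.
  by move=> x; apply: is_deriveM.
Qed.

(** Every iterated partial derivative stays in the algebra, whose members are continuous and have
    partial derivatives, so smoothness of all orders reduces to first derivatives of the
    generators. *)
Lemma algebra_of_smooth G g : derivation_stable G -> algebra_of G g -> smooth g.
Proof.
move=> Gs Gg.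
have Gp s : algebra_of G (foldr (@partial R n) g s).
  elim: s => //= i s IH.
  have [_ /(_ i)[dg Gdg H]] := algebra_of_stable Gs IH.
  by rewrite (_ : partial i _ = dg)//; apply/funext => x; exact: derive_val.
move=> s; have [cs ds] := algebra_of_stable Gs (Gp s); split => // i x.
by have [dg _ /(_ x)[]] := ds i.
Qed.

End smooth_algebra.

Section flat.
Context (R : realType).

(* Polynomials in 1/y times e^(-1/y), extended by 0: a family stable under derivation,
   from which the cutoffs are built. *)
Definition flat (k : nat) (y : R) : R :=
  if 0 < y then y^-1 ^+ k * expR (- y^-1) else 0.

Lemma flat_ge0 k y : 0 <= flat k y.
Proof.
rewrite /flat; case: ifPn => // y0.
by rewrite mulr_ge0 ?expR_ge0// exprn_ge0// invr_ge0 ltW.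
Qed.

(** With u = 1 / y this is u^j / j! <= e^u for j = k + m + 1: [flat k] vanishes to every order at
    0. *)
Lemma flat_le k m y : `|flat k y| <= (k + m).+1`!%:R * `|y| ^+ m.+1.
Proof.
rewrite ger0_norm ?flat_ge0// /flat; case: ifPn => [y0|_]; last first.
  by rewrite mulr_ge0// exprn_ge0.
rewrite gtr0_norm//.
have u0 : 0 < y^-1 by rewrite invr_gt0.
rewrite -[y in leRHS]invrK; move: (y^-1) u0 => u u0.
have F0 : 0 < (k + m).+1`!%:R :> R by rewrite ltr0n fact_gt0.
have := @expR_ge1Dxn R u (k + m) (ltW u0).
have -> : (k + m).+1 = (k + m.+1)%N by rewrite addnS.
rewrite -(ler_pM2r (expR_gt0 (- u))) expRxMexpNx_1 mulrDl => h.
have {h} : u ^+ (k + m.+1) / (k + m.+1)`!%:R * expR (- u) <= 1.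
  by rewrite (le_trans _ h)// lerDr mul1r expR_ge0.
rewrite exprD mulrAC ler_pdivrMr -?addnS// mul1r => h.
rewrite exprVn -ler_pdivrMr ?invr_gt0 ?exprn_gt0// invrK.
by rewrite mulrAC.
Qed.

Lemma is_derive_flat k (y : R) :
  is_derive y 1 (flat k) (- k%:R * flat k.+1 y + flat k.+2 y).
Proof.
have [y0|y0|y0] := ltgtP 0 y; last first.
- rewrite -y0; have f0 j : flat j 0 = 0 by rewrite /flat ltxx.
  rewrite !f0 mulr0 addr0.
  (* At the origin the bound with m = 1 is a quadratic remainder around derivative 0. *)
  apply: (@is_derive_quadratic _ _ _ _ _ _ (k + 1).+1`!%:R) => h _.
  rewrite f0 mulr0 !subr0 addr0 [h *: 1]mulr1 (le_trans (flat_le k 1 h))//.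
  by rewrite -normrX ger0_norm// sqr_ge0.
- apply: (@near_eq_is_derive _ _ _ (cst 0)).
    near=> z; rewrite /flat ifF//; apply/negbTE; rewrite -leNgt ltW//.
    by near: z; exact: lt_nbhsl.
  rewrite /flat ifF; last by rewrite ltNge ltW.
  by rewrite ifF ?mulr0 ?addr0; [exact: is_derive_cst|rewrite ltNge ltW].
- have d : is_derive y 1 (fun y : R => y^-1 ^+ k * expR (- y^-1))
     (- k%:R * flat k.+1 y + flat k.+2 y).
    have yn : y != 0 by rewrite gt_eqF.
    have dV : is_derive y 1 (fun y : R => y^-1) (- y^-1 ^+ 2).
      apply: (is_derive_eq (@is_deriveV R id y 1 1 yn (is_derive_id _ _))).
      by rewrite [_ *: _]mulr1 exprVn.
    have d1 := is_deriveX k dV.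
    have d2 := @is_derive1_comp _ expR (- (fun z : R => z^-1)) y _ _
      (is_derive_expR _) (is_deriveN dV).
    have -> : (fun y : R => y^-1 ^+ k * expR (- y^-1)) =
        ((fun z : R => z^-1) ^+ k) \* (expR \o (- (fun z : R => z^-1))).
      by apply/funext => z; rewrite /= !fctE.
    apply: (is_derive_eq (is_deriveM d1 d2)).
    rewrite /GRing.scale/= /flat y0 !fctE.
    move: {d1 d2} k; case=> [|k]; first by rewrite /= expr0 expr2; ring.
    by rewrite /= !exprS; ring.
  apply: near_eq_is_derive d; near=> z; rewrite /flat ifT//.
  by near: z; exact: lt_nbhsr.
Unshelve. all: by end_near. Qed.

End flat.

Lemma le_integrable_real d (T : measurableType d) (R : realType)
  (mu : {measure set T -> \bar R}) (f g : T -> R) :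
  measurable_fun setT f -> (forall x, `|f x| <= g x) ->
  mu.-integrable setT (EFin \o g) -> mu.-integrable setT (EFin \o f).
Proof.
move=> mf fg; apply: le_integrable => //; first exact/measurable_EFinP.
by move=> x _ /=; rewrite lee_fin (le_trans (fg x))// ler_norm.
Qed.

Lemma integrableZl_real d (T : measurableType d) (R : realType)
  (mu : {measure set T -> \bar R}) (k : R) (f : T -> R) :
  mu.-integrable setT (EFin \o f) -> mu.-integrable setT (EFin \o (fun x => k * f x)).
Proof. exact: integrableZl. Qed.

Lemma integrableB_real d (T : measurableType d) (R : realType)
  (mu : {measure set T -> \bar R}) (f g : T -> R) :
  mu.-integrable setT (EFin \o f) -> mu.-integrable setT (EFin \o g) ->
  mu.-integrable setT (EFin \o (fun x => f x - g x)).
Proof. by move=> fi gi; exact: (integrableB measurableT fi gi). Qed.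

Lemma integrableD_real d (T : measurableType d) (R : realType)
  (mu : {measure set T -> \bar R}) (f g : T -> R) :
  mu.-integrable setT (EFin \o f) -> mu.-integrable setT (EFin \o g) ->
  mu.-integrable setT (EFin \o (fun x => f x + g x)).
Proof. by move=> fi gi; exact: (integrableD measurableT fi gi). Qed.

Lemma normr_expRB1_le (R : realType) (w : R) : `|expR w - 1| <= `|w| * expR `|w|.
Proof.
have h1 := expR_ge1Dx w; have h2 := expR_ge1Dx (- w).
have E0 := expR_gt0 w.
have h3 : expR w - 1 <= w * expR w.
  by have := ler_wpM2r (ltW E0) h2; rewrite mulrDl mul1r mulNr -expRD addNr expR0; lra.
have [w0|w0] := leP 0 w.
  by rewrite (ger0_norm w0) ger0_norm // subr_ge0 (le_trans _ h1)// lerDl.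
have e1 : 1 <= expR `|w| by rewrite -expR0 ler_expR.
rewrite ler0_norm; last by rewrite subr_le0 -expR0 ler_expR ltW.
rewrite (le_trans (_ : _ <= `|w|))//; first by rewrite ltr0_norm//; lra.
by rewrite ler_peMr.
Qed.

Lemma normr_expRB1B_le (R : realType) (w : R) :
  `|expR w - 1 - w| <= w ^+ 2 * expR `|w|.
Proof.
have h1 := expR_ge1Dx w; have h2 := expR_ge1Dx (- w).
have E0 := expR_gt0 w.
have h3 : expR w - 1 <= w * expR w.
  by have := ler_wpM2r (ltW E0) h2; rewrite mulrDl mul1r mulNr -expRD addNr expR0; lra.
rewrite ger0_norm; last by lra.
have h4 := normr_expRB1_le w.
rewrite (@le_trans _ _ (w * (expR w - 1)))//; first by rewrite mulrBr mulr1; lra.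
rewrite (le_trans (ler_norm _))// normrM -[w ^+ 2]ger0_norm ?sqr_ge0// normrX expr2 -mulrA.
by rewrite ler_wpM2l.
Qed.

Lemma sqr_le_expR (R : realType) (t : R) : 0 <= t -> t ^+ 2 <= 2 * expR t.
Proof. by move=> t0; have := expR_ge_taylor2 t0; lra. Qed.

Section laplace.
Context (R : realType) (n : nat).
Local Notation mu := (lebesgue_rV R n).
Implicit Types (psi f : 'rV[R]_n -> R) (x y v : 'rV[R]_n).

(** Transfers estimates in the Euclidean norm to the max-norm topology; the constant may depend on
    [x]. *)
Lemma locally_lipschitz_continuous f x (C : R) :
  (forall x', enorm (x' - x) <= 1 -> `|f x' - f x| <= C * enorm (x' - x)) ->
  {for x, continuous f}.
Proof.
move=> H.
have cx : enorm (y - x) @[y --> x] --> 0.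
  have -> : 0 = enorm (x - x) by rewrite subrr enorm0.
  apply: (@continuous_comp _ _ _ (fun y => y - x) (@enorm R n)).
    by apply: (@continuousB _ _ _ id (cst x)); [exact: cvg_id|exact: cst_continuous].
  exact: continuous_enorm.
apply/(@cvgrPdist_le _ _ _ (nbhs x) (nbhs_filter x)) => e e0.
have C0 : 0 < `|C| + 1 by rewrite ltr_wpDl.
have /(@cvgr0Pnorm_le _ _ _ (nbhs x) (nbhs_filter x)) cx0 := cx.
have d0 : 0 < (`|C| + 1)^-1 * e by rewrite mulr_gt0// invr_gt0.
apply: filterS2 (cx0 _ ltr01) (cx0 _ d0) => y.
rewrite ger0_norm ?enorm_ge0// => y1 y2.
rewrite distrC (le_trans (H _ y1))// (@le_trans _ _ ((`|C| + 1) * enorm (y - x)))//.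
  by rewrite ler_wpM2r ?enorm_ge0// (le_trans (ler_norm _))// lerDl.
by rewrite -ler_pdivlMl.
Qed.

(** On this class Laplace transforms can be differentiated under the integral any number of times:
    each derivative multiplies [psi] by a linear form, which |y| <= e^|y| absorbs into the
    weight. *)
Definition exp_integrable psi := measurable_fun setT psi /\
  forall c, mu.-integrable setT (EFin \o (fun y => `|psi y| * expR (c * enorm y))).

Lemma measurable_dotp v : measurable_fun setT (dotp v).
Proof.
by apply: measurable_sum => i; apply: measurable_funM => //; exact: measurable_coord.
Qed.

Lemma exp_integrable_dotp psi v : exp_integrable psi ->
  exp_integrable (fun y => dotp v y * psi y).
Proof.
move=> [mpsi ipsi]; have mv := measurable_dotp v.
have me := @measurable_enorm R n; split; first exact: measurable_funM.
move=> c.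
apply: (@le_integrable_real _ _ _ _ _ (fun y => enorm v * (`|psi y| * expR ((c + 1) * enorm y)))).
- apply: measurable_funM; first by apply: measurableT_comp => //; exact: measurable_funM.
  by apply: measurableT_comp => //; exact: measurable_funM.
- move=> y; rewrite ger0_norm ?mulr_ge0 ?expR_ge0// normrM.
  rewrite mulrDl mul1r expRD [_ * (_ * _)]mulrA mulrA -mulrA -[leRHS]mulrA.
  rewrite [leLHS](_ : _ = `|psi y| * expR (c * enorm y) * `|dotp v y|); last ring.
  rewrite [leRHS](_ : _ = `|psi y| * expR (c * enorm y) * (enorm v * expR (enorm y))); last ring.
  rewrite ler_wpM2l ?mulr_ge0 ?expR_ge0// (le_trans (dotp_le_enorm _ _))//.
  by rewrite ler_wpM2l ?enorm_ge0// (le_trans _ (expR_ge1Dx _))// lerDr ler01.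
- exact: (integrableZl_real _ (ipsi _)).
Qed.

(* [heat t f] is a Gaussian times [laplace t^-1] of [f] weighted by a Gaussian. *)
Definition laplace (b : R) psi x := \int[mu]_y (psi y * expR (b * dotp x y)).

Lemma laplace_integrable b psi x : exp_integrable psi ->
  mu.-integrable setT (EFin \o (fun y => psi y * expR (b * dotp x y))).
Proof.
move=> [mpsi ipsi].
apply: (@le_integrable_real _ _ _ _ _ (fun y => `|psi y| * expR (`|b| * enorm x * enorm y))) => //.
  apply: measurable_funM => //; apply: measurableT_comp => //.
  by apply: measurable_funM => //; exact: measurable_dotp.
move=> y; rewrite normrM ler_wpM2l// ger0_norm ?expR_ge0// ler_expR.
by rewrite (le_trans (ler_norm _))// normrM -mulrA ler_wpM2l// dotp_le_enorm.
Qed.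

Lemma expR_dotp_le b x y : expR (b * dotp x y) <= expR (`|b| * enorm x * enorm y).
Proof.
rewrite ler_expR (le_trans (ler_norm _))// normrM -mulrA.
by rewrite ler_wpM2l// dotp_le_enorm.
Qed.

Lemma continuous_laplace b psi : exp_integrable psi -> continuous (laplace b psi).
Proof.
move=> epsi x; have [mpsi ipsi] := epsi.
(* The exponent collects e^(b <x,y>), the bound |y| <= e^|y|, and e^(|b| |y|) from increments of
   length at most 1. *)
pose g y := `|b| * (`|psi y| * expR ((`|b| * enorm x + 1 + `|b|) * enorm y)).
have ig : mu.-integrable setT (EFin \o g).
  exact: (integrableZl_real _ (ipsi _)).
apply: (@locally_lipschitz_continuous _ _ (\int[mu]_y g y)) => x' xx'.
have i1 := laplace_integrable b x' epsi.
have i2 := laplace_integrable b x epsi.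
rewrite /laplace -RintegralB// (le_trans (le_normr_Rintegral _ _))//.
  exact: integrableB_real.
rewrite [leRHS]mulrC -RintegralZl//; apply: le_Rintegral => //.
- by apply: integrable_norm; exact: integrableB_real.
- exact: integrableZl_real.
move=> y _.
have -> : x' = (x' - x) + x by rewrite subrK.
move: (x' - x) xx' => v v1; rewrite addrK.
rewrite dotpDl mulrDr expRD -mulrBr -[X in _ - X]mul1r -mulrBl normrM normrM.
rewrite (@ger0_norm _ (expR _)) ?expR_ge0//.
have H : `|expR (b * dotp v y) - 1| <= `|b| * enorm v * (enorm y * expR (`|b| * enorm y)).
  rewrite (le_trans (normr_expRB1_le _))//.
  rewrite mulrA ler_pM ?expR_ge0//.
    by rewrite normrM -mulrA ler_wpM2l// dotp_le_enorm.
  rewrite ler_expR normrM ler_wpM2l// (le_trans (dotp_le_enorm _ _))//.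
  by rewrite ler_piMl// enorm_ge0.
rewrite /g (@le_trans _ _ (`|psi y| * (`|b| * enorm v * (enorm y * expR (`|b| * enorm y)) * expR (`|b| * enorm x * enorm y))))//.
  by rewrite ler_wpM2l// ler_pM ?expR_ge0// expR_dotp_le.
rewrite !mulrDl !expRD mul1r.
rewrite [leLHS](_ : _ = `|b| * enorm v * `|psi y| * expR (`|b| * enorm x * enorm y) * expR (`|b| * enorm y) * enorm y); last ring.
rewrite [leRHS](_ : _ = `|b| * enorm v * `|psi y| * expR (`|b| * enorm x * enorm y) * expR (`|b| * enorm y) * expR (enorm y)); last ring.
rewrite ler_wpM2l//; first by rewrite !mulr_ge0 ?expR_ge0 ?enorm_ge0.
by rewrite (le_trans _ (expR_ge1Dx _))// lerDr.
Qed.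

Lemma is_derive_laplace b psi x v : exp_integrable psi ->
  is_derive x v (laplace b psi) (b * laplace b (fun y => dotp v y * psi y) x).
Proof.
move=> epsi; have [mpsi ipsi] := epsi.
(* Of the two copies of |b| |v|, one bounds e^|w| for the increment w = b h <v,y>, the other absorbs
   the square of w through t^2 <= 2 e^t. *)
pose a := `|b| * enorm x + 2 * (`|b| * enorm v).
pose g y := 2 * (`|psi y| * expR (a * enorm y)).
have ig : mu.-integrable setT (EFin \o g).
  exact: (integrableZl_real _ (ipsi _)).
have i3 := laplace_integrable b x (exp_integrable_dotp v epsi).
apply: (@is_derive_quadratic _ _ _ _ _ _ (\int[mu]_y g y)) => h h1.
have i1 := laplace_integrable b (h *: v + x) epsi.
have i2 := laplace_integrable b x epsi.
have i4 : mu.-integrable setT (EFin \o (fun y => h * b * (dotp v y * psi y * expR (b * dotp x y)))).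
  exact: integrableZl_real.
rewrite /laplace mulrA -RintegralZl// -RintegralB//.
rewrite -RintegralB//; last exact: integrableB_real.
rewrite (le_trans (le_normr_Rintegral _ _))//.
  by apply: integrableB_real => //; exact: integrableB_real.
rewrite [leRHS]mulrC -RintegralZl//; apply: le_Rintegral => //.
- by apply: integrable_norm; apply: integrableB_real => //; exact: integrableB_real.
- exact: integrableZl_real.
move=> y _.
pose w := b * (h * dotp v y).
rewrite [X in `|X|](_ : _ = psi y * (expR (b * dotp x y) * (expR w - 1 - w))); last first.
  by rewrite dotpDl dotpZl mulrDr expRD -/w /w; ring.
rewrite normrM normrM (@ger0_norm _ (expR _)) ?expR_ge0//.
have wb : `|w| <= `|h| * (`|b| * enorm v * enorm y).
  rewrite /w !normrM mulrCA ler_wpM2l// -mulrA ler_wpM2l//.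
  exact: dotp_le_enorm.
set t := `|b| * enorm v * enorm y in wb *.
have t0 : 0 <= t by rewrite !mulr_ge0 ?enorm_ge0.
have wt : `|w| <= t by rewrite (le_trans wb)// ler_piMl.
have H : `|expR w - 1 - w| <= h ^+ 2 * (2 * expR (2 * t)).
  rewrite (le_trans (normr_expRB1B_le _))//.
  rewrite (@le_trans _ _ (h ^+ 2 * t ^+ 2 * expR t))//.
    rewrite ler_pM ?sqr_ge0 ?expR_ge0 ?ler_expR// -exprMn.
    rewrite -[w ^+ 2]ger0_norm ?sqr_ge0// -[leRHS]ger0_norm ?sqr_ge0// !normrX.
    by rewrite ler_sqr ?nnegrE// (le_trans wb)// normrM (ger0_norm t0).
  rewrite -mulrA ler_wpM2l ?sqr_ge0//.
  rewrite (_ : 2 * t = t + t); last ring.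
  by rewrite expRD mulrA ler_wpM2r ?expR_ge0// sqr_le_expR.
rewrite (@le_trans _ _ (`|psi y| * (expR (`|b| * enorm x * enorm y) * (h ^+ 2 * (2 * expR (2 * t))))))//.
  by rewrite ler_wpM2l// ler_pM ?expR_ge0// expR_dotp_le.
rewrite /g /a (mulrDl (`|b| * enorm x)) expRD.
rewrite (_ : 2 * (`|b| * enorm v) * enorm y = 2 * t); last by rewrite /t; ring.
by rewrite le_eqVlt; apply/orP; left; apply/eqP; ring.
Qed.

End laplace.

Lemma is_derive_comp_dotp (R : realType) n (phi : R -> R) (c r d : R)
    (x v : 'rV[R]_n) : is_derive (c + r * dotp x x) 1 phi d ->
  is_derive x v (fun x => phi (c + r * dotp x x)) (d * (2 * r * dotp v x)).
Proof.
move=> dphi; apply: is_derive_line.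
pose q (h : R) := c + r * (h * h * dotp v v + h * (2 * dotp v x) + dotp x x).
have qE : (fun h : R => phi (c + r * dotp (h *: v + x) (h *: v + x))) = phi \o q.
  apply/funext => h /=; congr (phi (c + r * _)).
  by rewrite !(dotpDl, dotpDr, dotpZl, dotpZr) (dotpC x v); ring.
rewrite qE; apply: is_derive1_comp.
  by rewrite /q !mul0r !add0r.
by apply: is_derive_eq; rewrite /GRing.scale/=; ring.
Qed.

Section generators.
Context (R : realType) (n : nat).
Local Notation mu := (lebesgue_rV R n).
Implicit Types (psi f : 'rV[R]_n -> R) (x y v : 'rV[R]_n).

(* Heat extensions and cutoffs are both sums of products of these generators, whose
   partial derivatives are again such; this is what makes them smooth. *)
Inductive gen : set ('rV[R]_n -> R) :=
| gen_coord i : gen (fun x => x ord0 i)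
| gen_exp r : gen (fun x => expR (0 + r * dotp x x))
| gen_flat k r : gen (fun x => flat k (1 + r * dotp x x))
| gen_laplace b psi : exp_integrable psi -> gen (laplace b psi).

Lemma continuous_dotp_diag : continuous (fun x => dotp x x).
Proof.
apply: continuous_sum_rV => i y.
by apply: continuousM; exact: coord_continuous.
Qed.

Lemma continuous_comp_dotp (phi : R -> R) (c r : R) :
  continuous phi -> continuous (fun x => phi (c + r * dotp x x)).
Proof.
move=> cphi x.
apply: (@continuous_comp _ _ _ (fun x => c + r * dotp x x) phi); last exact: cphi.
apply: (@continuousD _ _ _ (cst c) (fun x => r * dotp x x)); first exact: cst_continuous.
apply: (@continuousM _ _ (cst r) (fun x => dotp x x)); first exact: cst_continuous.
exact: continuous_dotp_diag.
Qed.

Lemma continuous_flat k : continuous (@flat R k).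
Proof.
move=> y; have [ex _] := is_derive_flat k y.
exact/differentiable_continuous/derivable1_diffP.
Qed.

(** Radial generators differentiate to radial generators times a coordinate, and a Laplace transform
    to the transform of [psi] times a coordinate, so the algebra is never left. *)
Lemma gen_stable : derivation_stable gen.
Proof.
move=> g; case => {g} [j|r|k r|b psi epsi]; split.
- exact: coord_continuous.
- move=> i; exists (cst ((delta_mx ord0 i : 'rV[R]_n) ord0 j)); first exact: algebra_cst.
  move=> x; apply: (@is_derive_quadratic _ _ _ _ _ _ 0) => h _.
  by rewrite !mxE mul0r [X in `|X|](_ : _ = 0) ?normr0//; ring.
- exact: (continuous_comp_dotp (@continuous_expR R)).
- move=> i; exists ((fun x => expR (0 + r * dotp x x)) \* (cst (2 * r) \* (fun x => x ord0 i))).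
    apply: algebraM; first exact/algebra_base/gen_exp.
    apply: algebraM; first exact: algebra_cst.
    exact/algebra_base/gen_coord.
  move=> x; have := is_derive_comp_dotp (delta_mx ord0 i) (is_derive_expR (0 + r * dotp x x)).
  by rewrite dotpC dotp_delta.
- exact: (continuous_comp_dotp (@continuous_flat k)).
- move=> i; exists ((cst (- k%:R) \* (fun x => flat k.+1 (1 + r * dotp x x)) \+
     (fun x => flat k.+2 (1 + r * dotp x x))) \* (cst (2 * r) \* (fun x => x ord0 i))).
    apply: algebraM.
      apply: algebraD; last exact/algebra_base/gen_flat.
      by apply: algebraM; [exact: algebra_cst|exact/algebra_base/gen_flat].
    by apply: algebraM; [exact: algebra_cst|exact/algebra_base/gen_coord].
  move=> x; have := is_derive_comp_dotp (delta_mx ord0 i) (is_derive_flat k (1 + r * dotp x x)).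
  by rewrite (dotpC _ x) dotp_delta.
- exact: continuous_laplace.
- move=> i; exists (cst b \* laplace b (fun y => dotp (delta_mx ord0 i) y * psi y)).
    apply: algebraM; first exact: algebra_cst.
    exact/algebra_base/gen_laplace/exp_integrable_dotp.
  by move=> x; exact: is_derive_laplace.
Qed.

(* [f] lies in L^1 + L^oo, which contains every L^p and is all that [heat] requires. *)
Definition tame f := measurable_fun setT f /\
  exists c h, [/\ 0 <= c, mu.-integrable setT (EFin \o h) & forall x, `|f x| <= c + h x].

Definition gauss_deriv (t : R) v x := - (dotp v x / t) * gauss t x.

Section heat.
Variable t : R.
Hypothesis t0 : 0 < t.

Lemma gauss_integrable : mu.-integrable setT (EFin \o gauss t).
Proof.
apply/integrableP; split; first by apply/measurable_EFinP; exact: measurable_gauss.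
under eq_integral do rewrite /= ger0_norm ?gauss_ge0//.
by rewrite (integral_gauss n t0) ltry.
Qed.

(** Completing the square gives a |y| - |y|^2 / (2 t) <= a^2 t - |y|^2 / (4 t): half of the Gaussian
    exponent pays for the exponential weight. The other half makes the constant part of the bound on
    [f] integrable, and is at most 1 against the integrable part. *)
Lemma exp_integrable_tame f : tame f ->
  exp_integrable (fun y => f y * expR (- (enorm y ^+ 2 / (2 * t)))).
Proof.
move=> [mf [c [h [c0 ih fh]]]].
have me := @measurable_enorm R n.
have mG : measurable_fun setT (fun y : 'rV[R]_n => expR (- (enorm y ^+ 2 / (2 * t)))).
  apply: measurableT_comp => //; apply: measurableT_comp => //.
  by apply: measurable_funM => //; exact: measurable_funX.
split; first exact: measurable_funM.
move=> a; pose k := (2 * pi * (2 * t)) `^ (- (n%:R / 2)).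
have k0 : 0 < k by rewrite powR_gt0// !mulr_gt0// pi_gt0.
have t20 : 0 < 2 * t by rewrite mulr_gt0.
apply: (@le_integrable_real _ _ _ _ _ (fun y => expR (a ^+ 2 * t) *
   (c / k * gauss (2 * t) y + `|h y|))).
- apply: measurable_funM; first by apply: measurableT_comp => //; exact: measurable_funM.
  by apply: measurableT_comp => //; exact: measurable_funM.
- move=> y; rewrite ger0_norm ?mulr_ge0 ?expR_ge0// normrM.
  rewrite (@ger0_norm _ (expR _)) ?expR_ge0// -[leLHS]mulrA -expRD.
  have H : - (enorm y ^+ 2 / (2 * t)) + a * enorm y <=
      a ^+ 2 * t + - (enorm y ^+ 2 / (2 * (2 * t))).
    rewrite -subr_ge0 [leRHS](_ : _ = (enorm y - 2 * t * a) ^+ 2 / (4 * t)).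
      by rewrite divr_ge0 ?sqr_ge0// mulr_ge0// ltW.
    by field; rewrite gt_eqF.
  rewrite (@le_trans _ _ ((c + `|h y|) * expR (a ^+ 2 * t + - (enorm y ^+ 2 / (2 * (2 * t))))))//.
    by rewrite ler_pM ?expR_ge0 ?ler_expR// (le_trans (fh y))// lerD2l ler_norm.
  rewrite expRD mulrCA ler_wpM2l ?expR_ge0// mulrDl lerD//.
    rewrite /gauss -/k le_eqVlt; apply/orP; left; apply/eqP.
    by field; rewrite gt_eqF.
  rewrite ler_piMr// expR_le1 oppr_le0 divr_ge0 ?sqr_ge0// ltW//.
  by rewrite mulr_gt0.
- apply: integrableZl_real; apply: integrableD_real; last exact: integrable_norm.
  apply: integrableZl_real; apply/integrableP; split.
    by apply/measurable_EFinP; exact: measurable_gauss.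
  under eq_integral do rewrite /= ger0_norm ?gauss_ge0//.
  by rewrite (integral_gauss n t20) ltry.
Qed.

Lemma gauss_expand x y : gauss t (x - y) =
  (2 * pi * t) `^ (- (n%:R / 2)) * expR (0 + (- (2 * t)^-1) * dotp x x) *
  (expR (- (enorm y ^+ 2 / (2 * t))) * expR (t^-1 * dotp x y)).
Proof.
rewrite /gauss -[RHS]mulrA -!expRD; congr (_ * expR _).
rewrite !enorm_sqr !(dotpDl, dotpDr, dotpNl, dotpNr) (dotpC y x).
by field; rewrite gt_eqF.
Qed.

(** Expanding |x - y|^2 couples [x] and [y] only through e^(<x,y>/t), which exhibits [heat t f] as a
    product of a constant and two generators. *)
Lemma heat_laplace f : tame f -> heat t f = cst ((2 * pi * t) `^ (- (n%:R / 2))) \*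
   ((fun x => expR (0 + (- (2 * t)^-1) * dotp x x)) \*
    laplace t^-1 (fun y => f y * expR (- (enorm y ^+ 2 / (2 * t))))).
Proof.
move=> tf; apply/funext => x; rewrite /heat /=; congr (_ * _).
rewrite /laplace -RintegralZl//; last exact/laplace_integrable/exp_integrable_tame.
apply: eq_Rintegral => y _.
rewrite -[expR (- (enorm (x - y) ^+ 2 / _))](mulKf (x := (2 * pi * t) `^ (- (n%:R / 2)))); last first.
  by rewrite gt_eqF// powR_gt0// !mulr_gt0// pi_gt0.
rewrite -/(gauss t (x - y)) gauss_expand -!mulrA mulKf; first by ring.
by rewrite gt_eqF// powR_gt0// !mulr_gt0// pi_gt0.
Qed.

Lemma tame_gauss_integrable f x : tame f ->
  mu.-integrable setT (EFin \o (fun y => f y * gauss t (x - y))).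
Proof.
move=> tf; have := integrableZl_real ((2 * pi * t) `^ (- (n%:R / 2)) * expR (0 + (- (2 * t)^-1) * dotp x x))
  (laplace_integrable t^-1 x (exp_integrable_tame tf)).
apply: eq_integrable => // y _ /=; congr EFin.
by rewrite gauss_expand; ring.
Qed.

Lemma heatE f x : tame f -> heat t f x = \int[mu]_y (f y * gauss t (x - y)).
Proof.
move=> tf; rewrite /heat -RintegralZl//.
  by apply: eq_Rintegral => y _; rewrite /gauss mulrCA.
have k0 : (2 * pi * t) `^ (- (n%:R / 2)) != 0.
  by rewrite gt_eqF// powR_gt0// !mulr_gt0// pi_gt0.
have := integrableZl_real ((2 * pi * t) `^ (- (n%:R / 2)))^-1 (tame_gauss_integrable x tf).
apply: eq_integrable => // y _ /=; congr EFin.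
by rewrite /gauss mulrCA mulKf.
Qed.

(** Differentiation under the integral sign, read off from the Laplace form: the product rule yields
    the factor <v,y>/t - <v,x>/t, which reassembles into [gauss_deriv]. *)
Lemma is_derive_heat f x v : tame f ->
  is_derive x v (heat t f) (\int[mu]_y (f y * gauss_deriv t v (x - y))).
Proof.
move=> tf; rewrite heat_laplace//.
have e1 := exp_integrable_tame tf.
set K := (2 * pi * t) `^ _; set psi := fun y => f y * _.
have d1 := is_derive_laplace t^-1 x v e1.
have d2 := is_derive_comp_dotp v (is_derive_expR (0 + (- (2 * t)^-1) * dotp x x)).
apply: (is_derive_eq (is_deriveM (is_derive_cst K x v) (is_deriveM d2 d1))).
rewrite /GRing.scale/= mulr0 addr0.
have i1 := integrableZl_real (K *
  expR (0 + (- (2 * t)^-1) * dotp x x) * - (dotp v x / t)) (laplace_integrable t^-1 x e1).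
have i2 := integrableZl_real (K *
  expR (0 + (- (2 * t)^-1) * dotp x x) / t) (laplace_integrable t^-1 x (exp_integrable_dotp v e1)).
rewrite [RHS](_ : _ = \int[mu]_y (K * expR (0 + (- (2 * t)^-1) * dotp x x) * - (dotp v x / t) *
   (psi y * expR (t^-1 * dotp x y)) +
   K * expR (0 + (- (2 * t)^-1) * dotp x x) / t * (dotp v y * psi y * expR (t^-1 * dotp x y)))); last first.
  apply: eq_Rintegral => y _.
  rewrite /psi /gauss_deriv gauss_expand dotpDr dotpNr -/K.
  by field; rewrite gt_eqF.
rewrite RintegralD// RintegralZl//; last exact: laplace_integrable.
rewrite RintegralZl//; last exact/laplace_integrable/exp_integrable_dotp.
rewrite -/(laplace t^-1 psi x) -/(laplace t^-1 (fun y => dotp v y * psi y) x).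
by field; rewrite gt_eqF.
Qed.

Lemma heat_algebra f : tame f -> algebra_of gen (heat t f).
Proof.
move=> tf; rewrite heat_laplace//; apply: algebraM; first exact: algebra_cst.
apply: algebraM; first exact/algebra_base/gen_exp.
exact/algebra_base/gen_laplace/exp_integrable_tame.
Qed.

Lemma heat_smooth f : tame f -> smooth (heat t f).
Proof. by move=> tf; exact: algebra_of_smooth gen_stable (heat_algebra tf). Qed.

End heat.

End generators.

(** * Convolution with bounded integrable kernels *)

Section kernels.
Context (R : realType) (n : nat).
Local Notation mu := (lebesgue_rV R n).
Implicit Types (f a k : 'rV[R]_n -> R) (x y v z : 'rV[R]_n).

(** L^1 and bounded: finite norm for every conjugate exponent, and absolutely convergent convolution
    with every [tame] function. The bound is pointwise because the norm at q = oo is a supremum. *)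
Definition kernel k := [/\ measurable_fun setT k, mu.-integrable setT (EFin \o k)
  & exists M, forall x, `|k x| <= M].

Lemma kernelZ c k : kernel k -> kernel (fun x => c * k x).
Proof.
move=> [mk ik [M kM]]; split; [exact: measurable_funM|exact: integrableZl_real|].
by exists (`|c| * M) => x; rewrite normrM ler_wpM2l.
Qed.

Lemma kernelD k k' : kernel k -> kernel k' -> kernel (fun x => k x + k' x).
Proof.
move=> [mk ik [M kM]] [mk' ik' [M' kM']].
split; [exact: measurable_funD|exact: integrableD_real|].
by exists (M + M') => x; rewrite (le_trans (ler_normD _ _))// lerD.
Qed.

Lemma measurable_reflect f x : measurable_fun setT f ->
  measurable_fun setT (fun y => f (x - y)).
Proof.
move=> mf; apply: measurableT_comp => //.
rewrite (_ : (fun y => x - y) = (fun y => -1 *: y + x)); first exact: measurable_affine_rV.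
by apply/funext => y; rewrite scaleN1r addrC.
Qed.

Lemma measurable_sub_rV : measurable_fun setT (fun p : 'rV[R]_n * 'rV[R]_n => p.1 - p.2).
Proof.
apply: measurable_fun_rV => i.
rewrite (_ : (fun _ => _) = (fun p : 'rV[R]_n * 'rV[R]_n => p.1 ord0 i - p.2 ord0 i)).
  apply: measurable_funB; exact: (measurableT_comp (@measurable_coord R n i)).
by apply/funext => p; rewrite !mxE.
Qed.

Lemma integrable_reflect f x : mu.-integrable setT (EFin \o f) ->
  mu.-integrable setT (EFin \o (fun y => f (x - y))).
Proof.
move=> /integrableP[/measurable_EFinP mf fi]; apply/integrableP; split.
  by apply/measurable_EFinP; exact: measurable_reflect.
rewrite (integral_reflect x (F := fun y => `|(f y)%:E|%E))//.
by apply: measurableT_comp => //; apply/measurable_EFinP.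
Qed.

(** The constant part of the bound on [f] pairs with the L^1 norm of [k], the integrable part with
    its supremum; neither depends on [x]. *)
Lemma tame_kernel_bound f k : tame f -> kernel k -> exists B : R, forall x,
  (\int[mu]_y (`|f y * k (x - y)|)%:E <= B%:E)%E.
Proof.
move=> [mf [c [h [c0 ih fh]]]] [mk ik [M kM]].
have M0 : 0 <= M by rewrite (le_trans _ (kM 0)).
have ik' := integrable_norm ik; have ih' := integrable_norm ih.
exists (c * \int[mu]_y `|k y| + M * \int[mu]_y `|h y|) => x.
have ikx := integrable_norm (integrable_reflect x ik).
apply: (@le_trans _ _ (\int[mu]_y (c%:E * (`|k (x - y)|)%:E + M%:E * (`|h y|)%:E))%E).
  have mkx := measurable_reflect x mk.
  have mh : measurable_fun setT h by apply/measurable_EFinP; case/integrableP: ih.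
  apply: ge0_le_integral => //.
  - by apply/measurable_EFinP; apply: measurableT_comp => //; exact: measurable_funM.
  - apply: emeasurable_funD; apply: measurable_funeM; apply/measurable_EFinP;
    exact: measurableT_comp.
  - move=> y _; rewrite -!EFinM -EFinD lee_fin normrM.
    rewrite (@le_trans _ _ ((c + `|h y|) * `|k (x - y)|))//.
      by rewrite ler_wpM2r// (le_trans (fh y))// lerD2l ler_norm.
    by rewrite mulrDl lerD2l mulrC ler_wpM2r.
rewrite integralD//; [|exact: integrableZl|exact: integrableZl].
rewrite !integralZl// EFinD !EFinM leeD// lee_wpmul2l// ?lee_fin//.
  rewrite /Rintegral fineK ?integrable_fin_num//.
  rewrite (integral_reflect x (F := fun y => (`|k y|)%:E))//.
  by case/integrableP: ik'.
by rewrite /Rintegral fineK ?integrable_fin_num.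
Qed.

Lemma tame_kernel_integrable f k x : tame f -> kernel k ->
  mu.-integrable setT (EFin \o (fun y => f y * k (x - y))).
Proof.
move=> tf kk; have [B /(_ x) fB] := tame_kernel_bound tf kk.
apply/integrableP; split; last exact: le_lt_trans fB (ltry _).
apply/measurable_EFinP; apply: measurable_funM; first by case: tf.
by apply: measurable_reflect; case: kk.
Qed.

(** Fubini: the inner absolute integral is bounded uniformly in [x] and [a] is integrable, so the
    double integral converges absolutely. *)
Lemma kernel_swap a f k : mu.-integrable setT (EFin \o a) -> tame f -> kernel k ->
  [/\ mu.-integrable setT (EFin \o (fun x => a x * \int[mu]_y (f y * k (x - y)))),
      mu.-integrable setT (EFin \o (fun y => f y * \int[mu]_x (a x * k (x - y))))
    & \int[mu]_x (a x * \int[mu]_y (f y * k (x - y))) =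
      \int[mu]_y (f y * \int[mu]_x (a x * k (x - y)))].
Proof.
move=> ia tf kk; have [B fB] := tame_kernel_bound tf kk.
have [mf _] := tf; have [mk ik [M kM]] := kk.
have ma : measurable_fun setT a by apply/measurable_EFinP; case/integrableP: ia.
pose F (p : 'rV[R]_n * 'rV[R]_n) := (a p.1 * (f p.2 * k (p.1 - p.2)))%:E.
have mF : measurable_fun setT F.
  apply/measurable_EFinP; apply: measurable_funM; first exact: measurableT_comp.
  apply: measurable_funM; first exact: measurableT_comp.
  by apply: measurableT_comp => //; exact: measurable_sub_rV.
have iF : (mu \x mu)%E.-integrable setT F.
  apply/integrable12ltyP => //.
  apply: (@le_lt_trans _ _ (\int[mu]_x (B%:E * `|(a x)%:E|))%E).
    apply: ge0_le_integral => //.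
    - by move=> x _; exact: integral_ge0.
    - apply: (@measurable_fun_fubini_tonelli_F _ _ _ _ R mu (fun p => `|F p|%E)) => //.
      exact: measurableT_comp.
    - by apply: measurable_funeM; apply: measurableT_comp => //; apply/measurable_EFinP.
    - move=> x _; rewrite /F /=.
      under eq_integral do rewrite normrM EFinM.
      rewrite ge0_integralZl_EFin//; first by rewrite muleC lee_wpmul2r// ?lee_fin.
      apply/measurable_EFinP; apply: measurableT_comp => //.
      by apply: measurable_funM => //; exact: measurable_reflect.
  have B0 : 0 <= B.
    by rewrite -lee_fin (le_trans _ (fB 0))//; apply: integral_ge0 => y _; rewrite lee_fin.
  rewrite ge0_integralZl_EFin//; last by apply: measurableT_comp => //; apply/measurable_EFinP.
  by apply: lte_mul_pinfty; rewrite ?lee_fin//; case/integrableP: ia.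
have E1 x : (\int[mu]_y F (x, y))%E = (a x * \int[mu]_y (f y * k (x - y)))%:E.
  rewrite /F/= EFinM /Rintegral fineK; last exact/integrable_fin_num/tame_kernel_integrable.
  rewrite -integralZl//; last exact: tame_kernel_integrable.
(* The integral over x at fixed y is a convolution of [a] with the reflected kernel, so [a] takes
   the role of the tame function. *)
have ta : tame a.
  split => //; exists 0, (fun x => `|a x|); split=> //; first exact: integrable_norm.
  by move=> x; rewrite add0r.
have kk' : kernel (fun x => k (- x)).
  split; last by exists M => x; exact: kM.
    rewrite (_ : (fun _ => _) = (fun x => k (0 - x))); first exact: measurable_reflect.
    by apply/funext => x; rewrite sub0r.
  rewrite (_ : (fun _ => _) = (fun x => k (0 - x))); first exact: integrable_reflect.
  by apply/funext => x; rewrite sub0r.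
have E2 y : (\int[mu]_x F (x, y))%E = (f y * \int[mu]_x (a x * k (x - y)))%:E.
  have iy : mu.-integrable setT (EFin \o (fun x => a x * k (x - y))).
    have := tame_kernel_integrable y ta kk'.
    by apply: eq_integrable => // x _ /=; rewrite opprB.
  rewrite /F/= EFinM /Rintegral fineK; last exact: integrable_fin_num.
  rewrite -integralZl//; apply: eq_integral => x _ /=.
  by rewrite -EFinM mulrCA.
split.
- have := integrable_fubini_F iF.
  by apply: eq_integrable => // x _; rewrite /fubini_F E1.
- apply/integrableP; split.
    rewrite (_ : EFin \o _ = fubini_G mu F); first exact: measurable_fubini_G iF.
    by apply/funext => y; rewrite /fubini_G E2.
  have mFa : measurable_fun setT (fun p => `|F p|%E) by exact: measurableT_comp.
  have /integrable21ltyP := iF => /(_ mF); apply: le_lt_trans.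
  apply: ge0_le_integral => //.
  + apply: measurableT_comp => //.
    rewrite (_ : EFin \o _ = fubini_G mu F); first exact: measurable_fubini_G iF.
    by apply/funext => y; rewrite /fubini_G E2.
  + exact: (@measurable_fun_fubini_tonelli_G _ _ _ _ R mu (fun p => `|F p|%E)).
  + move=> y _.
    suff: (`|\int[mu]_x F (x, y)| <= \int[mu]_x `|F (x, y)|)%E by rewrite E2.
    apply: le_abse_integral => //.
    exact: (measurableT_comp mF (measurable_pair2 y)).
- apply: (congr1 fine).
  transitivity (\int[mu]_x \int[mu]_y F (x, y))%E.
    by apply: eq_integral => x _; rewrite E1.
  rewrite Fubini//.
  by apply: eq_integral => y _; rewrite E2.
Qed.

Section gauss_kernels.
Variable t : R.
Hypothesis t0 : 0 < t.

Lemma kernel_gauss : kernel (gauss t).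
Proof.
split; [exact: measurable_gauss|exact: gauss_integrable|].
exists ((2 * pi * t) `^ (- (n%:R / 2))) => x.
by rewrite ger0_norm ?gauss_ge0// gauss_le.
Qed.

Lemma kernel_gauss_enorm : kernel (fun x => gauss t x * enorm x).
Proof.
have mG := @measurable_gauss R n t; have me := @measurable_enorm R n.
have g0 x : 0 <= gauss t x * enorm x by rewrite mulr_ge0 ?gauss_ge0 ?enorm_ge0.
split; first exact: measurable_funM.
  apply/integrableP; split; first by apply/measurable_EFinP; exact: measurable_funM.
  under eq_integral do rewrite /= ger0_norm//.
  by rewrite (le_lt_trans (gauss_moment1 n t0))// ltry.
exists ((2 * pi * t) `^ (- (n%:R / 2)) * (1 + 2 * t)) => x.
rewrite ger0_norm// /gauss -mulrA ler_wpM2l ?powR_ge0//.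
have t20 : 0 < 2 * t by rewrite mulr_gt0.
set w := enorm x ^+ 2 / (2 * t).
have w0 : 0 <= w by rewrite divr_ge0 ?sqr_ge0// ltW.
have ew : enorm x ^+ 2 = 2 * t * w by rewrite /w mulrC mulfVK// gt_eqF.
(* This is |x| <= 1 + |x|^2; the Gaussian then absorbs the growth through w e^-w <= 1. *)
have H : enorm x <= 1 + 2 * t * w by rewrite -ew; nra.
apply: le_trans (ler_wpM2l (expR_ge0 (- w)) H) _.
have E0 := expR_gt0 (- w).
rewrite mulrDr mulr1 lerD//; first by rewrite expR_le1 oppr_le0.
rewrite mulrCA ler_piMr//; first exact: ltW.
rewrite -(ler_pM2r (expR_gt0 w)) mulrAC -expRD addNr expR0 !mul1r.
by rewrite (le_trans _ (expR_ge1Dx _))// lerDr.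
Qed.

Lemma normr_gauss_deriv v x : `|gauss_deriv t v x| <= enorm v / t * (gauss t x * enorm x).
Proof.
rewrite /gauss_deriv normrM normrN normrM normfV (gtr0_norm t0).
rewrite (ger0_norm (gauss_ge0 t0 x)) [leRHS](_ : _ = enorm v * enorm x / t * gauss t x); last ring.
by rewrite ler_wpM2r ?gauss_ge0// ler_wpM2r ?invr_ge0 ?(ltW t0)// dotp_le_enorm.
Qed.

Lemma measurable_gauss_deriv v : measurable_fun setT (gauss_deriv t v).
Proof.
apply: measurable_funM; last exact: measurable_gauss.
by apply: measurableT_comp => //; apply: measurable_funM => //; exact: measurable_dotp.
Qed.

Lemma kernel_gauss_deriv v : kernel (gauss_deriv t v).
Proof.
have [_ ik [M kM]] := kernelZ (enorm v / t) kernel_gauss_enorm.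
have mk := measurable_gauss_deriv v.
split => //; first exact: le_integrable_real (normr_gauss_deriv v) ik.
by exists M => x; rewrite (le_trans (normr_gauss_deriv v x))// (le_trans (ler_norm _)).
Qed.

Lemma gauss_derivN v x : gauss_deriv t v (- x) = - gauss_deriv t v x.
Proof. by rewrite /gauss_deriv gaussN dotpNr [- dotp v x / t]mulNr [LHS]mulNr. Qed.

End gauss_kernels.

End kernels.

(** * The semigroup law, and L^p inside the tame functions *)

Section semigroup.
Context (R : realType) (n : nat).
Local Notation mu := (lebesgue_rV R n).
Implicit Types (f a k : 'rV[R]_n -> R) (x y v z : 'rV[R]_n).

(** The heat extension of a tame function is bounded, so a constant alone dominates it. *)
Lemma tame_heat f s : 0 < s -> tame f -> tame (heat s f).
Proof.
move=> s0 tf; have kg := kernel_gauss n s0.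
split; first by apply: continuous_measurable_rV; have [] := heat_smooth s0 tf [::].
have [B fB] := tame_kernel_bound tf kg.
exists `|B|, (cst 0); split => //; first by rewrite (_ : _ \o _ = cst 0%E)//; exact: integrable0.
move=> y; rewrite addr0 heatE// (le_trans (le_normr_Rintegral _ _))//.
  exact: tame_kernel_integrable.
rewrite (le_trans _ (ler_norm B))// -lee_fin (le_trans _ (fB y))//.
rewrite /Rintegral fineK// integrable_fin_num//.
exact/integrable_norm/tame_kernel_integrable.
Qed.

(** After the exchange of integrals, [gauss_parallelogram] leaves a translated Gaussian of mass 1 in
    [y]. Equal times suffice for the dyadic comparison. *)
Lemma heat_semigroup f s x : 0 < s -> tame f -> heat s (heat s f) x = heat (2 * s) f x.
Proof.
move=> s0 tf.
have s20 : 0 < 2 * s by rewrite mulr_gt0.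
have sh0 : 0 < s / 2 by rewrite divr_gt0.
have kg := kernel_gauss n s0.
have [_ ig _] := kg.
have thf := tame_heat s0 tf.
rewrite (heatE s0 x thf).
have := kernel_swap (integrable_reflect x ig) tf kg => -[_ _ E].
transitivity (\int[mu]_y (gauss s (x - y) * \int[mu]_z (f z * gauss s (y - z)))).
  by apply: eq_Rintegral => y _; rewrite (heatE s0 y tf) [LHS]mulrC.
rewrite E (heatE s20 x tf); apply: eq_Rintegral => z _; congr (_ * _).
transitivity (\int[mu]_y (gauss (2 * s) (x - z) * gauss (s / 2) (y - 2^-1 *: (x + z)))).
  by apply: eq_Rintegral => y _; exact: gauss_parallelogram.
have [_ ig2 _] := kernel_gauss n sh0.
set m := 2^-1 *: (x + z).
have ig3 : mu.-integrable setT (EFin \o (fun y => gauss (s / 2) (y - m))).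
  rewrite (_ : (fun y => _) = (fun y => gauss (s / 2) (m - y))).
    exact: integrable_reflect.
  by apply/funext => y; rewrite -gaussN opprB.
rewrite (RintegralZl (gauss (2 * s) (x - z)) measurableT ig3).
rewrite -[RHS]mulr1; congr (_ * _).
rewrite -[RHS]/(fine 1%E) -(integral_gauss n sh0); apply: (congr1 fine).
apply: (integral_translate (- m) (F := EFin \o gauss (s / 2))).
by apply/measurable_EFinP; exact: measurable_gauss.
Qed.

(** Since p >= 1, one has |f| <= 1 + |f|^p. *)
Lemma tame_Lfun (p : R) f : 1 <= p -> f \in Lfun mu p%:E -> tame f.
Proof.
move=> p1 /[1!inE] /andP[/[!inE] mf fp].
have mf' : measurable_fun setT f by [].
have p0 : p != 0 by rewrite gt_eqF// (lt_le_trans ltr01).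
split => //; exists 1, (fun x => `|f x| `^ p); split => //.
  apply/integrableP; split.
    apply/measurable_EFinP; apply: (@measurableT_comp _ _ _ _ _ _ (@powR R ^~ p)) => //.
    exact: measurableT_comp.
  move: fp; rewrite /finite_norm => fp.
  have := poweR_lty p fp; rewrite powR_Lnorm//.
  apply: le_lt_trans; rewrite le_eqVlt; apply/orP; left; apply/eqP.
  by apply: eq_integral => x _ /=; rewrite ger0_norm ?powR_ge0// poweR_EFin.
move=> x; have [f1|f1] := leP `|f x| 1.
  by rewrite (le_trans f1)// lerDl powR_ge0.
by rewrite (le_trans (le1r_powR (ltW f1) p1))// lerDr.
Qed.

End semigroup.

(** * Norms at the conjugate exponent: Hoelder and Young *)

Lemma conjugate_cases (R : realType) (p : R) : 1 <= p ->
  (p = 1 /\ hoelder_conjugate p%:E = +oo%E) \/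
  (exists q, [/\ 1 < p, 1 < q, p^-1 + q^-1 = 1 & hoelder_conjugate p%:E = q%:E]).
Proof.
move=> p1; have [->|pn] := eqVneq p 1; [left|right].
  by split => //; exact: hoelder_conjugate1.
have p1' : 1 < p by rewrite lt_neqAle eq_sym pn.
have p0 : p != 0 by rewrite gt_eqF// (lt_trans ltr01).
have pm : p - 1 != 0 by rewrite subr_eq0.
exists (p / (p - 1)); split => //.
- by rewrite ltr_pdivlMr ?subr_gt0// mul1r ltrBlDr ltrDl.
- by field; rewrite ?p0 ?pm.
- by rewrite /hoelder_conjugate/= eqe (negbTE p0) -EFinD inver (negbTE pm) -EFinM.
Qed.

Lemma measurable_fun_powR d (T : measurableType d) (R : realType) (r : R) (g : T -> R) :
  measurable_fun setT g -> measurable_fun setT (fun x => g x `^ r).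
Proof. by move=> mg; exact: (measurableT_comp (measurable_powR r) mg). Qed.

Lemma le_poweR (R : realType) (r : R) (x y : \bar R) : 0 <= r ->
  (0 <= x -> x <= y -> x `^ r <= y `^ r)%E.
Proof.
move=> r0 x0 xy; apply: gt0_ler_poweR => //; rewrite in_itv/= leey ?x0//.
by rewrite (le_trans x0 xy).
Qed.

Section Lp_norm.
Context (R : realType) (n : nat).
Local Notation mu := (lebesgue_rV R n).
Implicit Types (f g a b k : 'rV[R]_n -> R) (x y : 'rV[R]_n).
Local Open Scope ereal_scope.

Lemma Lp_normE (r : R) g :
  Lp_norm r%:E g = (\int[mu]_x (`|g x| `^ r)%:E) `^ r^-1.
Proof. by rewrite /Lp_norm unlock. Qed.

Lemma Lp_norm_powR (r : R) g : (r != 0)%R ->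
  Lp_norm r%:E g `^ r = \int[mu]_x (`|g x| `^ r)%:E.
Proof.
move=> r0; rewrite Lp_normE -poweRrM mulVf// poweRe1//.
by apply: integral_ge0 => x _; rewrite lee_fin powR_ge0.
Qed.

Lemma Lp_norm_ge0 q g : 0 <= Lp_norm q g.
Proof.
case: q => [r| |]; [exact: Lnorm_ge0| |exact: Lnorm_ge0].
apply: le_trans (ereal_sup_ubound _); last by exists 0%R.
by rewrite lee_fin.
Qed.

Lemma measurable_powR_norm (r : R) g : measurable_fun setT g ->
  measurable_fun setT (fun x => (`|g x| `^ r)%:E).
Proof.
move=> mg; apply/measurable_EFinP.
apply: (@measurableT_comp _ _ _ _ _ _ (@powR R ^~ r)) => //.
exact: measurableT_comp.
Qed.

Lemma le_Lp_norm (p : R) g f : (1 <= p)%R -> measurable_fun setT g -> measurable_fun setT f ->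
  (forall x, `|g x| <= `|f x|)%R ->
  Lp_norm (hoelder_conjugate p%:E) g <= Lp_norm (hoelder_conjugate p%:E) f.
Proof.
move=> p1 mg mf gf; have [[_ ->]|[q [_ q1 _ ->]]] := conjugate_cases p1.
  apply: ge_ereal_sup => _ [x _ <-].
  by apply: le_trans (ereal_sup_ubound _); last (by exists x); rewrite lee_fin.
have q0 : (0 < q)%R by rewrite (lt_trans ltr01).
rewrite !Lp_normE; apply: le_poweR.
- by rewrite invr_ge0 ltW.
- by apply: integral_ge0 => x _; rewrite lee_fin powR_ge0.
apply: ge0_le_integral => //.
- exact: measurable_powR_norm.
- exact: measurable_powR_norm.
- by move=> x _; rewrite lee_fin ge0_ler_powR ?nnegrE// ltW.
Qed.

(** For finite q, integrate |g|^q <= M^(q-1) |g|. *)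
Lemma kernel_Lp_norm_lty (p : R) g : (1 <= p)%R -> kernel g ->
  Lp_norm (hoelder_conjugate p%:E) g < +oo.
Proof.
move=> p1 [mg ig [M gM]]; have [[_ ->]|[q [_ q1 _ ->]]] := conjugate_cases p1.
  apply: (@le_lt_trans _ _ M%:E); last exact: ltry.
  by apply: ge_ereal_sup => _ [x _ <-]; rewrite lee_fin.
rewrite Lp_normE poweR_lty//.
have q0 : (0 < q)%R by rewrite (lt_trans ltr01).
have iM := integrable_norm (integrableZl_real (M `^ (q - 1)) ig).
apply: (@le_lt_trans _ _ (\int[mu]_x `|(M `^ (q - 1) * g x)%:E|)); last first.
  by case/integrableP: (integrableZl_real (M `^ (q - 1)) ig).
apply: ge0_le_integral => //.
- exact: measurable_powR_norm.
- by apply: measurableT_comp => //; apply/measurable_EFinP; exact: measurable_funM.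
move=> x _; rewrite lee_fin normrM (ger0_norm (powR_ge0 _ _)).
rewrite -mulr_powRB1// mulrC ler_wpM2r// ge0_ler_powR ?nnegrE//.
  by rewrite subr_ge0 ltW.
by rewrite (le_trans _ (gM 0%R)).
Qed.

(** Integrability by comparison with a multiple of the standard Gaussian, which is bounded below on
    the ball of radius [L]. *)
Lemma bounded_support_kernel g (M L : R) : measurable_fun setT g ->
  (forall x, `|g x| <= M)%R -> (forall x, L < enorm x -> g x = 0)%R -> kernel g.
Proof.
move=> mg gM gL; split => //; last by exists M.
have M0 : (0 <= M)%R by rewrite (le_trans _ (gM 0%R)).
pose c : R := ((2 * pi * 1) `^ (- (n%:R / 2)) * expR (- (L ^+ 2 / (2 * 1))))%R.
have c0 : (0 < c)%R by rewrite mulr_gt0 ?expR_gt0// powR_gt0// !mulr_gt0// pi_gt0.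
apply: (@le_integrable_real _ _ _ _ _ (fun x => M / c * gauss 1 x)%R) => //.
  move=> x; have [Lx|xL] := ltP L (enorm x).
    by rewrite gL// normr0 mulr_ge0 ?gauss_ge0// divr_ge0// ltW.
  rewrite (le_trans (gM x))// mulrAC ler_pdivlMr// ler_wpM2l//.
  rewrite /c /gauss ler_wpM2l ?powR_ge0// ler_expR lerN2 ler_wpM2r ?invr_ge0//.
  by rewrite ler_sqr ?nnegrE ?enorm_ge0// (le_trans _ xL)// enorm_ge0.
by apply: integrableZl_real; exact: (gauss_integrable n ltr01).
Qed.

(** At p = 1 the conjugate norm is a supremum and bounds [b] pointwise; the boundedness of [b] makes
    it a finite constant that leaves the integral. *)
Lemma hoelder_conj (p : R) a b : (1 <= p)%R ->
  measurable_fun setT a -> measurable_fun setT b -> (exists M, forall x, `|b x| <= M)%R ->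
  \int[mu]_x (`|a x * b x|)%:E <= Lp_norm p%:E a * Lp_norm (hoelder_conjugate p%:E) b.
Proof.
move=> p1 ma mb [M bM]; have [[-> ->]|[q [p1' q1 pq ->]]] := conjugate_cases p1.
  have S0 := Lp_norm_ge0 +oo b.
  have Sfin : Lp_norm +oo b \is a fin_num.
    rewrite ge0_fin_numE//; apply: (@le_lt_trans _ _ M%:E); last exact: ltry.
    by apply: ge_ereal_sup => _ [x _ <-]; rewrite lee_fin.
  rewrite {1}/Lp_norm Lnorm1 muleC -ge0_integralZl//; last first.
    by do 2 apply: measurableT_comp => //.
  apply: ge0_le_integral => //.
  - by do 2 apply: measurableT_comp => //; exact: measurable_funM.
  - by apply: emeasurable_funM => //; do 2 apply: measurableT_comp => //.
  move=> x _; rewrite normrM EFinM muleC lee_wpmul2r//.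
  by apply: ereal_sup_ubound; exists x.
have := @hoelder _ _ _ mu a b p q ma mb (lt_trans ltr01 p1') (lt_trans ltr01 q1) pq.
by rewrite Lnorm1.
Qed.

(** For finite q, split f k as (f k^(1/q)) k^(1/p), apply Hoelder in [y], and let Tonelli integrate
    [k] over the other variable. For q = oo the mass of the kernel bounds the supremum directly. *)
Lemma young (p : R) f k (c : R) : (1 <= p)%R -> (0 <= c)%R ->
  kernel f -> kernel k -> (forall x, 0 <= k x)%R -> (forall x, 0 <= f x)%R ->
  \int[mu]_x (k x)%:E <= c%:E ->
  Lp_norm (hoelder_conjugate p%:E) (fun x => \int[mu]_y (f y * k (x - y)))%R <=
    c%:E * Lp_norm (hoelder_conjugate p%:E) f.
Proof.
move=> p1 c0 kf kk k0 f0 kc.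
have [mf If [M fM]] := kf; have [mk Ik _] := kk.
have tf : tame f.
  split => //; exists 0%R, (fun x => `|f x|)%R; split=> //; first exact: integrable_norm.
  by move=> x; rewrite add0r.
have mkx x := measurable_reflect x mk.
have kcx x : \int[mu]_y (k (x - y))%:E <= c%:E.
  by rewrite (integral_reflect x (F := fun y => (k y)%:E))//; apply/measurable_EFinP.
have kcy y : \int[mu]_x (k (x - y))%:E <= c%:E.
  by rewrite (integral_translate (- y)%R (F := fun y => (k y)%:E))//; apply/measurable_EFinP.
have E x : (\int[mu]_y (f y * k (x - y))%R)%:E = \int[mu]_y (f y * k (x - y))%:E.
  by rewrite /Rintegral fineK//; apply: integrable_fin_num => //; exact: tame_kernel_integrable.
have c0x x : (0 <= \int[mu]_y (f y * k (x - y))%R)%R.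
  by apply: Rintegral_ge0 => y _; rewrite mulr_ge0.
have [[_ ->]|[q [p1' q1 pq ->]]] := conjugate_cases p1.
  have S0 := Lp_norm_ge0 +oo f.
  have Sfin : Lp_norm +oo f \is a fin_num.
    rewrite ge0_fin_numE//; apply: (@le_lt_trans _ _ M%:E); last exact: ltry.
    by apply: ge_ereal_sup => _ [x _ <-]; rewrite lee_fin.
  apply: ge_ereal_sup => _ [x _ <-]; rewrite ger0_norm// E.
  apply: (@le_trans _ _ (\int[mu]_y (Lp_norm +oo f * (k (x - y))%:E))).
    apply: ge0_le_integral => //.
    - by move=> y _; rewrite lee_fin mulr_ge0.
    - by apply/measurable_EFinP; exact: measurable_funM.
    - by apply: emeasurable_funM => //; apply/measurable_EFinP.
    move=> y _; rewrite EFinM lee_wpmul2r ?lee_fin//.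
    by apply: ereal_sup_ubound; exists y => //; rewrite ger0_norm.
  rewrite ge0_integralZl//; [|by apply/measurable_EFinP|by move=> y _; rewrite lee_fin].
  by rewrite muleC lee_wpmul2r.
have p0 : (0 < p)%R := lt_trans ltr01 p1'.
have q0 : (0 < q)%R := lt_trans ltr01 q1.
have qn0 : q != 0%R by rewrite gt_eqF.
have mfq : measurable_fun setT (fun y => (f y `^ q)%R).
  exact: measurable_fun_powR.
pose G (z : 'rV[R]_n * 'rV[R]_n) := (f z.2 `^ q * k (z.1 - z.2))%:E.
have mG : measurable_fun setT G.
  apply/measurable_EFinP; apply: measurable_funM.
    exact: (measurableT_comp mfq).
  by apply: measurableT_comp => //; exact: measurable_sub_rV.
have G0 z : 0 <= G z by rewrite lee_fin mulr_ge0 ?powR_ge0.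
have H x : ((\int[mu]_y (f y * k (x - y))%R) `^ q)%:E <=
    (\int[mu]_y G (x, y)) * (c `^ (q / p))%:E.
  pose A y := (f y * k (x - y) `^ q^-1)%R; pose B y := (k (x - y) `^ p^-1)%R.
  have mA : measurable_fun setT A.
    apply: measurable_funM => //.
    by apply: measurable_fun_powR.
  have mB : measurable_fun setT B.
    by apply: measurable_fun_powR.
  have := @hoelder _ _ _ mu A B q p mA mB q0 p0; rewrite addrC => /(_ pq).
  rewrite Lnorm1 [X in X <= _ -> _](_ : _ = (\int[mu]_y (f y * k (x - y))%R)%:E); last first.
    rewrite E; apply: eq_integral => y _ /=.
    rewrite /A /B /= -mulrA -powRD; last by rewrite addrC pq oner_eq0.
    by rewrite (addrC q^-1)%R pq powRr1// ger0_norm// mulr_ge0.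
  rewrite -!/(Lp_norm _%:E _) => hld.
  have hq : (\int[mu]_y (f y * k (x - y))%R)%:E `^ q <=
      (Lp_norm q%:E A * Lp_norm p%:E B) `^ q.
    by apply: le_poweR; [exact: ltW|rewrite lee_fin|exact: hld].
  rewrite -poweR_EFin (le_trans hq)// poweRM ?Lp_norm_ge0//.
  rewrite Lp_norm_powR// (_ : \int[mu]_y _ = \int[mu]_y G (x, y)); last first.
    apply: eq_integral => y _; rewrite /A /G /= ger0_norm ?mulr_ge0 ?powR_ge0//.
    by rewrite powRM ?powR_ge0// -powRrM mulVf// powRr1.
  rewrite lee_wpmul2l ?integral_ge0//.
  rewrite Lp_normE -poweRrM mulrC -poweR_EFin.
  apply: le_poweR.
  - by rewrite divr_ge0// ltW.
  - by apply: integral_ge0 => y _; rewrite lee_fin powR_ge0.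
  apply: le_trans (kcx x); rewrite le_eqVlt; apply/orP; left; apply/eqP.
  apply: eq_integral => y _; rewrite /B ger0_norm ?powR_ge0//.
  by rewrite -powRrM mulVf ?gt_eqF// powRr1.
rewrite !Lp_normE.
have I0 : 0 <= \int[mu]_x (`|f x| `^ q)%:E by apply: integral_ge0 => x _; rewrite lee_fin powR_ge0.
(* Hoelder costs c^(q/p) and Tonelli a further c; the q-th root of their product is c^(1/p + 1/q) =
   c. *)
rewrite -[X in X%:E * _](powRr1 c0) -pq powRD; last by rewrite pq oner_eq0.
apply: (@le_trans _ _ (((c `^ (q / p))%:E * c%:E * \int[mu]_x (`|f x| `^ q)%:E) `^ q^-1)).
  apply: le_poweR.
  - by rewrite invr_ge0 ltW.
  - by apply: integral_ge0 => x _; rewrite lee_fin powR_ge0.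
  apply: (@le_trans _ _ (\int[mu]_x ((c `^ (q / p))%:E * \int[mu]_y G (x, y)))).
    apply: ge0_le_integral => //.
    - apply: measurable_powR_norm; apply/measurable_EFinP.
      rewrite (_ : _ \o _ = (fun x => \int[mu]_y (f y * k (x - y))%:E)); last first.
        by apply/funext => x; rewrite /= E.
      pose G1 (z : 'rV[R]_n * 'rV[R]_n) := (f z.2 * k (z.1 - z.2))%:E.
      apply: (@measurable_fun_fubini_tonelli_F _ _ _ _ R mu G1) => [|z].
        apply/measurable_EFinP; apply: measurable_funM; first exact: (measurableT_comp mf).
        by apply: measurableT_comp => //; exact: measurable_sub_rV.
      by rewrite lee_fin mulr_ge0.
    - by apply: measurable_funeM; exact: (@measurable_fun_fubini_tonelli_F _ _ _ _ R mu G).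
    - by move=> x _; rewrite ger0_norm// muleC.
  rewrite ge0_integralZl_EFin ?powR_ge0//; last 2 first.
  - by move=> x _; exact: integral_ge0.
  - exact: (@measurable_fun_fubini_tonelli_F _ _ _ _ R mu G).
  rewrite -muleA lee_wpmul2l ?lee_fin ?powR_ge0// fubini_tonelli//.
  rewrite -ge0_integralZl_EFin//; last first.
  - exact: measurable_powR_norm.
  apply: ge0_le_integral => //.
  - by move=> y _; exact: integral_ge0.
  - exact: (@measurable_fun_fubini_tonelli_G _ _ _ _ R mu G).
  - by apply: measurable_funeM; exact: measurable_powR_norm.
  move=> y _; rewrite /G /=; under eq_integral do rewrite EFinM.
  rewrite ge0_integralZl_EFin ?powR_ge0//; last 2 first.
  - by move=> x _; rewrite lee_fin.
  - apply/measurable_EFinP; apply: measurableT_comp => //.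
    rewrite (_ : (fun x => _) = (fun x => 1 *: x + (- y)))%R; first exact: measurable_affine_rV.
    by apply/funext => x; rewrite scale1r.
  by rewrite muleC (ger0_norm (f0 y)) lee_wpmul2r// lee_fin powR_ge0.
rewrite poweRM//; last by rewrite mule_ge0 ?lee_fin ?powR_ge0.
rewrite -EFinM poweR_EFin powRM ?powR_ge0// -powRrM.
by rewrite (_ : q / p * q^-1 = p^-1)%R//; field; rewrite qn0 gt_eqF.
Qed.

End Lp_norm.

(** * Heat extension of vector fields *)

Section fields.
Context (R : realType) (n : nat).
Local Notation mu := (lebesgue_rV R n).
Implicit Types (f g a b k : 'rV[R]_n -> R) (x y : 'rV[R]_n)
  (Phi : 'rV[R]_n -> 'rV[R]_n).

Lemma Rintegral_sum_integrable (F : 'I_n -> 'rV[R]_n -> R) :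
  (forall i, mu.-integrable setT (EFin \o F i)) ->
  mu.-integrable setT (EFin \o (fun x => \sum_(i < n) F i x)) /\
  \int[mu]_x (\sum_(i < n) F i x) = \sum_(i < n) \int[mu]_x F i x.
Proof.
move=> iF; elim: (index_enum 'I_n) => [|i s [IH1 IH2]].
  have -> : (fun x => \sum_(i <- [::]) F i x) = cst 0.
    by apply/funext => x; rewrite big_nil.
  split; first by rewrite (_ : EFin \o _ = cst 0%E)//; exact: integrable0.
  by rewrite big_nil Rintegral_cst// mul0r.
have -> : (fun x => \sum_(j <- i :: s) F j x) = (fun x => F i x + \sum_(j <- s) F j x).
  by apply/funext => x; rewrite big_cons.
split; first exact: integrableD_real.
by rewrite big_cons RintegralD// IH2.
Qed.

Definition heat_field t Phi : 'rV[R]_n -> 'rV[R]_n :=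
  fun x => \row_i heat t (fun y => Phi y ord0 i) x.

Section bounds.
Variables (t : R) (Phi : 'rV[R]_n -> 'rV[R]_n).
Hypothesis t0 : 0 < t.
Hypothesis mPhi : forall i, measurable_fun setT (fun x => Phi x ord0 i).
Hypothesis kPhi : kernel (fun x => enorm (Phi x)).

Lemma kernel_coord i : kernel (fun x => Phi x ord0 i).
Proof.
have [_ iP [M PM]] := kPhi; split => //.
  by apply: le_integrable_real iP => // x; exact: coord_le_enorm.
exists M => x; rewrite (le_trans (coord_le_enorm _ _))//.
by rewrite (le_trans (ler_norm _)).
Qed.

Lemma kernel_tame g : kernel g -> tame g.
Proof.
move=> [mg ig _]; split => //; exists 0, (fun x => `|g x|); split => //.
  exact: integrable_norm.
by move=> x; rewrite add0r.
Qed.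

Let tcoord i := kernel_tame (kernel_coord i).

(** With v = P_t Phi(x), |v|^2 is the average of <v, Phi(y)> against the Gaussian, and
    Cauchy-Schwarz in R^n bounds it by |v| times the right-hand side. *)
Lemma enorm_heat_field x :
  enorm (heat_field t Phi x) <= \int[mu]_y (enorm (Phi y) * gauss t (x - y)).
Proof.
set v := heat_field t Phi x.
have [v0|v0] := eqVneq (enorm v) 0.
  rewrite v0; apply: Rintegral_ge0 => y _.
  by rewrite mulr_ge0 ?enorm_ge0// gauss_ge0.
have vp : 0 < enorm v by rewrite lt0r v0 enorm_ge0.
rewrite -(ler_pM2l vp) -expr2 enorm_sqr {2}/v /dotp.
have ig := tame_kernel_integrable x (kernel_tame kPhi) (kernel_gauss n t0).
have ii i : mu.-integrable setT (EFin \o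
    (fun y => v ord0 i * (Phi y ord0 i * gauss t (x - y)))).
  apply: integrableZl_real.
  exact: tame_kernel_integrable (tcoord i) (kernel_gauss n t0).
rewrite (eq_bigr (fun i => \int[mu]_y (v ord0 i * (Phi y ord0 i * gauss t (x - y))))); last first.
  move=> i _; rewrite mxE (heatE t0 x (tcoord i)) RintegralZl//.
  exact: tame_kernel_integrable (tcoord i) (kernel_gauss n t0).
have [I1 <-] := Rintegral_sum_integrable ii.
rewrite -RintegralZl//; apply: le_Rintegral => //; first exact: integrableZl_real.
move=> y _; rewrite (eq_bigr (fun i => v ord0 i * Phi y ord0 i * gauss t (x - y))); last first.
  by move=> i _; rewrite mulrA.
rewrite -mulr_suml mulrA ler_wpM2r ?gauss_ge0//.
by rewrite (le_trans (ler_norm _))// dotp_le_enorm.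
Qed.

Lemma partial_heat f i x : tame f -> partial i (heat t f) x =
  \int[mu]_y (f y * gauss_deriv t (delta_mx ord0 i) (x - y)).
Proof. by move=> tf; have [_] := is_derive_heat t0 x (delta_mx ord0 i) tf. Qed.

Lemma divergence_heat_field x : divergence (heat_field t Phi) x =
  \sum_(i < n) \int[mu]_y (Phi y ord0 i * gauss_deriv t (delta_mx ord0 i) (x - y)).
Proof.
apply: eq_bigr => i _; rewrite -(partial_heat i x (tcoord i)).
by congr (partial i _ x); apply/funext => y; rewrite mxE.
Qed.

(** The coordinates recombine into -<Phi(y), x - y> / t times the Gaussian before absolute values
    are taken, so the dimension enters only through the first moment of the Gaussian. *)
Lemma divergence_heat_field_le x : `|divergence (heat_field t Phi) x| <=
  \int[mu]_y (enorm (Phi y) * (t^-1 * (gauss t (x - y) * enorm (x - y)))).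
Proof.
have kg i := kernel_gauss_deriv t0 (delta_mx ord0 i : 'rV[R]_n).
rewrite divergence_heat_field.
have [I1 <-] := Rintegral_sum_integrable
  (fun i => tame_kernel_integrable x (tcoord i) (kg i)).
rewrite (le_trans (le_normr_Rintegral _ I1))//.
apply: le_Rintegral => //; first exact: integrable_norm.
  exact: (tame_kernel_integrable x (kernel_tame kPhi) (kernelZ t^-1 (kernel_gauss_enorm n t0))).
move=> y _.
rewrite (eq_bigr (fun i => Phi y ord0 i * (x - y) ord0 i * (- (gauss t (x - y) / t)))); last first.
  by move=> i _; rewrite /gauss_deriv dotpC dotp_delta; ring.
rewrite -mulr_suml normrM normrN normrM normfV (gtr0_norm t0) (ger0_norm (gauss_ge0 t0 _)).
rewrite [leRHS](_ : _ = enorm (Phi y) * enorm (x - y) * (gauss t (x - y) / t)); last ring.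
by rewrite ler_wpM2r ?dotp_le_enorm// divr_ge0 ?gauss_ge0// ltW.
Qed.

(** The differentiated Gaussian is odd, so exchanging the integrals moves the derivative from [f] to
    [Phi] with a minus sign. This replaces integration by parts for fields that may be neither
    smooth nor compactly supported. *)
Lemma gradient_heat_duality f : tame f ->
  mu.-integrable setT (EFin \o (fun x => divergence (heat_field t Phi) x * f x)) /\
  \int[mu]_x dotp (gradient (heat t f) x) (Phi x) =
    - \int[mu]_x (divergence (heat_field t Phi) x * f x).
Proof.
move=> tf; have kg i := kernel_gauss_deriv t0 (delta_mx ord0 i : 'rV[R]_n).
have ic i : mu.-integrable setT (EFin \o (fun x => Phi x ord0 i)) by case: (kernel_coord i).
have sw i := kernel_swap (ic i) tf (kg i).
have E x i : \int[mu]_y (Phi y ord0 i * gauss_deriv t (delta_mx ord0 i) (y - x)) =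
    - \int[mu]_y (Phi y ord0 i * gauss_deriv t (delta_mx ord0 i) (x - y)).
  rewrite -mulN1r -RintegralZl//; last exact: tame_kernel_integrable (tcoord i) (kg i).
  by apply: eq_Rintegral => y _; rewrite -opprB gauss_derivN mulrN mulN1r.
have i2 i : mu.-integrable setT (EFin \o (fun x =>
    \int[mu]_y (Phi y ord0 i * gauss_deriv t (delta_mx ord0 i) (x - y)) * f x)).
  have [_ h _] := sw i.
  rewrite (_ : (fun x => _) = (fun x => -1 * (f x * \int[mu]_y (Phi y ord0 i * gauss_deriv t (delta_mx ord0 i) (y - x))))).
    exact: integrableZl_real.
  by apply/funext => x; rewrite E mulrN mulN1r opprK mulrC.
have [J1 J2] := Rintegral_sum_integrable i2.
have DE : (fun x => divergence (heat_field t Phi) x * f x) = (fun x =>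
  \sum_(i < n) \int[mu]_y (Phi y ord0 i * gauss_deriv t (delta_mx ord0 i) (x - y)) * f x).
  by apply/funext => x; rewrite divergence_heat_field mulr_suml.
split; first by rewrite DE.
rewrite DE J2 -sumrN.
have i1 i : mu.-integrable setT (EFin \o (fun x =>
    Phi x ord0 i * \int[mu]_y (f y * gauss_deriv t (delta_mx ord0 i) (x - y)))).
  by have [h _ _] := sw i.
have [K1 K2] := Rintegral_sum_integrable i1.
transitivity (\int[mu]_x \sum_(i < n) (Phi x ord0 i *
   \int[mu]_y (f y * gauss_deriv t (delta_mx ord0 i) (x - y)))).
  apply: eq_Rintegral => x _; apply: eq_bigr => i _.
  by rewrite mxE partial_heat// mulrC.
rewrite K2; apply: eq_bigr => i _.
have [_ h ->] := sw i.
rewrite -mulN1r -RintegralZl//; apply: eq_Rintegral => x _.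
by rewrite E mulN1r mulrN [in RHS]mulrC.
Qed.

End bounds.

End fields.

(** * Bounding U by V *)

Section cutoff.
Context (R : realType) (n : nat).
Local Notation mu := (lebesgue_rV R n).
Implicit Types (f g : 'rV[R]_n -> R) (x y : 'rV[R]_n)
  (Psi : 'rV[R]_n -> 'rV[R]_n) (rho : R).

(** On the ball of radius 1 / rho this is exp (1 - 1 / (1 - rho^2 |x|^2)); the factor e makes it 1
    at the origin. *)
Definition cutoff rho x : R := expR 1 * flat 0 (1 + (- rho ^+ 2) * dotp x x).

Lemma cutoff_ge0 rho x : 0 <= cutoff rho x.
Proof. by rewrite mulr_ge0 ?expR_ge0 ?flat_ge0. Qed.

Lemma cutoff_le1 rho x : cutoff rho x <= 1.
Proof.
rewrite /cutoff /flat; case: ifPn => [y0|_]; last by rewrite mulr0.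
rewrite expr0 mul1r -expRD expR_le1 subr_le0.
rewrite -[leLHS]invr1 lef_pV2 ?posrE ?ltr01//.
by rewrite gerDl mulNr oppr_le0 mulr_ge0 ?sqr_ge0 ?dotp_ge0.
Qed.

Lemma cutoff_eq0 rho x : 1 <= rho ^+ 2 * dotp x x -> cutoff rho x = 0.
Proof.
move=> h; rewrite /cutoff /flat ifF ?mulr0//; apply/negbTE; rewrite -leNgt mulNr.
lra.
Qed.

Lemma is_derive_cutoff rho x (v : 'rV[R]_n) : is_derive x v (cutoff rho)
  (expR 1 * (flat 2 (1 + (- rho ^+ 2) * dotp x x) * (2 * (- rho ^+ 2) * dotp v x))).
Proof.
have d := is_derive_comp_dotp v (is_derive_flat 0 (1 + (- rho ^+ 2) * dotp x x)).
have := is_deriveM (is_derive_cst (expR 1 : R) x v) d.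
move/is_derive_eq; apply.
by rewrite /GRing.scale/= mulr0 addr0 oppr0 mul0r add0r.
Qed.

Lemma cutoff_algebra rho : algebra_of (@gen R n) (cutoff rho).
Proof.
apply: (@algebraM _ _ _ (cst (expR 1)) (fun x => flat 0 (1 + (- rho ^+ 2) * dotp x x))).
  exact: algebra_cst.
exact/algebra_base/gen_flat.
Qed.

(** Where the cutoff is nonzero rho |x| < 1, so the factor 2 rho^2 <y,x> of the chain rule is at
    most 2 rho |y|; the remaining 6 is the 3! of [flat_le] at an argument in [0, 1]. *)
Lemma cutoff_grad_le rho x y : 0 < rho -> rho <= 1 ->
  `|expR 1 * (flat 2 (1 + (- rho ^+ 2) * dotp x x) * (2 * (- rho ^+ 2) * dotp y x))|
    <= 12 * expR 1 * rho * enorm y.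
Proof.
move=> r0 r1; rewrite normrM (ger0_norm (expR_ge0 1)) !normrM normrN.
rewrite [leRHS](_ : _ = expR 1 * (6 * (2 * rho * enorm y))); last ring.
rewrite ler_wpM2l ?expR_ge0//.
have [h|h] := leP 1 (rho ^+ 2 * dotp x x).
  rewrite /flat ifF; last by apply/negbTE; rewrite -leNgt mulNr; lra.
  by rewrite normr0 mul0r !mulr_ge0 ?enorm_ge0// ltW.
have d0 := dotp_ge0 x.
have q0 : 0 <= rho ^+ 2 * dotp x x by rewrite mulr_ge0 ?sqr_ge0.
apply: ler_pM => //.
  rewrite (le_trans (flat_le 2 0 _))//= expr1.
  have -> : ((2 + 0).+1`!%:R : R) = 6 by [].
  by rewrite -[leRHS]mulr1 ler_wpM2l// mulNr ger0_norm; lra.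
rewrite (@ger0_norm _ 2)// (@ger0_norm _ (rho ^+ 2)) ?sqr_ge0//.
rewrite [leLHS](_ : _ = 2 * rho * (rho * `|dotp y x|)); last ring.
rewrite ler_wpM2l ?mulr_ge0 ?(ltW r0)//.
rewrite (@le_trans _ _ (rho * (enorm y * enorm x)))//.
  by rewrite ler_wpM2l ?(ltW r0)// dotp_le_enorm.
rewrite mulrCA ler_piMr ?enorm_ge0//.
rewrite -ler_sqr ?nnegrE ?mulr_ge0 ?enorm_ge0 ?(ltW r0)//.
by rewrite expr1n exprMn enorm_sqr ltW.
Qed.

Lemma cutoff_support rho Psi : 0 < rho ->
  compact (closure [set x | cutoff rho x *: Psi x != 0]).
Proof.
move=> r0.
pose B := [set x : 'rV[R]_n | forall i, `[- rho^-1, rho^-1]%classic (x ord0 i)].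
have cB : compact B by apply: (@rV_compact R n (fun=> `[- rho^-1, rho^-1]%classic)) => i; exact: segment_compact.
apply: (subclosed_compact _ cB); first exact: closed_closure.
have clB : closed B by apply: compact_closed => //; exact: (@norm_hausdorff R ('rV[R]_n : normedModType R)).
rewrite (closure_id B).1//; apply: closure_subset => x /= hx i.
have [h|h] := leP 1 (rho ^+ 2 * dotp x x).
  by rewrite cutoff_eq0 ?scale0r ?eqxx in hx.
rewrite /= in_itv/= -ler_norml (le_trans (coord_le_enorm x i))//.
rewrite -[leRHS]mulr1 ler_pdivlMl//.
rewrite -ler_sqr ?nnegrE ?mulr_ge0 ?enorm_ge0 ?(ltW r0)//.
by rewrite expr1n exprMn enorm_sqr ltW.
Qed.

(** Continuity in [rho] at 0, where the cutoff is identically 1. *)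
Lemma cutoff_cvg x : cutoff k.+1%:R^-1 x @[k --> \oo] --> (1 : R).
Proof.
have c1 : cutoff 0 x = 1.
  by rewrite /cutoff expr0n oppr0 mul0r addr0 /flat ltr01 expr0 mul1r invr1 -expRD subrr expR0.
pose q (u : R) := 1 + (- u ^+ 2) * dotp x x.
have cq : {for 0, continuous q}.
  have [dq _] : is_derive (0 : R) 1 q 0.
    by apply: is_derive_eq; rewrite /GRing.scale/=; ring.
  exact/differentiable_continuous/derivable1_diffP.
have cQ : {for 0, continuous (fun u => cutoff u x)}.
  apply: (@continuousM _ _ (cst (expR 1)) (flat 0 \o q)); first exact: cst_continuous.
  by apply: continuous_comp; [exact: cq|exact: continuous_flat].
have := continuous_cvg _ cQ (@cvg_harmonic R); rewrite c1; exact.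
Qed.

Lemma partial_cutoff rho (h : 'rV[R]_n -> R) i x d :
  is_derive x (delta_mx ord0 i) h d ->
  partial i (fun y => cutoff rho y * h y) x = cutoff rho x * d +
   h x * (expR 1 * (flat 2 (1 + (- rho ^+ 2) * dotp x x) *
     (2 * (- rho ^+ 2) * x ord0 i))).
Proof.
move=> dh; have dc := is_derive_cutoff rho x (delta_mx ord0 i).
have [_] := is_deriveM dc dh.
by rewrite /partial (dotpC _ x) dotp_delta => ->.
Qed.

Section field.
Variables (t : R) (Phi : 'rV[R]_n -> 'rV[R]_n).
Hypothesis t0 : 0 < t.
Hypothesis mPhi : forall i, measurable_fun setT (fun x => Phi x ord0 i).
Hypothesis kPhi : kernel (fun x => enorm (Phi x)).
Let psi := heat_field t Phi.

Let tcoord i : tame (fun x => Phi x ord0 i).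
Proof. exact: kernel_tame (kernel_coord mPhi kPhi i). Qed.

Lemma cutoff_heat_coord rho i : (fun x => (cutoff rho x *: psi x) ord0 i) =
  (fun x => cutoff rho x * heat t (fun y => Phi y ord0 i) x).
Proof. by apply/funext => x; rewrite !mxE. Qed.

Lemma cutoff_test_field rho : 0 < rho -> test_field (fun x => cutoff rho x *: psi x).
Proof.
move=> r0; split; last exact: cutoff_support.
move=> i; rewrite cutoff_heat_coord; apply: (algebra_of_smooth (@gen_stable R n)).
by apply: algebraM; [exact: cutoff_algebra|exact: heat_algebra].
Qed.

Lemma divergence_cutoff rho x : divergence (fun x => cutoff rho x *: psi x) x =
  cutoff rho x * divergence psi x +
  expR 1 * (flat 2 (1 + (- rho ^+ 2) * dotp x x) * (2 * (- rho ^+ 2) * dotp (psi x) x)).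
Proof.
rewrite {1}/divergence (eq_bigr (fun i => cutoff rho x *
    \int[mu]_y (Phi y ord0 i * gauss_deriv t (delta_mx ord0 i) (x - y)) +
  expR 1 * (flat 2 (1 + (- rho ^+ 2) * dotp x x) * (2 * (- rho ^+ 2))) *
    (psi x ord0 i * x ord0 i))); last first.
  move=> i _; rewrite cutoff_heat_coord.
  rewrite (partial_cutoff rho (is_derive_heat t0 x (delta_mx ord0 i) (tcoord i))).
  by rewrite [psi x ord0 i]mxE; ring.
rewrite big_split/= -!mulr_sumr -/(dotp (psi x) x).
by rewrite -(divergence_heat_field t0 mPhi kPhi) -/psi; ring.
Qed.

End field.

End cutoff.

(** * Admissible constants tested on heat extensions *)

Section duality.
Context (R : realType) (n : nat).
Local Notation mu := (lebesgue_rV R n).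
Implicit Types (f g : 'rV[R]_n -> R) (x y : 'rV[R]_n)
  (Phi Psi : 'rV[R]_n -> 'rV[R]_n).

Lemma smooth_continuous g : smooth g -> continuous g.
Proof. by move=> /(_ [::])[]. Qed.

Lemma smooth_partial_continuous g i : smooth g -> continuous (partial i g).
Proof. by move=> /(_ [:: i])[]. Qed.

Lemma measurable_divergence Psi : (forall i, smooth (fun x => Psi x ord0 i)) ->
  measurable_fun setT (divergence Psi).
Proof.
move=> sPsi; apply: measurable_sum => i; apply: continuous_measurable_rV.
exact: smooth_partial_continuous.
Qed.

Lemma measurable_enorm_field Psi : (forall i, measurable_fun setT (fun x => Psi x ord0 i)) ->
  measurable_fun setT (fun x => enorm (Psi x)).
Proof.
move=> mPsi; apply: (measurableT_comp (@measurable_enorm R n)).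
exact: measurable_fun_rV.
Qed.

Lemma measurable_conv f k : kernel f -> kernel k -> (forall x, 0 <= k x) ->
  (forall x, 0 <= f x) -> measurable_fun setT (fun x => \int[mu]_y (f y * k (x - y))).
Proof.
move=> kf kk k0 f0; have [mf If _] := kf; have [mk _ _] := kk.
pose G (z : 'rV[R]_n * 'rV[R]_n) := (f z.2 * k (z.1 - z.2))%:E.
have mG : measurable_fun setT G.
  apply/measurable_EFinP; apply: measurable_funM; first exact: (measurableT_comp mf).
  by apply: measurableT_comp => //; exact: measurable_sub_rV.
apply/measurable_EFinP; rewrite (_ : EFin \o _ = fubini_F mu G).
  apply: measurable_fun_fubini_tonelli_F => // z.
  by rewrite lee_fin mulr_ge0.
apply/funext => x; rewrite /= /fubini_F /Rintegral fineK//.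
by apply: integrable_fin_num => //; exact: tame_kernel_integrable (kernel_tame kf) kk.
Qed.

Lemma powR1D_le (a u : R) : 0 <= a -> a <= 1 -> 0 <= u -> (1 + u) `^ a <= 1 + u.
Proof. by move=> a0 a1 u0; rewrite ler1_powR ?lerDl. Qed.

(** Isolates the error made by a cutoff as a factor that tends to 1 with [w]. *)
Lemma powR_le1D (a u w : R) : 0 <= a -> a <= 1 -> 0 < u -> 0 <= w ->
  (u + w) `^ a <= u `^ a * (1 + w / u).
Proof.
move=> a0 a1 u0 w0.
have wu : 0 <= w / u by rewrite divr_ge0// ltW.
have -> : u + w = u * (1 + w / u) by field; rewrite gt_eqF.
rewrite powRM ?(ltW u0) ?addr_ge0// ler_wpM2l ?powR_ge0// powR1D_le//.
Qed.

(** Repeats the condition inside [V], so that members of the set whose infimum is [V] are admissible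
    by unfolding. *)
Definition admissible (p alpha : R) f (C : R) := 0 <= C /\
  forall Phi, test_field Phi ->
      (\int[mu]_x (divergence Phi x * f x)%:E <=
       C%:E * Lp_norm (hoelder_conjugate p%:E) (@enorm R n \o Phi) `^ alpha
            * Lp_norm (hoelder_conjugate p%:E) (divergence Phi) `^ (1 - alpha))%E.

(** Both terms in the divergence of the cut field, including the gradient of the cutoff against P_t
    Phi, are bounded by one convolution of |Phi| with [K rho], of mass at most kappa + c rho. A
    single use of Young thus keeps the sharp constant sqrt (n / t) as rho -> 0. *)
Lemma admissible_heat_field (p alpha C t : R) f Phi :
  (0 < n)%N -> 1 <= p -> 0 < alpha -> alpha <= 1 -> tame f -> admissible p alpha f C ->
  0 < t -> (forall i, measurable_fun setT (fun x => Phi x ord0 i)) ->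
  kernel (fun x => enorm (Phi x)) ->
  \int[mu]_x (divergence (heat_field t Phi) x * f x) <=
    C * Num.sqrt (n%:R / t) `^ (1 - alpha) *
    fine (Lp_norm (hoelder_conjugate p%:E) (fun x => enorm (Phi x))).
Proof.
move=> n0 p1 al0 al1 tf [C0 adC] t0 mPhi kPhi.
set q := hoelder_conjugate p%:E; set N := fine _.
have NE : Lp_norm q (fun x => enorm (Phi x)) = N%:E.
  by rewrite fineK// ge0_fin_numE ?kernel_Lp_norm_lty// Lp_norm_ge0.
have N0 : 0 <= N by rewrite fine_ge0// Lp_norm_ge0.
have a0 : 0 <= 1 - alpha by rewrite subr_ge0.
have a1 : 1 - alpha <= 1 by rewrite gerBl ltW.
(* The bound sqrt (n t) on the first moment, divided by t. *)
pose kappa : R := Num.sqrt (n%:R / t).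
have kp : 0 < kappa by rewrite sqrtr_gt0 divr_gt0// ltr0n.
have kE : t^-1 * Num.sqrt (n%:R * t) = kappa.
  rewrite /kappa [n%:R / t](_ : _ = t^-1 ^+ 2 * (n%:R * t)); last by field; rewrite gt_eqF.
  by rewrite [RHS]sqrtrM ?sqr_ge0// sqrtr_sqr ger0_norm// invr_ge0 ltW.
(* The constant of [cutoff_grad_le]. *)
pose c : R := 12 * expR 1.
have c0 : 0 <= c by rewrite mulr_ge0// expR_ge0.
pose K rho x := t^-1 * (gauss t x * enorm x) + c * rho * gauss t x.
have kK rho : kernel (K rho).
  apply: kernelD; first exact/kernelZ/kernel_gauss_enorm.
  exact/kernelZ/kernel_gauss.
have K0 rho x : 0 <= rho -> 0 <= K rho x.
  move=> r0; rewrite addr_ge0//.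
    by rewrite mulr_ge0 ?invr_ge0 ?(ltW t0)// mulr_ge0 ?enorm_ge0 ?gauss_ge0.
  by rewrite mulr_ge0 ?gauss_ge0// mulr_ge0.
have IK rho : 0 <= rho -> (\int[mu]_x (K rho x)%:E <= (kappa + c * rho)%:E)%E.
  move=> r0.
  have [_ i1 _] := kernel_gauss_enorm n t0; have [_ i2 _] := kernel_gauss n t0.
  rewrite (eq_integral (fun x => (t^-1)%:E * (gauss t x * enorm x)%:E +
     (c * rho)%:E * (gauss t x)%:E)%E); last by move=> x _; rewrite -!EFinM -EFinD.
  rewrite integralD//; [|exact: integrableZl|exact: integrableZl].
  rewrite !integralZl// (integral_gauss n t0) mule1 EFinD leeD2r// -kE EFinM.
  by rewrite lee_wpmul2l ?lee_fin ?invr_ge0 ?(ltW t0)// gauss_moment1.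
set psi := heat_field t Phi.
have f0 x : 0 <= enorm (Phi x) by exact: enorm_ge0.
pose Pk (k : nat) x := cutoff k.+1%:R^-1 x *: psi x.
have r0 (k : nat) : 0 < k.+1%:R^-1 :> R by rewrite invr_gt0.
have r1 (k : nat) : k.+1%:R^-1 <= 1 :> R by rewrite invf_le1 ?ler1n.
have tPk k : test_field (Pk k) by exact: cutoff_test_field.
have dPk k x : `|divergence (Pk k) x - cutoff k.+1%:R^-1 x * divergence psi x| <=
    c * k.+1%:R^-1 * enorm (psi x).
  by rewrite (divergence_cutoff t0 mPhi kPhi) addrAC subrr add0r cutoff_grad_le.
have epsi x : enorm (psi x) <= \int[mu]_y (enorm (Phi y) * gauss t (x - y)).
  exact: enorm_heat_field.
have dPkK k x : `|divergence (Pk k) x| <=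
    \int[mu]_y (enorm (Phi y) * K k.+1%:R^-1 (x - y)).
  have -> : \int[mu]_y (enorm (Phi y) * K k.+1%:R^-1 (x - y)) =
     \int[mu]_y (enorm (Phi y) * (t^-1 * (gauss t (x - y) * enorm (x - y)))) +
     c * k.+1%:R^-1 * \int[mu]_y (enorm (Phi y) * gauss t (x - y)).
    have i1 := tame_kernel_integrable x (kernel_tame kPhi) (kernelZ t^-1 (kernel_gauss_enorm n t0)).
    have i2 := tame_kernel_integrable x (kernel_tame kPhi) (kernel_gauss n t0).
    rewrite -RintegralZl// -RintegralD//; last exact: integrableZl_real.
    by apply: eq_Rintegral => y _; rewrite /K mulrDr; congr (_ + _); rewrite mulrCA.
  rewrite -[divergence _ _](subrK (cutoff k.+1%:R^-1 x * divergence psi x)).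
  rewrite (le_trans (ler_normD _ _))// addrC lerD//.
    rewrite normrM (le_trans _ (divergence_heat_field_le t0 mPhi kPhi x))//.
    by rewrite ler_piMl// ger0_norm ?cutoff_ge0// cutoff_le1.
  by rewrite (le_trans (dPk k x))// ler_wpM2l ?epsi// mulr_ge0//.
have mPk k i : measurable_fun setT (fun x => Pk k x ord0 i).
  by have [h _] := tPk k; exact: (continuous_measurable_rV (smooth_continuous (h i))).
have mdPk k : measurable_fun setT (divergence (Pk k)).
  by apply: measurable_divergence; case: (tPk k).
have bound k : (\int[mu]_x (divergence (Pk k) x * f x)%:E <=
    (C * kappa `^ (1 - alpha) * N * (1 + c * k.+1%:R^-1 / kappa))%:E)%E.
  apply: le_trans (adC _ (tPk k)) _.
  have h1 : (Lp_norm q (@enorm R n \o Pk k) <= N%:E)%E.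
    have := @young R n p (fun x => enorm (Phi x)) (gauss t) 1 p1 ler01 kPhi
      (kernel_gauss n t0) (fun x => gauss_ge0 t0 x) f0.
    rewrite (integral_gauss n t0) lexx mul1e NE => /(_ isT); apply: le_trans.
    apply: le_Lp_norm => //.
    - exact: measurable_enorm_field.
    - exact: (measurable_conv kPhi (kernel_gauss n t0) (fun x => gauss_ge0 t0 x) f0).
    move=> x /=; rewrite enormZ (ger0_norm (cutoff_ge0 _ _)).
    rewrite (ger0_norm (mulr_ge0 (cutoff_ge0 _ _) (enorm_ge0 _))).
    rewrite (le_trans _ (ler_norm _))// (le_trans _ (epsi x))//.
    by rewrite ler_piMl ?enorm_ge0// cutoff_le1.
  have h2 : (Lp_norm q (divergence (Pk k)) <= ((kappa + c * k.+1%:R^-1) * N)%:E)%E.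
    have rk := ltW (r0 k).
    have k0 : 0 <= kappa + c * k.+1%:R^-1 by rewrite addr_ge0 ?(ltW kp)// mulr_ge0.
    have := @young R n p (fun x => enorm (Phi x)) (K k.+1%:R^-1) _ p1 k0 kPhi
      (kK _) (fun x => K0 _ x rk) f0 (IK _ rk).
    rewrite NE -EFinM; apply: le_trans.
    apply: le_Lp_norm => //.
      exact: (measurable_conv kPhi (kK _) (fun x => K0 _ x rk) f0).
    by move=> x;rewrite (le_trans (dPkK k x))// ler_norm.
  apply: (@le_trans _ _ (C%:E * (N `^ alpha)%:E * (((kappa + c * k.+1%:R^-1) * N) `^ (1 - alpha))%:E)%E).
    apply: lee_pmul; rewrite ?poweR_ge0 ?mule_ge0 ?poweR_ge0 ?lee_fin//.
      rewrite lee_wpmul2l ?lee_fin// -poweR_EFin le_poweR ?(ltW al0) ?Lp_norm_ge0//.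
    by rewrite -poweR_EFin le_poweR ?Lp_norm_ge0.
  rewrite -!EFinM lee_fin.
  have rk := ltW (r0 k).
  have k0 : 0 <= kappa + c * k.+1%:R^-1 by rewrite addr_ge0 ?(ltW kp)// mulr_ge0.
  rewrite powRM//.
  rewrite [leLHS](_ : _ = C * (N `^ alpha * N `^ (1 - alpha)) * (kappa + c * k.+1%:R^-1) `^ (1 - alpha)); last ring.
  rewrite -powRD; last by rewrite addrC subrK oner_eq0.
  rewrite addrC subrK powRr1//.
  rewrite [leRHS](_ : _ = C * N * (kappa `^ (1 - alpha) * (1 + c * k.+1%:R^-1 / kappa))); last ring.
  by rewrite ler_wpM2l ?mulr_ge0// powR_le1D// mulr_ge0.
have [mf _] := tf.
have [If _] := gradient_heat_duality t0 mPhi kPhi tf; rewrite -/psi in If.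
have spsi i : smooth (fun x => psi x ord0 i).
  have -> : (fun x => psi x ord0 i) = heat t (fun y => Phi y ord0 i).
    by apply/funext => x; rewrite mxE.
  exact: (heat_smooth t0 (kernel_tame (kernel_coord mPhi kPhi i))).
have mdpsi : measurable_fun setT (divergence psi) by exact: measurable_divergence.
(* As rho = 1 / (k + 1) is at most 1, the kernel [K 1] dominates all the others and gives a majorant
   independent of k. *)
pose D x := `|f x| * \int[mu]_y (enorm (Phi y) * K 1 (x - y)).
have iD : mu.-integrable setT (EFin \o D).
  have taf : tame (fun x => `|f x|).
    have [_ [c' [h [? ? fh]]]] := tf; split; first exact: measurableT_comp.
    by exists c', h; split => // x; rewrite normr_id.
  have [_ iP _] := kPhi.
  have [_ h _] := kernel_swap iP taf (kK 1).
  (* [K 1] is even, so its argument can be reversed to match the form in [kernel_swap]. *)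
  have -> : D = (fun x => `|f x| * \int[mu]_y (enorm (Phi y) * K 1 (y - x))).
    apply/funext => x; apply: (congr1 (fun u => `|f x| * u)).
    apply: eq_Rintegral => y _; apply: (congr1 (fun u => enorm (Phi y) * u)).
    by rewrite /K -(gaussN t (x - y)) -(enormN (x - y)) opprB.
  exact: h.
have cv : (\int[mu]_x (divergence (Pk k) x * f x)%:E @[k --> \oo] -->
    \int[mu]_x (divergence psi x * f x)%:E)%E.
  have [] := @dominated_convergence _ _ _ mu setT measurableT
    (fun k x => (divergence (Pk k) x * f x)%:E) (fun x => (divergence psi x * f x)%:E) (EFin \o D).
  - by move=> k; apply/measurable_EFinP; exact: measurable_funM.
  - by apply/measurable_EFinP; exact: measurable_funM.
  - apply/nearW => x _; apply: cvg_EFin; first exact/nearW.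
    apply: cvgM; last exact: cvg_cst.
    have c1 : cutoff k.+1%:R^-1 x * divergence psi x @[k --> \oo] --> divergence psi x.
      rewrite -[X in _ --> X]mul1r; apply: cvgM; last exact: cvg_cst.
      exact: cutoff_cvg.
    have c2 : divergence (Pk k) x - cutoff k.+1%:R^-1 x * divergence psi x @[k --> \oo] --> (0 : R).
      apply: norm_cvg0.
      apply: (@squeeze_cvgr _ _ _ _ (cst 0) (fun k => c * k.+1%:R^-1 * enorm (psi x))).
      + by apply: nearW => k; rewrite normr_ge0 dPk.
      + exact: cvg_cst.
      + rewrite -[X in _ --> X](mul0r (enorm (psi x))); apply: cvgM; last exact: cvg_cst.
        rewrite -[X in _ --> X](mulr0 c); apply: cvgM; first exact: cvg_cst.
        exact: cvg_harmonic.
    have c3 := cvgD c2 c1; rewrite add0r in c3.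
    have -> : (fun k => divergence (Pk k) x) =
      (fun k => divergence (Pk k) x - cutoff k.+1%:R^-1 x * divergence psi x) \+
      (fun k => cutoff k.+1%:R^-1 x * divergence psi x).
      by apply/funext => k; rewrite /= subrK.
    exact: c3.
  - exact: iD.
  - apply/nearW => x k _; rewrite lee_fin /D normrM mulrC ler_wpM2l//.
    rewrite (le_trans (dPkK k x))//; apply: le_Rintegral => //.
    + exact: tame_kernel_integrable (kernel_tame kPhi) (kK _).
    + exact: tame_kernel_integrable (kernel_tame kPhi) (kK _).
    move=> y _; rewrite ler_wpM2l// lerD2l ler_wpM2r ?gauss_ge0//.
    by rewrite ler_wpM2l.
  by [].
have cb : ((C * kappa `^ (1 - alpha) * N * (1 + c * k.+1%:R^-1 / kappa))%:E @[k --> \oo] -->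
    (C * kappa `^ (1 - alpha) * N)%:E)%E.
  apply: cvg_EFin; first exact/nearW.
  rewrite -[X in _ --> X]mulr1; apply: cvgM; first exact: cvg_cst.
  rewrite -[X in _ --> X]addr0; apply: cvgD; first exact: cvg_cst.
  rewrite -[X in _ --> X](mul0r kappa^-1); apply: cvgM; last exact: cvg_cst.
  rewrite -[X in _ --> X](mulr0 c); apply: cvgM; first exact: cvg_cst.
  exact: cvg_harmonic.
rewrite -lee_fin /Rintegral fineK; last exact: integrable_fin_num.
exact: (lee_cvg_to cv cb (nearW _ bound)).
Qed.

End duality.

(** * From pairings to the norm of the gradient *)

Section first_inequality.
Context (R : realType) (n : nat).
Local Notation mu := (lebesgue_rV R n).
Implicit Types (f g : 'rV[R]_n -> R) (x y : 'rV[R]_n)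
  (Phi Psi : 'rV[R]_n -> 'rV[R]_n).

(* The test fields are |G|^(p-2) G restricted to the sets where |G| and |x| are at most m. *)
Lemma truncated_dual_bound (p K : R) (G : 'rV[R]_n -> 'rV[R]_n) :
  1 <= p -> 0 <= K -> (forall i, measurable_fun setT (fun x => G x ord0 i)) ->
  (forall Phi, (forall i, measurable_fun setT (fun x => Phi x ord0 i)) ->
     kernel (fun x => enorm (Phi x)) ->
     \int[mu]_x dotp (G x) (Phi x) <=
       K * fine (Lp_norm (hoelder_conjugate p%:E) (fun x => enorm (Phi x)))) ->
  (Lp_norm p%:E (fun x => enorm (G x)) <= K%:E)%E.
Proof.
move=> p1 K0 mG H.
have p0 : 0 < p by rewrite (lt_le_trans ltr01).
have me := measurable_enorm_field mG.
pose A (m : nat) := [set x | enorm (G x) <= m%:R] `&` [set x : 'rV[R]_n | enorm x <= m%:R].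
have mA m : measurable (A m).
  apply: measurableI.
    have := me measurableT _ (measurable_itv `]-oo, (m%:R : R)]); rewrite setTI.
    by congr measurable; apply/seteqP; split => x /=; rewrite in_itv.
  have := @measurable_enorm R n measurableT _ (measurable_itv `]-oo, (m%:R : R)]); rewrite setTI.
  by congr measurable; apply/seteqP; split => x /=; rewrite in_itv.
have mI m : measurable_fun setT (\1_(A m) : 'rV[R]_n -> R) by exact: measurable_indic.
pose F m x : R := \1_(A m) x * enorm (G x) `^ p.
have F0 m x : 0 <= F m x by rewrite mulr_ge0 ?powR_ge0.
have mF m : measurable_fun setT (F m).
  by apply: measurable_funM => //; exact: measurable_fun_powR.
have indE m x : (\1_(A m) x = 1 :> R /\ enorm (G x) <= m%:R /\ enorm x <= m%:R) \/ \1_(A m) x = 0 :> R.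
  rewrite indicE; have [xA|xA] := boolP (x \in A m); [left|right]; last exact: mulr0n.
  by have [h1 h2] := set_mem xA.
have FK m : (\int[mu]_x (F m x)%:E <= (K `^ p)%:E)%E.
  have kF : kernel (F m).
    apply: (@bounded_support_kernel _ _ _ (m%:R `^ p) m%:R) => // x.
      rewrite ger0_norm// /F; case: (indE m x) => [[-> [h _]]|->].
        by rewrite mul1r ge0_ler_powR ?nnegrE ?enorm_ge0// ltW.
      by rewrite mul0r powR_ge0.
    rewrite ltNge /F; case: (indE m x) => [[_ [_ ->]]//|->].
    by rewrite mul0r.
  pose Phi x := (\1_(A m) x * enorm (G x) `^ (p - 2)) *: G x.
  (* Where [G] vanishes so does the field, whereas |G|^(p-1) would be 0^0 = 1 at p = 1. *)
  have ePhi x : enorm (Phi x) = if enorm (G x) == 0 then 0 else \1_(A m) x * enorm (G x) `^ (p - 1).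
    rewrite enormZ ger0_norm ?mulr_ge0 ?powR_ge0//; case: ifPn => [/eqP ->|e0].
      by rewrite mulr0.
    rewrite -mulrA; congr (_ * _).
    rewrite -[X in _ * X]powRr1 ?enorm_ge0// -powRD ?e0 ?implybT//.
    by congr (_ `^ _); ring.
  have mPhi i : measurable_fun setT (fun x => Phi x ord0 i).
    rewrite (_ : (fun x => Phi x ord0 i) =
      (fun x => \1_(A m) x * enorm (G x) `^ (p - 2) * G x ord0 i)); last first.
      by apply/funext => x; rewrite mxE.
    apply: measurable_funM => //; apply: measurable_funM => //.
    exact: measurable_fun_powR.
  have kPhi : kernel (fun x => enorm (Phi x)).
    apply: (@bounded_support_kernel _ _ _ (m%:R `^ (p - 1)) m%:R).
    - exact: measurable_enorm_field.
    - move=> x; rewrite ger0_norm ?enorm_ge0// ePhi; case: ifPn => _; first exact: powR_ge0.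
      case: (indE m x) => [[-> [h _]]|->].
        by rewrite mul1r ge0_ler_powR ?nnegrE ?enorm_ge0// subr_ge0.
      by rewrite mul0r powR_ge0.
    - move=> x; rewrite ltNge ePhi; case: (indE m x) => [[_ [_ ->]]//|->].
      by rewrite mul0r if_same.
  have := H Phi mPhi kPhi.
  have -> : \int[mu]_x dotp (G x) (Phi x) = \int[mu]_x (F m x).
    apply: eq_Rintegral => x _; rewrite /Phi dotpZr -enorm_sqr /F -mulrA; congr (_ * _).
    have [->|e0] := eqVneq (enorm (G x)) 0.
      by rewrite expr0n mulr0 powR0// gt_eqF.
    rewrite -powR_mulrn ?enorm_ge0// -powRD ?e0 ?implybT//.
    by congr (_ `^ _); ring.
  have [_ iF _] := kF.
  have -> : (\int[mu]_x (F m x)%:E)%E = (\int[mu]_x (F m x))%:E.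
    by rewrite /Rintegral fineK// integrable_fin_num.
  have I0 : 0 <= \int[mu]_x (F m x) by exact: Rintegral_ge0.
  rewrite lee_fin.
  case: (conjugate_cases p1) => [[pE ->]|[q [p1' q1 pq ->]]].
    rewrite pE powRr1// => /le_trans; apply; rewrite ler_piMr//.
    rewrite -lee_fin fineK.
      apply: ge_ereal_sup => _ [x _ <-]; rewrite lee_fin ger0_norm ?enorm_ge0// ePhi.
      case: ifPn => // e0; rewrite pE subrr powRr0 mulr1.
      by case: (indE m x) => [[-> _]|->].
    rewrite ge0_fin_numE ?Lp_norm_ge0//.
    by have := kernel_Lp_norm_lty p1 kPhi; rewrite pE hoelder_conjugate1.
  have q0 : 0 < q := lt_trans ltr01 q1.
  have qn : q != 0 by rewrite gt_eqF.
  have -> : Lp_norm q%:E (fun x => enorm (Phi x)) = ((\int[mu]_x (F m x)) `^ q^-1)%:E.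
    rewrite Lp_normE -poweR_EFin; congr (_ `^ _)%E.
    rewrite /Rintegral fineK ?integrable_fin_num//.
    apply: eq_integral => x _; congr EFin.
    rewrite ger0_norm ?enorm_ge0// ePhi /F.
    case: ifPn => [/eqP ->|e0]; first by rewrite !powR0 ?mulr0// gt_eqF.
    (* This makes |Phi|^q equal to |G|^p on the truncation set, so the norm of [Phi] is a power of
       the integral of [F m]. *)
    have pqE : (p - 1) * q = p.
      have pn : p != 0 by rewrite gt_eqF.
      have : (p^-1 + q^-1) * (p * q) = p * q by rewrite pq mul1r.
      rewrite mulrDl mulrA mulVf// mul1r mulrCA mulVf// mulr1 => h.
      by rewrite mulrBl -h; ring.
    rewrite powRM ?powR_ge0// -powRrM pqE; congr (_ * _).
    by case: (indE m x) => [[-> _]|->]; rewrite ?powR1 ?powR0.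
  move: I0; set I := \int[mu]_x _ => I0 /= h.
  (* The inequality I <= K I^(1/q) is divided by I^(1/q), finite thanks to the truncation, to give
     I^(1/p) <= K. *)
  have [->|In0] := eqVneq I 0; first exact: powR_ge0.
  have Ip : 0 < I by rewrite lt0r In0.
  have IE : I = I `^ p^-1 * I `^ q^-1.
    by rewrite -powRD ?In0 ?implybT// pq powRr1.
  have h2 : I `^ p^-1 <= K.
    by rewrite -(ler_pM2r (powR_gt0 q^-1 Ip)) -IE.
  rewrite -[I]powRr1// -(mulVf (lt0r_neq0 p0)) powRrM.
  by rewrite ge0_ler_powR ?nnegrE ?powR_ge0// ltW.
(* The truncated values are constant in m as soon as m exceeds |G x| and |x|. *)
have limF x : limn (fun m => (F m x)%:E) = (`|enorm (G x)| `^ p)%:E.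
  apply/cvg_lim => //; apply: cvg_near_cst.
  exists (maxn (Num.trunc (enorm (G x))).+1 (Num.trunc (enorm x)).+1) => // m /=.
  rewrite geq_max => /andP[m1 m2]; congr EFin.
  rewrite /F ger0_norm ?enorm_ge0// indicE mem_set ?mul1r//.
  by split => /=; apply: ltW; rewrite (lt_le_trans (truncnS_gt _))// ler_nat.
have cv := @cvg_monotone_convergence _ _ _ mu setT measurableT (fun m x => (F m x)%:E).
have {}cv : (\int[mu]_x (F m x)%:E @[m --> \oo] --> \int[mu]_x (`|enorm (G x)| `^ p)%:E)%E.
  rewrite -(eq_integral _ _ (fun x _ => limF x)).
  apply: cv => [m|m x _|x _ i j ij]; first exact/measurable_EFinP.
    by rewrite lee_fin.
  rewrite lee_fin ler_wpM2r ?powR_ge0//.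
  have [[-> [h1 h2]]|->] := indE i x; last by rewrite indicE ler0n.
  rewrite indicE mem_set// /A; split => /=.
    by rewrite (le_trans h1)// ler_nat.
  by rewrite (le_trans h2)// ler_nat.
have pb : (\int[mu]_x (`|enorm (G x)| `^ p)%:E <= (K `^ p)%:E)%E.
  exact: (lee_cvg_to cv (cvg_cst _) (nearW _ FK)).
rewrite Lp_normE; apply: (@le_trans _ _ ((K `^ p)%:E `^ p^-1)%E).
  apply: le_poweR => //; first by rewrite invr_ge0 ltW.
  by apply: integral_ge0 => x _; rewrite lee_fin powR_ge0.
by rewrite poweR_EFin -powRrM mulfV ?gt_eqF// powRr1.
Qed.

Lemma Lp_gradient_heat_le (p alpha C t : R) f :
  (0 < n)%N -> 1 <= p -> 0 < alpha -> alpha <= 1 -> tame f -> admissible p alpha f C ->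
  0 < t ->
  (Lp_norm p%:E (@enorm R n \o gradient (heat t f)) <=
    (C * Num.sqrt (n%:R / t) `^ (1 - alpha))%:E)%E.
Proof.
move=> n0 p1 al0 al1 tf adC t0.
have [C0 _] := adC.
apply: truncated_dual_bound => //; first by rewrite mulr_ge0 ?powR_ge0.
  move=> i; have -> : (fun x => gradient (heat t f) x ord0 i) = partial i (heat t f).
    by apply/funext => x; rewrite mxE.
  by apply: continuous_measurable_rV; apply: smooth_partial_continuous; exact: heat_smooth.
move=> Phi mPhi kPhi.
(* The duality carries a minus sign while the available bound is one-sided, so the field is
   negated. *)
pose Psi x := - Phi x.
have ePsi : (fun x => enorm (Psi x)) = (fun x => enorm (Phi x)).
  by apply/funext => x; rewrite enormN.
have mPsi i : measurable_fun setT (fun x => Psi x ord0 i).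
  rewrite (_ : (fun x => Psi x ord0 i) = (fun x => - Phi x ord0 i)).
    exact: measurableT_comp.
  by apply/funext => x; rewrite mxE.
have kPsi : kernel (fun x => enorm (Psi x)) by rewrite ePsi.
have [_ D] := gradient_heat_duality t0 mPsi kPsi tf.
have := admissible_heat_field n0 p1 al0 al1 tf adC t0 mPsi kPsi.
rewrite ePsi; apply: le_trans; rewrite -[leRHS]opprK -D.
have iD : mu.-integrable setT (EFin \o (fun x => dotp (gradient (heat t f) x) (Psi x))).
  have kg i := kernel_gauss_deriv t0 (delta_mx ord0 i : 'rV[R]_n).
  have ic i : mu.-integrable setT (EFin \o (fun x => Psi x ord0 i)) by case: (kernel_coord mPsi kPsi i).
  apply: (Rintegral_sum_integrable (F := fun i x => gradient (heat t f) x ord0 i * Psi x ord0 i) _).1 => i.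
  have [h _ _] := kernel_swap (ic i) tf (kg i).
  have -> : (fun x => gradient (heat t f) x ord0 i * Psi x ord0 i) =
    (fun x => Psi x ord0 i * \int[mu]_y (f y * gauss_deriv t (delta_mx ord0 i) (x - y))).
    by apply/funext => x; rewrite mxE partial_heat// mulrC.
  exact: h.
rewrite -mulN1r -RintegralZl// le_eqVlt; apply/orP; left; apply/eqP.
by apply: eq_Rintegral => x _; rewrite dotpNr mulN1r opprK.
Qed.

Lemma U_le_V (p alpha : R) f : (0 < n)%N -> 1 <= p -> 0 < alpha -> alpha <= 1 -> tame f ->
  (U p alpha f <= (n%:R `^ ((1 - alpha) / 2))%:E * V p alpha f)%E.
Proof.
move=> n0 p1 al0 al1 tf.
have np : 0 < n%:R `^ ((1 - alpha) / 2) :> R by rewrite powR_gt0// ltr0n.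
(* Dividing first makes the claim a lower bound for the set defining [V], which also covers an empty
   set. *)
rewrite -lee_pdivrMl//; apply: le_ereal_inf_tmp => _ [C adC <-].
rewrite lee_pdivrMl//; apply: ge_ereal_sup => _ [t /= t0 <-].
have := Lp_gradient_heat_le n0 p1 al0 al1 tf adC t0.
have tp : 0 < t `^ ((1 - alpha) / 2) by rewrite powR_gt0.
move=> /(lee_wpmul2l _) => /(_ (t `^ ((1 - alpha) / 2))%:E) H.
apply: le_trans (H _) _; first by rewrite lee_fin ltW.
rewrite -!EFinM lee_fin -powR12_sqrt ?divr_ge0 ?(ltW t0)// -powRrM.
rewrite [2^-1 * _]mulrC powRM ?invr_ge0 ?(ltW t0)//.
set b := (1 - alpha) / 2.
have tb : t `^ b * t^-1 `^ b = 1.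
  by rewrite -powRM ?invr_ge0 ?(ltW t0)// mulfV ?gt_eqF// powR1.
rewrite [leLHS](_ : _ = n%:R `^ b * C * (t `^ b * t^-1 `^ b)); last ring.
by rewrite tb mulr1.
Qed.

End first_inequality.

(** * Bounding V by U *)

Section test_fields.
Context (R : realType) (n : nat).
Local Notation mu := (lebesgue_rV R n).
Implicit Types (f g u : 'rV[R]_n -> R) (x y z : 'rV[R]_n)
  (Phi Psi : 'rV[R]_n -> 'rV[R]_n).

Definition supported_in (L : R) g := forall x, L < enorm x -> g x = 0.

Lemma test_field_support Phi : test_field Phi ->
  exists L, forall i, supported_in L (fun x => Phi x ord0 i).
Proof.
move=> [_ cS]; set S := [set x | Phi x != 0] in cS.
have cE : {within closure S, continuous (@enorm R n)}.
  by apply: continuous_subspaceT; exact: continuous_enorm.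
have /compact_bounded := continuous_compact cE cS.
move=> [M [_ HM]]; exists (M + 1) => i x Mx.
have [//|/eqP x0] := pselect (Phi x ord0 i = 0).
have Sx : S x by apply/eqP => h; move: x0; rewrite h mxE eqxx.
have M1 : M < M + 1 by rewrite ltrDl.
have := HM _ M1 (enorm x) (ex_intro2 _ _ x (subset_closure Sx) erefl).
rewrite /= ger0_norm ?enorm_ge0// => /(lt_le_trans Mx).
by rewrite ltxx.
Qed.

Lemma continuous_supported_bounded L g : continuous g -> supported_in L g ->
  exists M, forall x, `|g x| <= M.
Proof.
move=> cg gL.
pose B := [set x : 'rV[R]_n | forall i, `[- L, L]%classic (x ord0 i)].
have cB : compact B by apply: (@rV_compact R n (fun=> `[- L, L]%classic)) => i; exact: segment_compact.
have cgB : {within B, continuous g} by exact: continuous_subspaceT.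
have /compact_bounded [M [_ HM]] := continuous_compact cgB cB.
have M1 : M < `|M| + 1 by rewrite (le_lt_trans (ler_norm M))// ltrDl.
exists (`|M| + 1) => x.
have [Lx|xL] := ltP L (enorm x).
  by rewrite gL// normr0 addr_ge0.
apply: (HM _ M1); exists x => // i.
by rewrite /= in_itv/= -ler_norml (le_trans (coord_le_enorm x i)).
Qed.

Lemma continuous_supported_kernel L g : continuous g -> supported_in L g -> kernel g.
Proof.
move=> cg gL; have [M gM] := continuous_supported_bounded cg gL.
exact: (bounded_support_kernel (continuous_measurable_rV cg) gM gL).
Qed.

Lemma enorm_delta i : enorm (delta_mx ord0 i : 'rV[R]_n) = 1.
Proof.
apply/eqP; rewrite -(@eqrXn2 _ 2) ?enorm_ge0// enorm_sqr dotp_delta mxE !eqxx.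
by rewrite expr1n.
Qed.

(** The radius grows by 1 because the derivative criterion looks at steps |h| <= 1: from outside
    radius L + 1 such a step stays outside radius L. *)
Lemma partial_supported L g i : supported_in L g -> supported_in (L + 1) (partial i g).
Proof.
move=> gL x Lx; have xL : L < enorm x by apply: lt_trans Lx; rewrite ltrDl.
suff [] : is_derive x (delta_mx ord0 i) g 0 by [].
apply: (@is_derive_quadratic _ _ _ _ _ _ 0) => h h1.
rewrite !gL//; first by rewrite mulr0 !subr0 normr0 mul0r.
have := enorm_triangle (h *: delta_mx ord0 i + x) (- (h *: delta_mx ord0 i)).
rewrite addrAC subrr add0r enormN enormZ enorm_delta mulr1; lra.
Qed.

Lemma axis_lipschitz (B : R) g i : (forall x, derivable g x (delta_mx ord0 i)) ->
  (forall x, `|partial i g x| <= B) ->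
  forall x h, `|g (h *: delta_mx ord0 i + x) - g x| <= B * `|h|.
Proof.
move=> dg gB x h.
pose v : 'rV[R]_n := delta_mx ord0 i.
pose phi (th : R) := g (th *: v + x).
have dphi (th : R) : is_derive th 1 phi (partial i g (th *: v + x)).
  apply: is_derive_at_line; exact: derivableP.
have cphi (a b : R) : {within `[a, b], continuous phi}.
  apply: derivable_within_continuous => y _.
  by have [] := dphi y.
rewrite -[g x]/(g x) -{2}[x](add0r x) -(scale0r v) -/(phi h) -/(phi 0).
have [h0|h0] := leP 0 h.
  have [c _ ->] := @MVT_segment _ phi _ 0 h h0 (fun c _ => dphi c) (cphi 0 h).
  by rewrite subr0 normrM ler_wpM2r.
have [c _] := @MVT_segment _ phi _ h 0 (ltW h0) (fun c _ => dphi c) (cphi h 0).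
rewrite sub0r => E; rewrite distrC E normrM normrN ler_wpM2r//.
Qed.

(** Moving one coordinate at a time bounds the increment by the l^1 norm of [z], hence the crude
    factor [n]; only the finiteness of this Lipschitz constant matters later. *)
Lemma smooth_lipschitz (B : R) u : smooth u -> (forall i x, `|partial i u x| <= B) ->
  forall x z, `|u (x + z) - u x| <= B * (n%:R * enorm z).
Proof.
move=> su uB x z.
have H (s : seq 'I_n) y : `|u (y + \sum_(i <- s) z ord0 i *: delta_mx ord0 i) - u y| <=
    B * \sum_(i <- s) `|z ord0 i|.
  elim: s y => [|i s IH] y.
    by rewrite !big_nil addr0 subrr normr0 mulr0.
  rewrite !big_cons mulrDr addrA.
  set y' := y + _.
  rewrite -[X in `|X|](subrKA (u y')); apply: le_trans (ler_normD _ _) _.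
  rewrite [leRHS]addrC; apply: lerD; first exact: IH.
  by rewrite /y' [y + _]addrC; apply: axis_lipschitz => //; case: (su [::]).
(* In dimension 0 the number [B] may be negative, but then both sides vanish. *)
have B0 : 0 <= B \/ n = 0%N.
  case: (posnP n) => [|n0]; first by right.
  by left; rewrite (le_trans _ (uB (Ordinal n0) 0)).
have := H (index_enum _) x; rewrite -row_sum_delta => /le_trans; apply.
case: B0 => [B0|n0]; last first.
  by subst n; rewrite big_ord0 mulr0 mul0r mulr0.
rewrite ler_wpM2l// -[X in X%:R * _]card_ord -sum1_card natr_sum mulr_suml.
by apply: ler_sum => i _; rewrite mul1r coord_le_enorm.
Qed.

Lemma smooth_partial g i : smooth g -> smooth (partial i g).
Proof.
move=> sg s; have := sg (rcons s i).
by rewrite foldr_rcons.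
Qed.

Lemma smoothD g u : smooth g -> smooth u -> smooth (fun x => g x + u x).
Proof.
move=> sg su.
suff H s : foldr (@partial R n) (fun x => g x + u x) s =
    (fun x => foldr (@partial R n) g s x + foldr (@partial R n) u s x).
  move=> s; rewrite H; have [cg dg] := sg s; have [cu du] := su s; split.
    by move=> x; apply: continuousD; [exact: cg|exact: cu].
  by move=> i x; apply: derivableD; [exact: dg|exact: du].
elim: s => //= i s ->; apply/funext => x.
by rewrite /partial deriveD//; [case: (sg s)|case: (su s)].
Qed.

Lemma smooth_sum (I : Type) (s : seq I) (F : I -> 'rV[R]_n -> R) :
  (forall i, smooth (F i)) -> smooth (fun x => \sum_(i <- s) F i x).
Proof.
move=> sF; elim: s => [|i s IH].
  rewrite (_ : (fun x => _) = cst 0).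
    apply: (@algebra_of_smooth _ _ set0); last exact: algebra_cst.
    by move=> g [].
  by apply/funext => x; rewrite big_nil.
rewrite (_ : (fun x => _) = (fun x => F i x + \sum_(j <- s) F j x)).
  exact: (smoothD (sF i) IH).
by apply/funext => x; rewrite big_cons.
Qed.

Lemma smooth_divergence Phi : (forall i, smooth (fun x => Phi x ord0 i)) ->
  smooth (divergence Phi).
Proof. by move=> sPhi; apply: smooth_sum => i; exact: smooth_partial. Qed.

Definition ball_indic (L : R) x : R := \1_[set x | enorm x <= L] x.

Lemma ball_indic_in L x : enorm x <= L -> ball_indic L x = 1.
Proof. by move=> xL; rewrite /ball_indic indicE mem_set. Qed.

Lemma ball_indic_out L x : L < enorm x -> ball_indic L x = 0.
Proof.
by move=> xL; rewrite /ball_indic indicE memNset//= => h; move: xL; rewrite ltNge h.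
Qed.

Lemma ball_indic_ge0 L x : 0 <= ball_indic L x.
Proof. by have [h|h] := leP (enorm x) L; [rewrite ball_indic_in|rewrite ball_indic_out]. Qed.

Lemma ball_indic_le1 L x : ball_indic L x <= 1.
Proof. by have [h|h] := leP (enorm x) L; [rewrite ball_indic_in|rewrite ball_indic_out]. Qed.

Lemma kernel_ball_indic L : kernel (ball_indic L).
Proof.
apply: (@bounded_support_kernel _ _ _ 1 L).
- apply: measurable_indic.
  have := @measurable_enorm R n measurableT _ (measurable_itv `]-oo, L]); rewrite setTI.
  by congr measurable; apply/seteqP; split => x /=; rewrite in_itv.
- by move=> x; rewrite ger0_norm ?ball_indic_ge0// ball_indic_le1.
- exact: ball_indic_out.
Qed.

(** By translation invariance every difference quotient has integral 0, and dominated convergence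
    passes to the derivative. *)
Lemma integral_partial_eq0 L g i : continuous g ->
  (forall x, derivable g x (delta_mx ord0 i)) -> continuous (partial i g) ->
  supported_in L g -> \int[mu]_x partial i g x = 0.
Proof.
move=> cg dg cpg gL.
have pL := partial_supported i gL.
have [B pB] := continuous_supported_bounded cpg pL.
have B0 : 0 <= B by rewrite (le_trans _ (pB 0)).
have [mg ig _] := continuous_supported_kernel cg gL.
have mpg := continuous_measurable_rV cpg.
pose v : 'rV[R]_n := delta_mx ord0 i.
pose d (k : nat) x := k.+1%:R * (g (k.+1%:R^-1 *: v + x) - g x).
have mgt (k : nat) : measurable_fun setT (fun x => g (k.+1%:R^-1 *: v + x)).
  have -> : (fun x => g (k.+1%:R^-1 *: v + x)) = g \o (fun x => 1 *: x + k.+1%:R^-1 *: v).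
    by apply/funext => x; rewrite /= scale1r addrC.
  by apply: measurableT_comp => //; exact: measurable_affine_rV.
have md k : measurable_fun setT (d k).
  by apply: measurable_funM => //; exact: measurable_funB.
have k0 (k : nat) : 0 < k.+1%:R^-1 :> R by rewrite invr_gt0.
(* Steps have length at most 1, so all quotients are supported in the ball of radius L + 1; the mean
   value theorem bounds them there. *)
have dB k x : `|d k x| <= B * ball_indic (L + 1) x.
  have [h|h] := leP (enorm x) (L + 1).
    rewrite ball_indic_in// mulr1 normrM ger0_norm//.
    rewrite -ler_pdivlMl ?ltr0n// mulrC.
    by rewrite (le_trans (axis_lipschitz dg pB _ _))// gtr0_norm.
  rewrite ball_indic_out// mulr0 /d !gL ?subrr ?mulr0 ?normr0//.
    by apply: lt_trans h; rewrite ltrDl.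
  have := enorm_triangle (k.+1%:R^-1 *: v + x) (- (k.+1%:R^-1 *: v)).
  rewrite addrAC subrr add0r enormN enormZ enorm_delta mulr1 gtr0_norm//.
  have : k.+1%:R^-1 <= 1 :> R by rewrite invf_le1 ?ler1n.
  move: h; move: (k.+1%:R^-1) => r; lra.
have I0 k : (\int[mu]_x (d k x)%:E = 0)%E.
  have igt : mu.-integrable setT (EFin \o (fun x => g (k.+1%:R^-1 *: v + x))).
    apply/integrableP; split; first by apply/measurable_EFinP.
    case/integrableP: (ig) => mg' h; apply: le_lt_trans h; rewrite le_eqVlt; apply/orP; left.
    rewrite -(integral_translate (k.+1%:R^-1 *: v) (F := fun x => `|(g x)%:E|%E)); last first.
      exact: measurableT_comp.
    by apply/eqP; apply: eq_integral => x _; rewrite /= addrC.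
  rewrite (eq_integral (fun x => (k.+1%:R)%:E * ((g (k.+1%:R^-1 *: v + x))%:E - (g x)%:E))%E); last first.
    by move=> x _; rewrite -EFinB -EFinM.
  rewrite integralZl//; last exact: integrableB.
  rewrite integralB//.
  rewrite (_ : (\int[mu]_x (g (k.+1%:R^-1 *: v + x))%:E)%E = (\int[mu]_x (g x)%:E)%E).
    by rewrite subee ?mule0// integrable_fin_num.
  rewrite -(integral_translate (k.+1%:R^-1 *: v) (F := EFin \o g)); last by case/integrableP: ig.
  by apply: eq_integral => x _; rewrite /= addrC.
have [_ iw _] := kernel_ball_indic (L + 1).
have cvd x : d k x @[k --> \oo] --> partial i g x.
  have : h^-1 *: ((g \o shift x) (h *: v) - g x) @[h --> 0^'] --> partial i g x by exact: dg.
  move=> /cvgr_dnbhsP /(_ (fun k => k.+1%:R^-1)) cv.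
  have {}cv : k.+1%:R^-1^-1 *: ((g \o shift x) (k.+1%:R^-1 *: v) - g x) @[k --> \oo] --> partial i g x.
    by apply: cv; split; [move=> k; rewrite gt_eqF|exact: cvg_harmonic].
  have -> : d ^~ x = (fun k => k.+1%:R^-1^-1 *: ((g \o shift x) (k.+1%:R^-1 *: v) - g x)).
    by apply/funext => k; rewrite /d invrK.
  exact: cv.
have cv0 : ((\int[mu]_x (d k x)%:E) @[k --> \oo] --> \int[mu]_x (partial i g x)%:E)%E.
  have [] := @dominated_convergence _ _ _ mu setT measurableT
    (fun k x => (d k x)%:E) (fun x => (partial i g x)%:E)
    (EFin \o (fun x => B * ball_indic (L + 1) x)).
  - by move=> k; apply/measurable_EFinP.
  - exact/measurable_EFinP.
  - by apply/nearW => x _; apply: cvg_EFin; [exact/nearW|exact: cvd].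
  - exact: integrableZl_real.
  - by apply/nearW => x k _; rewrite lee_fin.
  by [].
have -> : \int[mu]_x partial i g x = fine 0%E; last by [].
apply: (congr1 fine); rewrite -(cvg_lim _ cv0)//; apply/cvg_lim => //.
by apply: cvg_near_cst; apply: nearW => k; exact: I0.
Qed.

End test_fields.

(** * Integration by parts and the limit at time zero *)

Section pairings.
Context (R : realType) (n : nat).
Local Notation mu := (lebesgue_rV R n).
Implicit Types (f g u : 'rV[R]_n -> R) (x y z : 'rV[R]_n)
  (Phi Psi : 'rV[R]_n -> 'rV[R]_n).

Lemma divergence_supported L Phi : (forall i, supported_in L (fun x => Phi x ord0 i)) ->
  supported_in (L + 1) (divergence Phi).
Proof.
move=> PL x Lx; rewrite /divergence big1// => i _.
exact: (partial_supported i (PL i)).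
Qed.

(** Each product of a coordinate of [Phi] with [g] has compact support even if [g] does not, so its
    partial derivative integrates to 0. *)
Lemma smooth_ibp Phi g : test_field Phi -> smooth g ->
  \int[mu]_x (divergence Phi x * g x) = - \int[mu]_x dotp (Phi x) (gradient g x).
Proof.
move=> tPhi sg; have [sPhi _] := tPhi; have [L PL] := test_field_support tPhi.
have cg := smooth_continuous sg.
have cP i := smooth_continuous (sPhi i).
have cpP i : continuous (partial i (fun x => Phi x ord0 i)).
  exact: (smooth_partial_continuous (sPhi i)).
have cpg i : continuous (partial i g) by exact: smooth_partial_continuous.
have dP i x : derivable (fun x => Phi x ord0 i) x (delta_mx ord0 i) by case: (sPhi i [::]).
have dg i x : derivable g x (delta_mx ord0 i) by case: (sg [::]).
have pE i : partial i (fun x => Phi x ord0 i * g x) =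
    (fun x => Phi x ord0 i * partial i g x + partial i (fun x => Phi x ord0 i) x * g x).
  by apply/funext => x; rewrite /partial deriveM// /GRing.scale/= [X in _ + X]mulrC.
have k1 i : kernel (fun x => Phi x ord0 i * partial i g x).
  apply: (@continuous_supported_kernel _ _ L).
    by move=> x; apply: continuousM; [exact: cP|exact: cpg].
  by move=> x Lx; rewrite PL// mul0r.
have k2 i : kernel (fun x => partial i (fun x => Phi x ord0 i) x * g x).
  apply: (@continuous_supported_kernel _ _ (L + 1)).
    by move=> x; apply: continuousM; [exact: cpP|exact: cg].
  by move=> x Lx; rewrite (partial_supported i (PL i))// mul0r.
have i1 i : mu.-integrable setT (EFin \o (fun x => Phi x ord0 i * partial i g x)) by case: (k1 i).
have i2 i : mu.-integrable setT (EFin \o (fun x => partial i (fun x => Phi x ord0 i) x * g x)) by case: (k2 i).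
have I0 i : \int[mu]_x (partial i (fun x => Phi x ord0 i) x * g x) =
    - \int[mu]_x (Phi x ord0 i * partial i g x).
  apply/eqP; rewrite -subr_eq0 opprK addrC -RintegralD// -pE.
  apply/eqP; apply: (@integral_partial_eq0 _ _ L).
  - by move=> x; apply: continuousM; [exact: cP|exact: cg].
  - by move=> x; exact: derivableM.
  - rewrite pE => x; apply: (@continuousD _ _ _ (fun x => Phi x ord0 i * partial i g x)
      (fun x => partial i (fun x => Phi x ord0 i) x * g x)).
      by apply: continuousM; [exact: cP|exact: cpg].
    by apply: continuousM; [exact: cpP|exact: cg].
  - by move=> x Lx; rewrite PL// mul0r.
have [_ E1] := Rintegral_sum_integrable i1.
have [_ E2] := Rintegral_sum_integrable i2.
transitivity (\int[mu]_x (\sum_(i < n) partial i (fun x => Phi x ord0 i) x * g x)).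
  by apply: eq_Rintegral => x _; rewrite mulr_suml.
rewrite E2 (eq_bigr _ (fun i _ => I0 i)) sumrN -E1; congr (- _).
by apply: eq_Rintegral => x _; apply: eq_bigr => i _; rewrite mxE.
Qed.

Lemma Lp_norm_Lfun (p : R) f : f \in Lfun mu p%:E -> (Lp_norm p%:E f < +oo)%E.
Proof. by move=> /[1!inE] /andP[_ /[!inE]]. Qed.

Lemma integral_pairing_heat u f s : kernel u -> tame f -> 0 < s ->
  mu.-integrable setT (EFin \o (fun x => u x * heat s f x)) /\
  \int[mu]_x (u x * heat s f x) =
    \int[mu]_y (f y * \int[mu]_x (u x * gauss s (x - y))).
Proof.
move=> [mu_ iu _] tf s0.
have [h _ E] := kernel_swap iu tf (kernel_gauss n s0).
have HE : (fun x => u x * heat s f x) = (fun x => u x * \int[mu]_y (f y * gauss s (x - y))).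
  by apply/funext => x; rewrite (heatE s0 x tf).
by rewrite HE; split; [exact: h|exact: E].
Qed.

(** The product is the integrand of a convolution at 0 with the reflected kernel. *)
Lemma tame_kernel_mul_integrable u f : kernel u -> tame f ->
  mu.-integrable setT (EFin \o (fun x => u x * f x)).
Proof.
move=> [mu_ iu [M uM]] tf.
have ku : kernel (fun x => u (- x)).
  have e : (fun x => u (- x)) = (fun x => u (0 - x)) by apply/funext => x; rewrite sub0r.
  by rewrite e; split; [exact: measurable_reflect|exact: integrable_reflect|exists M => x].
have := tame_kernel_integrable 0 tf ku.
have -> : (fun y => f y * u (- (0 - y))) = (fun x => u x * f x).
  by apply/funext => y; rewrite sub0r opprK mulrC.
by [].
Qed.

(* The kernel is moved onto [u], where the Lipschitz bound applies; Hoelder and Young then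
   leave the first moment of the Gaussian, of order sqrt s. *)
Lemma heat_limit_bound (p L : R) u f : 1 <= p -> smooth u -> supported_in L u ->
  f \in Lfun mu p%:E -> exists K, forall s, 0 < s ->
  `|\int[mu]_x (u x * heat s f x) - \int[mu]_x (u x * f x)| <= K * Num.sqrt s.
Proof.
move=> p1 su uL fLp.
have tf := tame_Lfun p1 fLp; have [mf _] := tf.
have ku := continuous_supported_kernel (smooth_continuous su) uL.
have [mu_ iu _] := ku.
have : forall i, exists M, forall x, `|partial i u x| <= M.
  move=> i; apply: (continuous_supported_bounded _ (partial_supported i uL)).
  exact: smooth_partial_continuous.
move=> /choice[M uM].
have uB i x : `|partial i u x| <= \sum_(j < n) `|M j|.
  rewrite (le_trans (uM i x))// (le_trans (ler_norm _))// (bigD1 i)//= lerDl.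
  by apply: sumr_ge0.
pose b := (\sum_(j < n) `|M j|) * n%:R.
have b0 : 0 <= b by rewrite mulr_ge0// sumr_ge0.
pose w := @ball_indic R n L.
have kw : kernel w by exact: kernel_ball_indic.
have [mw iw [Mw wM]] := kw.
have w0 x : 0 <= w x by exact: ball_indic_ge0.
have yxE x y : y + (x - y) = x by rewrite addrC subrK.
(* The Lipschitz bound is kept only where [x] or [y] lies in the support ball, so that the majorant
   involves [w], whose conjugate norm is finite. *)
have lip x y : `|u x - u y| <= b * (w y * enorm (x - y) + w x * enorm (x - y)).
  have [h1|h1] := leP (enorm x) L.
    rewrite /w (ball_indic_in h1) mul1r.
    have := smooth_lipschitz su uB y (x - y); rewrite yxE => /le_trans; apply.
    by rewrite mulrA ler_wpM2l// lerDr mulr_ge0 ?enorm_ge0.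
  have [h2|h2] := leP (enorm y) L.
    rewrite /w (ball_indic_in h2) mul1r.
    have := smooth_lipschitz su uB y (x - y); rewrite yxE => /le_trans; apply.
    by rewrite mulrA ler_wpM2l// lerDl mulr_ge0 ?enorm_ge0.
  by rewrite !uL// subrr normr0 (mulr_ge0 b0) ?addr_ge0 ?(mulr_ge0 (w0 _)) ?enorm_ge0.
set F := Lp_norm p%:E f.
set W := Lp_norm (hoelder_conjugate p%:E) w.
have Ffin : F = (fine F)%:E by rewrite fineK// ge0_fin_numE ?Lp_norm_ge0// Lp_norm_Lfun.
have Wfin : W = (fine W)%:E.
  by rewrite fineK// ge0_fin_numE ?Lp_norm_ge0// kernel_Lp_norm_lty.
exists (2 * b * Num.sqrt n%:R * (fine F * fine W)) => s s0.
have kg := kernel_gauss n s0; have kge := kernel_gauss_enorm n s0.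
have [mg ig _] := kg; have [mge ige [Mge geM]] := kge.
have ge0 z : 0 <= gauss s z * enorm z by rewrite mulr_ge0 ?gauss_ge0 ?enorm_ge0.
pose k z := gauss s z * enorm z.
pose m1 := \int[mu]_z k z.
have m1E : (\int[mu]_z (k z)%:E = m1%:E)%E by rewrite /m1 /Rintegral fineK// integrable_fin_num.
have m10 : 0 <= m1 by apply: Rintegral_ge0 => z _; exact: ge0.
have m1s : m1 <= Num.sqrt n%:R * Num.sqrt s.
  by rewrite -lee_fin -m1E -sqrtrM ?ler0n// gauss_moment1.
have [iuh ->] := integral_pairing_heat ku tf s0.
have itr (k0 : 'rV[R]_n -> R) y : mu.-integrable setT (EFin \o k0) ->
    mu.-integrable setT (EFin \o (fun x => k0 (x - y))).
  move=> /integrableP[mk0 ik0]; apply/integrableP; split.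
    apply/measurable_EFinP; apply: measurableT_comp; first by apply/measurable_EFinP.
    rewrite (_ : (fun x => x - y) = (fun x => 1 *: x + (- y))); first exact: measurable_affine_rV.
    by apply/funext => x; rewrite scale1r.
  rewrite (integral_translate (- y) (F := fun x => `|(k0 x)%:E|%E))//.
  exact: measurableT_comp.
have iug y : mu.-integrable setT (EFin \o (fun x => u x * gauss s (x - y))).
  have h := tame_kernel_integrable y (kernel_tame ku) kg.
  have -> : (fun x => u x * gauss s (x - y)) = (fun x => u x * gauss s (y - x)).
    by apply/funext => x; rewrite -(gaussN s (x - y)) opprB.
  exact: h.
have ikw y : mu.-integrable setT (EFin \o (fun x => w x * k (y - x))).
  exact: (tame_kernel_integrable y (kernel_tame kw) kge).
(* The integrated Lipschitz bound: [w y] meets the first moment of the Gaussian, while [w x] yields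
   a convolution that Young controls. *)
pose v y := b * (m1 * w y + \int[mu]_x (w x * k (y - x))).
have inner y : `|\int[mu]_x (u x * gauss s (x - y)) - u y| <= v y.
  have E1 : u y = \int[mu]_x (u y * gauss s (x - y)).
    rewrite RintegralZl//; last exact: itr.
    rewrite -[LHS]mulr1; congr (_ * _).
    rewrite -[LHS]/(fine 1%E) -(integral_gauss n s0); apply: (congr1 fine).
    rewrite -(integral_translate (- y) (F := EFin \o gauss s))//.
    exact/measurable_EFinP.
  have iuyg : mu.-integrable setT (EFin \o (fun x => u y * gauss s (x - y))).
    by apply: integrableZl_real; exact: itr.
  rewrite [X in _ - X]E1 -RintegralB//.
  rewrite (le_trans (le_normr_Rintegral _ _))//; first exact: integrableB_real.
  have Ev : v y = \int[mu]_x (b * (w y * k (x - y) + w x * k (y - x))).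
    have i3 : mu.-integrable setT (EFin \o (fun x => w y * k (x - y))).
      by apply: integrableZl_real; exact: itr.
    rewrite RintegralZl//; last exact: integrableD_real.
    rewrite RintegralD// RintegralZl//; last exact: itr.
    rewrite /v; congr (_ * (_ + _)); rewrite mulrC; congr (_ * _).
    apply: (congr1 fine).
    rewrite -(integral_translate (- y) (F := EFin \o k))//.
    exact/measurable_EFinP.
  rewrite Ev; apply: le_Rintegral => //.
  - by apply: integrable_norm; exact: integrableB_real.
  - apply: integrableZl_real; apply: integrableD_real => //.
    by apply: integrableZl_real; exact: itr.
  move=> x _; rewrite -mulrBl normrM (ger0_norm (gauss_ge0 s0 _)).
  rewrite /k -(gaussN s (y - x)) -(enormN (y - x)) opprB.
  rewrite [leRHS](_ : _ = b * (w y * enorm (x - y) + w x * enorm (x - y)) * gauss s (x - y)); last ring.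
  by rewrite ler_wpM2r ?gauss_ge0.
have mkw := measurable_conv kw kge ge0 w0.
have mv : measurable_fun setT v.
  by apply: measurable_funM => //; apply: measurable_funD => //; exact: measurable_funM.
have v0 y : 0 <= v y by rewrite (le_trans _ (inner y)).
have iuf := tame_kernel_mul_integrable ku tf.
have [_ ifu _] := kernel_swap iu tf kg.
have -> : \int[mu]_x (u x * f x) = \int[mu]_y (f y * u y).
  by apply: eq_Rintegral => x _; rewrite mulrC.
have ifu2 : mu.-integrable setT (EFin \o (fun y => f y * u y)).
  have -> : (fun y => f y * u y) = (fun y => u y * f y) by apply/funext => y; rewrite mulrC.
  exact: iuf.
rewrite -RintegralB//.
rewrite (le_trans (le_normr_Rintegral _ _))//; first exact: integrableB_real.
have idf : mu.-integrable setT (EFin \o (fun y => `|f y * \int[mu]_x (u x * gauss s (x - y)) - f y * u y|)).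
  by apply: integrable_norm; exact: integrableB_real.
rewrite -lee_fin /Rintegral fineK; last exact: integrable_fin_num.
have FW0 : 0 <= fine F * fine W by rewrite mulr_ge0// fine_ge0// Lp_norm_ge0.
have Hw : (\int[mu]_y (`|f y * w y|)%:E <= (fine F * fine W)%:E)%E.
  rewrite EFinM -Ffin -Wfin; apply: hoelder_conj => //.
  by exists Mw.
have Hkw : (\int[mu]_y (`|f y * \int[mu]_x (w x * k (y - x))|)%:E <= (m1 * (fine F * fine W))%:E)%E.
  apply: (@le_trans _ _ (F * Lp_norm (hoelder_conjugate p%:E) (fun y => \int[mu]_x (w x * k (y - x)))%R)%E).
    apply: hoelder_conj => //.
    have [B HB] := tame_kernel_bound (kernel_tame kw) kge.
    exists B => x; rewrite (le_trans (le_normr_Rintegral _ _))//.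
    rewrite -lee_fin (le_trans _ (HB x))// /Rintegral fineK//.
    by apply: integrable_fin_num => //; exact: integrable_norm.
  rewrite mulrCA EFinM Ffin.
  apply: (@le_trans _ _ ((fine F)%:E * (m1%:E * W))%E).
    rewrite lee_wpmul2l ?lee_fin ?fine_ge0 ?Lp_norm_ge0//.
    by apply: young => //; rewrite m1E.
  by rewrite Wfin -EFinM.
apply: (@le_trans _ _ (\int[mu]_y ((b * m1)%:E * (`|f y * w y|)%:E +
   b%:E * (`|f y * \int[mu]_x (w x * k (y - x))|)%:E))%E).
  apply: ge0_le_integral => //.
  - by case/integrableP: idf.
  - by apply: emeasurable_funD; apply: measurable_funeM; apply/measurable_EFinP;
      apply: measurableT_comp => //; exact: measurable_funM.
  move=> y _; rewrite -!EFinM -EFinD lee_fin -mulrBr normrM.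
  apply: (@le_trans _ _ (`|f y| * v y)); first by apply: ler_wpM2l => //; exact: inner.
  rewrite !normrM (ger0_norm (w0 y)) /v.
  rewrite [leLHS](_ : _ = b * m1 * (`|f y| * w y) + b * (`|f y| * \int[mu]_x (w x * k (y - x)))); last ring.
  by rewrite lerD2l ler_wpM2l// ler_wpM2l// ler_norm.
have mfw : measurable_fun setT (fun y => (`|f y * w y|)%:E).
  by apply/measurable_EFinP; apply: measurableT_comp => //; exact: measurable_funM.
have mfkw : measurable_fun setT (fun y => (`|f y * \int[mu]_x (w x * k (y - x))|)%:E).
  by apply/measurable_EFinP; apply: measurableT_comp => //; exact: measurable_funM.
have bm0 : 0 <= b * m1 by rewrite mulr_ge0.
rewrite ge0_integralD//; last 4 first.
- by move=> y _; apply: mule_ge0; rewrite lee_fin.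
- exact: measurable_funeM.
- by move=> y _; apply: mule_ge0; rewrite lee_fin.
- exact: measurable_funeM.
rewrite (ge0_integralZl_EFin _ measurableT _ mfw bm0); last by [].
rewrite (ge0_integralZl_EFin _ measurableT _ mfkw b0); last by [].
apply: (@le_trans _ _ ((b * m1)%:E * (fine F * fine W)%:E + b%:E * (m1 * (fine F * fine W))%:E)%E).
  by apply: leeD; apply: lee_wpmul2l; rewrite ?lee_fin; [|exact: Hw| |exact: Hkw].
rewrite -!EFinM -EFinD lee_fin.
rewrite [leLHS](_ : _ = 2 * b * (fine F * fine W) * m1); last ring.
rewrite [leRHS](_ : _ = 2 * b * (fine F * fine W) * (Num.sqrt n%:R * Num.sqrt s)); last ring.
by rewrite ler_wpM2l// mulr_ge0// mulr_ge0.
Qed.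

End pairings.

(** * Increments along segments and along the heat flow *)

Section increments.
Context (R : realType) (n : nat).
Local Notation mu := (lebesgue_rV R n).
Local Notation leb := (@lebesgue_measure R).
Implicit Types (f g u : 'rV[R]_n -> R) (x y z v : 'rV[R]_n).

Lemma continuous_enorm_field (G : 'rV[R]_n -> 'rV[R]_n) :
  (forall i, continuous (fun x => G x ord0 i)) -> continuous (fun x => enorm (G x)).
Proof.
move=> cG y.
apply: (@continuous_comp _ _ _ (fun y => \sum_(i < n) G y ord0 i ^+ 2) Num.sqrt).
  apply: continuous_sum_rV => i {}y.
  by apply: (@continuousM _ _ (fun y => G y ord0 i) (fun y => G y ord0 i)); exact: cG.
exact: sqrt_continuous.
Qed.

Lemma is_derive_heat_gradient f s x v : 0 < s -> tame f ->
  is_derive x v (heat s f) (dotp v (gradient (heat s f) x)).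
Proof.
move=> s0 tf; apply: (is_derive_eq (is_derive_heat s0 x v tf)).
have kg i := kernel_gauss_deriv s0 (delta_mx ord0 i : 'rV[R]_n).
have ik i : mu.-integrable setT (EFin \o (fun y => v ord0 i *
    (f y * gauss_deriv s (delta_mx ord0 i) (x - y)))).
  by apply: integrableZl_real; exact: tame_kernel_integrable tf (kg i).
have [_ E] := Rintegral_sum_integrable ik.
rewrite /dotp (eq_bigr (fun i => \int[mu]_y (v ord0 i *
    (f y * gauss_deriv s (delta_mx ord0 i) (x - y))))); last first.
  move=> i _; rewrite mxE partial_heat// RintegralZl//.
  exact: tame_kernel_integrable tf (kg i).
rewrite -E; apply: eq_Rintegral => y _.
rewrite (eq_bigr (fun i => v ord0 i * (x - y) ord0 i * (- (f y * gauss s (x - y) / s)))).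
  by rewrite -mulr_suml -/(dotp v (x - y)) /gauss_deriv; ring.
by move=> i _; rewrite /gauss_deriv (dotpC (delta_mx _ _)) dotp_delta; ring.
Qed.

Lemma line_increment_le g x v : continuous (fun y => enorm (gradient g y)) ->
  (forall i, continuous (partial i g)) ->
  (forall y, is_derive y v g (dotp v (gradient g y))) ->
  ((`|g (v + x) - g x|)%:E <=
    \int[leb]_(th in `[0%R, 1%R]) (enorm v * enorm (gradient g (th *: v + x)))%:E)%E.
Proof.
move=> ceg cpg dg.
pose phi (th : R) := g (th *: v + x).
pose dphi (th : R) := dotp v (gradient g (th *: v + x)).
have dp (th : R) : is_derive th 1 phi (dphi th).
  by apply: is_derive_at_line; exact: dg.
have cline : continuous (fun th : R => th *: v + x).
  move=> th; apply: (@continuousD _ _ _ (fun th : R => th *: v) (cst x)); last exact: cst_continuous.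
  exact: scalel_continuous.
have cdphi : continuous dphi.
  move=> th; apply: (@continuous_comp _ _ _ (fun th : R => th *: v + x)
    (fun y => dotp v (gradient g y))); first exact: cline.
  apply: continuous_sum_rV => i y.
  apply: (@continuousM _ _ (cst (v ord0 i)) (fun y => gradient g y ord0 i)).
    exact: cst_continuous.
  have -> : (fun y => gradient g y ord0 i) = partial i g by apply/funext => z; rewrite mxE.
  exact: cpg.
have cE : continuous (fun th : R => enorm v * enorm (gradient g (th *: v + x))).
  move=> th.
  apply: (@continuousM _ _ (cst (enorm v)) (fun th : R => enorm (gradient g (th *: v + x)))).
    exact: cst_continuous.
  apply: (@continuous_comp _ _ _ (fun th : R => th *: v + x)
    (fun y => enorm (gradient g y))); [exact: cline|exact: ceg].
have cphi : continuous phi.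
  by move=> th; have [d _] := dp th; exact/differentiable_continuous/derivable1_diffP.
have FTC : ((g (v + x) - g x)%:E = \int[leb]_(th in `[0%R, 1%R]) (dphi th)%:E)%E.
  have -> : g (v + x) = phi 1 by rewrite /phi scale1r.
  have -> : g x = phi 0 by rewrite /phi scale0r add0r.
  rewrite EFinB; apply/esym/continuous_FTC2 => //.
  - exact: continuous_subspaceT.
  - split; first by move=> th _; have [] := dp th.
    + by apply: cvg_at_right_filter; exact: cphi.
    + by apply: cvg_at_left_filter; exact: cphi.
  - by move=> th _; rewrite derive1E; have [] := dp th.
rewrite -[(`|_|)%:E]/(`|(g (v + x) - g x)%:E|)%E FTC.
have md : measurable_fun (`[0%R, 1%R]%classic : set (measurableTypeR R)) (fun th => (dphi th)%:E).
  by apply/measurable_EFinP; apply: measurable_funTS; exact: continuous_measurable_fun.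
apply: le_trans (le_abse_integral _ _ md) _ => //.
apply: ge0_le_integral => //.
- exact: measurableT_comp.
- by apply/measurable_EFinP; apply: measurable_funTS; exact: continuous_measurable_fun.
by move=> th _; rewrite lee_fin dotp_le_enorm.
Qed.

(** At each point th of the segment, Hoelder and the translation invariance of the norm of the
    gradient give the same bound. The indicator [I01] turns the integral over [0, 1] into one over
    the line, ready for Tonelli. *)
Lemma translation_increment_le (p E : R) g u v : (1 <= p) -> kernel u ->
  continuous g -> continuous (fun y => enorm (gradient g y)) ->
  (forall i, continuous (partial i g)) ->
  (forall y, is_derive y v g (dotp v (gradient g y))) ->
  (Lp_norm p%:E (fun y => enorm (gradient g y)) <= E%:E)%E ->
  (\int[mu]_x (`|u x| * `|g (v + x) - g x|)%:E <=
     (enorm v * (E * fine (Lp_norm (hoelder_conjugate p%:E) u)))%:E)%E.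
Proof.
move=> p1 ku cg ceg cpg dg gE; have [mu_ _ [M uM]] := ku.
set e := fun y => enorm (gradient g y) in ceg gE *.
have me : measurable_fun setT e by exact: continuous_measurable_rV.
have e0 x : 0 <= e x by exact: enorm_ge0.
set B := fine _.
have BE : Lp_norm (hoelder_conjugate p%:E) u = B%:E.
  by rewrite fineK// ge0_fin_numE ?kernel_Lp_norm_lty// Lp_norm_ge0.
pose I01 (th : R) : R := \1_`[0, 1]%classic th.
have I010 th : 0 <= I01 th by rewrite /I01 indicE.
have mI01 : measurable_fun setT (I01 : measurableTypeR R -> R) by exact: measurable_indic.
have mtr (a : 'rV[R]_n) : measurable_fun setT (fun x => a + x).
  rewrite (_ : (fun x => a + x) = (fun x => 1 *: x + a)); first exact: measurable_affine_rV.
  by apply/funext => x; rewrite scale1r addrC.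
pose H (z : 'rV[R]_n * measurableTypeR R) := (`|u z.1| * (I01 (z.2 : R) * (enorm v * e ((z.2 : R) *: v + z.1))))%:E.
have mline : measurable_fun setT (fun z : 'rV[R]_n * measurableTypeR R => (z.2 : R) *: v + z.1).
  apply: measurable_fun_rV => i.
  rewrite (_ : (fun _ => _) = (fun z : 'rV[R]_n * measurableTypeR R => (z.2 : R) * v ord0 i + z.1 ord0 i)).
    apply: measurable_funD; last exact: (measurableT_comp (@measurable_coord R n i)).
    by apply: measurable_funM.
  by apply/funext => z; rewrite !mxE.
have mH : measurable_fun setT H.
  apply/measurable_EFinP; apply: measurable_funM.
    by apply: measurableT_comp => //; exact: (measurableT_comp mu_).
  apply: measurable_funM; first exact: (measurableT_comp mI01).
  by apply: measurable_funM => //; exact: (measurableT_comp me mline).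
have H0 (w : 'rV[R]_n * measurableTypeR R) : (0 <= H w)%E by rewrite lee_fin mulr_ge0// mulr_ge0// mulr_ge0// enorm_ge0.
have mgv : measurable_fun setT (fun x => g (v + x) - g x).
  apply: measurable_funB; last exact: continuous_measurable_rV.
  by apply: measurableT_comp => //; exact: continuous_measurable_rV.
apply: (@le_trans _ _ (\int[mu]_x \int[leb]_th H (x, th))%E).
  apply: ge0_le_integral => //.
  - by apply/measurable_EFinP; apply: measurable_funM; exact: measurableT_comp.
  - exact: (@measurable_fun_fubini_tonelli_F _ _ _ _ R leb H).
  move=> x _; rewrite /H /=.
  under eq_integral do rewrite EFinM.
  rewrite ge0_integralZl_EFin//; last 2 first.
  - by move=> th _; rewrite lee_fin mulr_ge0// mulr_ge0// enorm_ge0.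
  - apply/measurable_EFinP; apply: measurable_funM => //; apply: measurable_funM => //.
    exact: (measurableT_comp me (measurableT_comp mline (measurable_pair1 x))).
  rewrite EFinM lee_wpmul2l ?lee_fin//.
  apply: le_trans (line_increment_le x ceg cpg dg) _.
  rewrite [leLHS]integral_mkcond le_eqVlt; apply/orP; left; apply/eqP.
  apply: eq_integral => th _; rewrite patchE /I01 indicE.
  by case: ifPn => _; rewrite ?mul1r ?mul0r.
rewrite fubini_tonelli//.
have E0 : 0 <= E by rewrite -lee_fin (le_trans _ gE)// Lp_norm_ge0.
have B0 : 0 <= B by rewrite -lee_fin -BE Lp_norm_ge0.
apply: (@le_trans _ _ (\int[leb]_th ((enorm v * (E * B))%:E * (I01 th)%:E))%E).
  apply: ge0_le_integral => //.
  - by move=> th _; exact: integral_ge0.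
  - exact: (@measurable_fun_fubini_tonelli_G _ _ _ _ R mu H).
  - by apply: measurable_funeM; apply/measurable_EFinP.
  move=> th _; rewrite /H /=.
  rewrite (eq_integral (fun x => (I01 th * enorm v)%:E * (`|e (th *: v + x) * u x|)%:E)%E); last first.
    by move=> x _; rewrite -EFinM normrM (ger0_norm (e0 _)); congr EFin; ring.
  have met : measurable_fun setT (fun x => e (th *: v + x)) by exact: (measurableT_comp me (mtr _)).
  rewrite ge0_integralZl_EFin//; last 2 first.
  - by apply/measurable_EFinP; apply: measurableT_comp => //; exact: measurable_funM.
  - by rewrite mulr_ge0// enorm_ge0.
  rewrite [X in (_ <= X)%E]muleC [(enorm v * _)%:E]EFinM EFinM -muleA.
  rewrite lee_wpmul2l ?lee_fin// lee_wpmul2l ?lee_fin ?enorm_ge0//.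
  apply: le_trans (hoelder_conj p1 met mu_ (ex_intro _ M uM)) _.
  rewrite BE EFinM; apply: lee_wpmul2r; first by rewrite lee_fin.
  apply: le_trans gE; rewrite !Lp_normE le_eqVlt; apply/orP; left; apply/eqP.
  apply: (congr1 (fun I => poweR I p^-1)).
  have T := integral_translate (th *: v) (measurable_powR_norm p me).
  apply: etrans T; apply: eq_integral => x _.
  by rewrite [x + _]addrC.
rewrite ge0_integralZl_EFin//; last 3 first.
- by move=> th _; rewrite lee_fin.
- exact/measurable_EFinP.
- by rewrite mulr_ge0 ?enorm_ge0// mulr_ge0.
have L1 : leb `[0, 1]%classic = 1%E by rewrite lebesgue_measure_itv/= lte_fin ltr01 sube0.
have I1 : (\int[leb]_th (I01 th)%:E = 1)%E.
  by rewrite -L1 -[in RHS](setIT `[0, 1]%classic); apply: integral_indic.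
by rewrite I1 mule1.
Qed.

(** As the Gaussian has mass 1, g(x) is an average of the constant g(x); the substitution y = z + x
    and evenness leave only the displacement z. *)
Lemma heat_displacement_le g s x : 0 < s -> tame g ->
  ((`|g x - heat s g x|)%:E <= \int[mu]_z (gauss s z * `|g (z + x)%R - g x|)%:E)%E.
Proof.
move=> s0 tg; have kg := kernel_gauss n s0; have [mG iG _] := kg.
have mg : measurable_fun setT g by case: tg.
have i1 : mu.-integrable setT (EFin \o (fun y => g x * gauss s (x - y))).
  by apply: integrableZl_real; exact: integrable_reflect.
have i2 := tame_kernel_integrable x tg kg.
have gx : g x = \int[mu]_y (g x * gauss s (x - y)).
  rewrite (RintegralZl (g x) measurableT (integrable_reflect x iG)).
  rewrite -[LHS]mulr1; congr (_ * _).
  rewrite -[LHS]/(fine 1%E) -(integral_gauss n s0); apply: (congr1 fine).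
  apply/esym/(integral_reflect x (F := EFin \o gauss s)).
  by apply/measurable_EFinP; exact: measurable_gauss.
rewrite {1}gx heatE// -RintegralB//.
apply: (@le_trans _ _ (\int[mu]_y (`|g x * gauss s (x - y) - g y * gauss s (x - y)|)%:E)%E).
  rewrite (le_trans _ (_ : (\int[mu]_y `|g x * gauss s (x - y) - g y * gauss s (x - y)|)%:E <= _)%E)//.
    by rewrite lee_fin; apply: le_normr_Rintegral => //; exact: integrableB_real.
  rewrite /Rintegral fineK//; apply: integrable_fin_num => //.
  by apply: integrable_norm; exact: integrableB_real.
have mF : measurable_fun setT (fun y => (`|g x * gauss s (x - y) - g y * gauss s (x - y)|)%:E).
  apply/measurable_EFinP; apply: measurableT_comp => //.
  by apply: measurable_funB; apply: measurable_funM => //; exact: measurable_reflect.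
rewrite -(integral_translate x mF) le_eqVlt; apply/orP; left; apply/eqP.
apply: eq_integral => z _; apply: (congr1 EFin).
have -> : x - (z + x)%R = - z by rewrite opprD addrC addrNK.
rewrite gaussN -mulrBl normrM (ger0_norm (gauss_ge0 s0 z)) distrC.
exact: mulrC.
Qed.

Lemma heat_increment_le (p E s : R) f u : 1 <= p -> kernel u -> tame f -> 0 < s ->
  (Lp_norm p%:E (fun y => enorm (gradient (heat s f) y)) <= E%:E)%E ->
  `|\int[mu]_x (u x * heat s f x) - \int[mu]_x (u x * heat (2 * s) f x)| <=
    Num.sqrt (n%:R * s) * (E * fine (Lp_norm (hoelder_conjugate p%:E) u)).
Proof.
move=> p1 ku tf s0 gE; set B := fine _.
have tg := tame_heat s0 tf; have sg := heat_smooth s0 tf.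
(* The increment becomes g - P_s g for the smooth function g = P_s f, whose gradient is the one
   controlled by [E]. *)
have -> : heat (2 * s) f = heat s (heat s f).
  by apply/funext => x; rewrite heat_semigroup.
have dg x v := is_derive_heat_gradient x v s0 tf.
set g := heat s f in gE tg sg dg *.
have cg := smooth_continuous sg.
have cpg i : continuous (partial i g) by exact: smooth_partial_continuous.
have ceg : continuous (fun y => enorm (gradient g y)).
  apply: continuous_enorm_field => i.
  by have -> : (fun y => gradient g y ord0 i) = partial i g by apply/funext => z; rewrite mxE.
have [mu_ iu _] := ku; have [mg _] := tg; have [mhg _] := tame_heat s0 tg.
have E0 : 0 <= E by rewrite -lee_fin (le_trans _ gE)// Lp_norm_ge0.
have B0 : 0 <= B by rewrite fine_ge0// Lp_norm_ge0.
have [mG iG _] := kernel_gauss n s0.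
have [_ iGe _] := kernel_gauss_enorm n s0.
have i1 := tame_kernel_mul_integrable ku tg.
have i2 := tame_kernel_mul_integrable ku (tame_heat s0 tg).
rewrite -RintegralB//.
apply: le_trans (le_normr_Rintegral _ _) _ => //; first exact: integrableB_real.
rewrite -lee_fin /Rintegral fineK; last first.
  by apply: integrable_fin_num => //; apply: integrable_norm; exact: integrableB_real.
have mtr (a : 'rV[R]_n) : measurable_fun setT (fun x => x + a).
  rewrite (_ : (fun x => x + a) = (fun x => 1 *: x + a)); first exact: measurable_affine_rV.
  by apply/funext => x; rewrite scale1r.
have md x : measurable_fun setT (fun z => g (z + x) - g x).
  by apply: measurable_funB; [exact: (measurableT_comp mg (mtr x))|exact: measurable_cst].
have md' z : measurable_fun setT (fun x => g (z + x) - g x).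
  apply: measurable_funB; last exact: mg.
  have -> : (fun x => g (z + x)) = (fun x => g (x + z)) by apply/funext => x; rewrite [z + x]addrC.
  exact: (measurableT_comp mg (mtr z)).
pose H (w : 'rV[R]_n * 'rV[R]_n) := (`|u w.1| * (gauss s w.2 * `|g (w.2 + w.1) - g w.1|))%:E.
have H0 w : (0 <= H w)%E by rewrite lee_fin mulr_ge0// mulr_ge0// gauss_ge0.
have madd : measurable_fun setT (fun w : 'rV[R]_n * 'rV[R]_n => w.2 + w.1).
  apply: measurable_fun_rV => i.
  rewrite (_ : (fun _ => _) = (fun w : 'rV[R]_n * 'rV[R]_n => w.2 ord0 i + w.1 ord0 i)).
    apply: measurable_funD; exact: (measurableT_comp (@measurable_coord R n i)).
  by apply/funext => w; rewrite !mxE.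
have mH : measurable_fun setT H.
  apply/measurable_EFinP; apply: measurable_funM.
    by apply: measurableT_comp => //; exact: (measurableT_comp mu_).
  apply: measurable_funM; first exact: (measurableT_comp mG).
  apply: measurableT_comp => //.
  by apply: measurable_funB; [exact: (measurableT_comp mg)|exact: (measurableT_comp mg)].
apply: (@le_trans _ _ (\int[mu]_x \int[mu]_z H (x, z))%E).
  apply: ge0_le_integral => //.
  - apply/measurable_EFinP; apply: measurableT_comp => //.
    by apply: measurable_funB; exact: measurable_funM.
  - exact: (@measurable_fun_fubini_tonelli_F _ _ _ _ R mu H).
  move=> x _; rewrite /H /= -mulrBr normrM.
  rewrite (eq_integral (fun z => (`|u x|)%:E * (gauss s z * `|g (z + x)%R - g x|)%:E)%E)//.
  rewrite ge0_integralZl_EFin//; last 2 first.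
  - by move=> z _; rewrite lee_fin mulr_ge0// gauss_ge0.
  - by apply/measurable_EFinP; apply: measurable_funM => //; exact: measurableT_comp.
  by rewrite EFinM lee_wpmul2l ?lee_fin//; exact: heat_displacement_le.
rewrite fubini_tonelli//.
apply: (@le_trans _ _ (\int[mu]_z ((E * B)%:E * (gauss s z * enorm z)%:E))%E).
  apply: ge0_le_integral => //.
  - by move=> z _; exact: integral_ge0.
  - exact: (@measurable_fun_fubini_tonelli_G _ _ _ _ R mu H).
  - by apply: measurable_funeM; case/integrableP: iGe.
  move=> z _; rewrite /H /=.
  rewrite (eq_integral (fun x => (gauss s z)%:E * (`|u x| * `|g (z + x)%R - g x|)%:E)%E); last first.
    by move=> x _; rewrite -EFinM; apply: (congr1 EFin); rewrite mulrCA.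
  rewrite ge0_integralZl_EFin//; last 2 first.
  - by apply/measurable_EFinP; apply: measurable_funM; exact: measurableT_comp.
  - exact: gauss_ge0.
  apply: (@le_trans _ _ ((gauss s z)%:E * (enorm z * (E * B))%:E)%E).
    rewrite lee_wpmul2l ?lee_fin ?gauss_ge0//.
    by apply: translation_increment_le.
  by rewrite -!EFinM lee_fin [leLHS](_ : _ = E * B * (gauss s z * enorm z)); [|ring].
rewrite ge0_integralZl_EFin//; last 3 first.
- by move=> z _; rewrite lee_fin mulr_ge0 ?gauss_ge0 ?enorm_ge0.
- by case/integrableP: iGe.
- exact: mulr_ge0.
rewrite [leRHS]EFinM [leRHS]muleC lee_wpmul2l ?lee_fin ?mulr_ge0//.
exact: gauss_moment1.
Qed.

End increments.

(** * Constants and the choice of time *)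

Section optimization.
Context (R : realType).

Lemma half_le_ln2 : 2^-1 <= ln 2 :> R.
Proof.
have h : (-1 < - 2^-1 :> R) by lra.
have := le_ln1Dx h.
rewrite (_ : 1 + - 2^-1 = 2^-1 :> R); last by field.
by rewrite lnV ?posrE//; lra.
Qed.

(** Origin of 4 / alpha: with r = 2^(-a/2), the bound ln 2 >= 1/2 gives 1 / r = e^(a ln 2 / 2) >= 1
    + a / 4, that is r / (1 - r) <= 4 / a. *)
Lemma powR_half_le (a : R) : 0 < a -> 2^-1 `^ (a / 2) <= 4 / a * (1 - 2^-1 `^ (a / 2)).
Proof.
move=> a0; set r := _ `^ _.
have r0 : 0 < r by rewrite powR_gt0.
have rE : r * expR (ln 2 * (a / 2)) = 1.
  rewrite /r -[X in X^-1](lnK (x := 2)) ?posrE// -expRN -expRM -expRD.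
  by rewrite mulNr addNr expR0.
have h : 1 + a / 4 <= expR (ln 2 * (a / 2)).
  apply: le_trans (expR_ge1Dx _); rewrite lerD2l.
  have : 2^-1 * (a / 2) <= ln 2 * (a / 2) by apply: ler_wpM2r half_le_ln2; rewrite divr_ge0// ltW.
  lra.
have {}h : r * (1 + a / 4) <= 1 by rewrite -[leRHS]rE ler_pM2l.
have a4 : 0 < a / 4 by rewrite divr_gt0.
rewrite -(ler_pM2l a4) [leRHS](_ : _ = 1 - r); last by field; rewrite gt_eqF.
lra.
Qed.

(* [K] bounds the geometric series r + r^2 + ... = r / (1 - r). *)
Lemma geometric_increments_le (u : nat -> R) (c r K : R) :
  0 <= c -> 0 <= r -> r <= K * (1 - r) ->
  (forall k, u k.+1 - u k <= c * r ^+ k.+1) -> forall k, u k <= u 0%N + c * (K * (1 - r ^+ k)).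
Proof.
move=> c0 r0 rK uS; elim=> [|k IH]; first by rewrite expr0 subrr !mulr0 addr0.
have := uS k; rewrite exprS => h.
have : c * (r * r ^+ k) <= c * (K * (1 - r) * r ^+ k).
  by rewrite ler_wpM2l// ler_wpM2r// exprn_ge0.
lra.
Qed.

(* Take t = (A / B)^2, or let t tend to 0 when A = 0. *)
Lemma optimal_time (A B D M X alpha : R) : 0 < alpha -> 0 <= D -> 0 <= M -> 0 <= A -> 0 < B ->
  (forall t, 0 < t -> X <= D * M * t `^ (alpha / 2) * B + M * A * t `^ (- ((1 - alpha) / 2))) ->
  X <= (D + 1) * M * A `^ alpha * B `^ (1 - alpha).
Proof.
move=> al0 D0 M0 A0 B0 H; have [A_eq0|A_neq0] := eqVneq A 0.
  apply: (@le_trans _ _ 0); last by rewrite !mulr_ge0// ?powR_ge0// addr_ge0.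
  apply/ler_addgt0Pr => e e0; rewrite add0r.
  have DB0 : 0 < D * M * B + 1 by rewrite ltr_wpDl// !mulr_ge0// ltW.
  pose s := e / (D * M * B + 1); have s0 : 0 < s by rewrite divr_gt0.
  (* At this time t^(alpha/2) equals s, which makes the surviving term at most e. *)
  have := H (s `^ (2 / alpha)) (powR_gt0 _ s0).
  rewrite A_eq0 mulr0 mul0r addr0 -powRrM (_ : 2 / alpha * (alpha / 2) = 1); last first.
    by field; rewrite gt_eqF.
  rewrite powRr1 ?(ltW s0)// => /le_trans; apply.
  rewrite [leLHS](_ : _ = e * (D * M * B / (D * M * B + 1))); last by rewrite /s; ring.
  by rewrite ler_piMr ?(ltW e0)// ler_pdivrMr// mul1r lerDl.
have A1 : 0 < A by rewrite lt_neqAle eq_sym A_neq0.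
(* Writing (A / B)^2 through logarithms reduces the comparison of powers to linear identities
   between exponents; both terms become multiples of A^alpha B^(1-alpha). *)
have := H (expR (2 * (ln A - ln B))) (expR_gt0 _).
set a := ln A; set b := ln B.
have -> : A = expR a by rewrite lnK.
have -> : B = expR b by rewrite lnK.
rewrite -!expRM -!mulrA -!expRD.
rewrite [2 * _ + _](_ : _ = a * alpha + b * (1 - alpha)); last by field.
rewrite [a + 2 * _](_ : _ = a * alpha + b * (1 - alpha)); last by field.
by move=> h; apply: le_trans h _; rewrite mulrDl mul1r.
Qed.

End optimization.

(** * Dyadic summation and conclusion *)

Section second_inequality.
Context (R : realType) (n : nat).
Local Notation mu := (lebesgue_rV R n).
Implicit Types (f g u : 'rV[R]_n -> R) (Phi : 'rV[R]_n -> 'rV[R]_n).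

Lemma test_field_kernels Phi : test_field Phi ->
  kernel (fun x => enorm (Phi x)) /\ kernel (divergence Phi).
Proof.
move=> tPhi; have [L PL] := test_field_support tPhi; have [sPhi _] := tPhi.
split.
  apply: (@continuous_supported_kernel _ _ L).
    by apply: continuous_enorm_field => i; exact: smooth_continuous.
  move=> x Lx; rewrite (_ : Phi x = 0) ?enorm0//.
  by apply/rowP => i; rewrite (PL i)// mxE.
apply: (@continuous_supported_kernel _ _ (L + 1)); last exact: divergence_supported.
exact/smooth_continuous/smooth_divergence.
Qed.

Lemma divergence_heat_pairing_le (p E s : R) f Phi : 1 <= p -> tame f -> test_field Phi ->
  0 < s -> (Lp_norm p%:E (@enorm R n \o gradient (heat s f)) <= E%:E)%E ->
  \int[mu]_x (divergence Phi x * heat s f x) <=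
    E * fine (Lp_norm (hoelder_conjugate p%:E) (@enorm R n \o Phi)).
Proof.
move=> p1 tf tPhi s0 gE; have sg := heat_smooth s0 tf.
have [kP _] := test_field_kernels tPhi; have [mP _ bP] := kP.
have [sPhi _] := tPhi; have [L PL] := test_field_support tPhi.
set q := hoelder_conjugate _; set A := fine _.
have AE : Lp_norm q (fun x => enorm (Phi x)) = A%:E.
  by rewrite fineK// ge0_fin_numE ?kernel_Lp_norm_lty// Lp_norm_ge0.
have A0 : 0 <= A by rewrite fine_ge0// Lp_norm_ge0.
have cg i : continuous (fun x => gradient (heat s f) x ord0 i).
  have -> : (fun y => gradient (heat s f) y ord0 i) = partial i (heat s f).
    by apply/funext => z; rewrite mxE.
  exact: smooth_partial_continuous.
have mg : measurable_fun setT (fun x => enorm (gradient (heat s f) x)).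
  exact: continuous_measurable_rV (continuous_enorm_field cg).
have kd : kernel (fun x => dotp (Phi x) (gradient (heat s f) x)).
  apply: (@continuous_supported_kernel _ _ L).
    apply: continuous_sum_rV => i x.
    apply: (@continuousM _ _ (fun x => Phi x ord0 i) (fun x => gradient (heat s f) x ord0 i)).
      exact: (smooth_continuous (sPhi i)).
    exact: cg.
  by move=> x Lx; rewrite /dotp big1// => i _; rewrite (PL i)// mul0r.
have [md id_ _] := kd.
rewrite smooth_ibp// (le_trans (ler_norm _))// normrN.
apply: le_trans (le_normr_Rintegral _ _) _ => //.
rewrite -lee_fin /Rintegral fineK; last by apply: integrable_fin_num => //; exact: integrable_norm.
apply: (@le_trans _ _ (\int[mu]_x (`|enorm (gradient (heat s f) x) * enorm (Phi x)|)%:E)%E).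
  apply: ge0_le_integral => //.
  - by apply/measurable_EFinP; exact: measurableT_comp.
  - by apply/measurable_EFinP; apply: measurableT_comp => //; exact: measurable_funM.
  move=> x _; rewrite lee_fin [leRHS]ger0_norm ?mulr_ge0 ?enorm_ge0// mulrC.
  exact: dotp_le_enorm.
apply: le_trans (hoelder_conj p1 mg mP bP) _.
by rewrite AE EFinM lee_wpmul2r ?lee_fin.
Qed.

Lemma dyadic_pairing_le (p alpha M t : R) f Phi : 1 <= p -> 0 < alpha -> 0 <= M ->
  f \in Lfun mu p%:E -> test_field Phi -> 0 < t ->
  (forall s, 0 < s -> (Lp_norm p%:E (@enorm R n \o gradient (heat s f)) <=
     (s `^ (- ((1 - alpha) / 2)) * M)%:E)%E) ->
  \int[mu]_x (divergence Phi x * f x) <=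
    4 * Num.sqrt n%:R * alpha^-1 * M * t `^ (alpha / 2) *
      fine (Lp_norm (hoelder_conjugate p%:E) (divergence Phi)) +
    M * fine (Lp_norm (hoelder_conjugate p%:E) (@enorm R n \o Phi)) * t `^ (- ((1 - alpha) / 2)).
Proof.
move=> p1 al0 M0 fLp tPhi t0 HM; have tf := tame_Lfun p1 fLp.
set B := fine (Lp_norm _ (divergence Phi)); set A := fine _.
have [_ ku] := test_field_kernels tPhi; have [L PL] := test_field_support tPhi.
have B0 : 0 <= B by rewrite fine_ge0// Lp_norm_ge0.
have [K HK] := heat_limit_bound p1 (smooth_divergence (proj1 tPhi)) (divergence_supported PL) fLp.
pose s k : R := t * 2^-1 ^+ k.
have s0 k : 0 < s k by rewrite mulr_gt0// exprn_gt0.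
have sS k : s k = 2 * s k.+1 by rewrite /s exprS; field.
pose a k := \int[mu]_x (divergence Phi x * heat (s k) f x).
pose r : R := 2^-1 `^ (alpha / 2).
have r0 : 0 <= r by exact: powR_ge0.
pose c := Num.sqrt n%:R * t `^ (alpha / 2) * M * B.
have c0 : 0 <= c by rewrite !mulr_ge0// powR_ge0.
(* With s = t / 2^(k+1), the sqrt s of the displacement times the s^(-(1-alpha)/2) of the gradient
   bound is s^(alpha/2) = t^(alpha/2) r^(k+1). *)
have aS k : a k.+1 - a k <= c * r ^+ k.+1.
  rewrite /a (sS k) (le_trans (ler_norm _))//.
  apply: le_trans (heat_increment_le p1 ku tf (s0 k.+1) (HM _ (s0 _))) _.
  rewrite -/B sqrtrM// -[Num.sqrt (s _)]powR12_sqrt ?(ltW (s0 _))//.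
  rewrite [leLHS](_ : _ = Num.sqrt n%:R * (s k.+1 `^ 2^-1 * s k.+1 `^ (- ((1 - alpha) / 2))) * M * B);
    last ring.
  rewrite -powRD ?(gt_eqF (s0 _)) ?implybT// (_ : _ + _ = alpha / 2); last by field.
  rewrite powRM ?exprn_ge0 ?(ltW t0)// -powR_mulrn// powRAC powR_mulrn ?powR_ge0//.
  by rewrite /c le_eqVlt; apply/orP; left; apply/eqP; rewrite /r; ring.
have a0 : a 0%N <= M * A * t `^ (- ((1 - alpha) / 2)).
  have := divergence_heat_pairing_le p1 tf tPhi t0 (HM t t0).
  by rewrite /a /s expr0 mulr1 [t `^ _ * M]mulrC mulrAC.
have ale k : a k <= M * A * t `^ (- ((1 - alpha) / 2)) + c * (4 / alpha).
  apply: le_trans (geometric_increments_le c0 r0 (powR_half_le al0) aS k) _.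
  apply: lerD => //; rewrite ler_wpM2l// ler_piMr ?divr_ge0 ?(ltW al0)//.
  by rewrite gerBl exprn_ge0.
apply/ler_addgt0Pr => e e0.
have K1 : 0 < `|K| + 1 by rewrite ltr_wpDl.
(* At times below d the error K sqrt s of [heat_limit_bound] is at most e; |K| + 1 keeps the
   denominator positive whatever the sign of K. *)
pose d := (e / (`|K| + 1)) ^+ 2.
have d0 : 0 < d by rewrite exprn_gt0// divr_gt0.
have [k kd] : exists k, s k <= d.
  have td0 : 0 <= t / d by rewrite divr_ge0// ltW.
  exists (Num.bound (t / d)); rewrite /s exprVn ler_pdivrMr ?exprn_gt0//.
  rewrite -ler_pdivrMl// mulrC (le_trans (ltW (archi_boundP td0)))//.
  by rewrite -natrX ler_nat ltnW// ltn_expl.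
have := HK (s k) (s0 k); rewrite ler_distlC => /andP[_ h].
apply: le_trans h _; rewrite -/(a k).
apply: lerD.
  apply: le_trans (ale k) _; rewrite addrC lerD2r /c le_eqVlt; apply/orP; left; apply/eqP.
  by field; rewrite gt_eqF.
have : Num.sqrt (s k) <= e / (`|K| + 1).
  rewrite -[leRHS]ger0_norm ?divr_ge0 ?(ltW e0) ?(ltW K1)// -sqrtr_sqr.
  by rewrite ler_wsqrtr.
move=> {}h; apply: (@le_trans _ _ (`|K| * (e / (`|K| + 1)))).
  by apply: le_trans (ler_wpM2l _ h) => //; apply: ler_wpM2r (ler_norm K); exact: sqrtr_ge0.
by rewrite mulrCA ler_piMr ?(ltW e0)// ler_pdivrMr// mul1r lerDl.
Qed.

Lemma admissible_of_U (p alpha M : R) f : 1 <= p -> 0 < alpha -> alpha <= 1 ->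
  f \in Lfun mu p%:E -> U p alpha f = M%:E ->
  admissible p alpha f ((4 * Num.sqrt n%:R * alpha^-1 + 1) * M).
Proof.
move=> p1 al0 al1 fLp UM; have tf := tame_Lfun p1 fLp; have [mf _] := tf.
have HM s : 0 < s -> (Lp_norm p%:E (@enorm R n \o gradient (heat s f)) <=
    (s `^ (- ((1 - alpha) / 2)) * M)%:E)%E.
  move=> s0; have sp : 0 < s `^ ((1 - alpha) / 2) by rewrite powR_gt0.
  rewrite powRN EFinM lee_pdivlMl// -UM.
  by apply: ereal_sup_ubound; exists s.
have M0 : 0 <= M.
  have := HM 1 ltr01; rewrite powR1 mul1r -lee_fin; apply: le_trans.
  exact: Lp_norm_ge0.
pose D := 4 * Num.sqrt n%:R * alpha^-1 : R.
have D0 : 0 <= D by rewrite mulr_ge0 ?invr_ge0 ?(ltW al0)// mulr_ge0.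
split; first by rewrite mulr_ge0// addr_ge0.
move=> Phi tPhi; have [kP ku] := test_field_kernels tPhi.
have [mu_ _ bu] := ku.
set q := hoelder_conjugate _.
have [A0 B0] : (0 <= Lp_norm q (@enorm R n \o Phi) /\ 0 <= Lp_norm q (divergence Phi))%E.
  by split; exact: Lp_norm_ge0.
have AE : Lp_norm q (@enorm R n \o Phi) \is a fin_num.
  by rewrite ge0_fin_numE ?kernel_Lp_norm_lty.
have BE : Lp_norm q (divergence Phi) \is a fin_num.
  by rewrite ge0_fin_numE ?kernel_Lp_norm_lty.
have bound t (t0 : 0 < t) := dyadic_pairing_le p1 al0 M0 fLp tPhi t0 HM.
have iuf := tame_kernel_mul_integrable ku tf.
move: A0 B0 bound; rewrite -(fineK AE) -(fineK BE) /= -/q.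
set A := fine _; set B := fine _; rewrite !lee_fin => A0 B0 bound.
rewrite -[leLHS]fineK; last exact: integrable_fin_num.
rewrite -[fine _]/(\int[mu]_x (divergence Phi x * f x)).
rewrite -EFinM lee_fin.
(* The time (A / B)^2 requires B > 0; for B = 0 Hoelder makes the pairing vanish. *)
have [B_eq0|B_neq0] := eqVneq B 0.
  apply: (@le_trans _ _ 0); last by rewrite !mulr_ge0// ?powR_ge0// addr_ge0.
  rewrite (le_trans (ler_norm _))//; apply: le_trans (le_normr_Rintegral _ _) _ => //.
  rewrite -lee_fin /Rintegral fineK; last by apply: integrable_fin_num => //; exact: integrable_norm.
  rewrite (eq_integral (fun x => (`|f x * divergence Phi x|)%:E)); last first.
    by move=> x _; rewrite mulrC.
  by rewrite (le_trans (hoelder_conj p1 mf mu_ bu))// -/q -(fineK BE) -/B B_eq0 mule0.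
have B1 : 0 < B by rewrite lt_neqAle eq_sym B_neq0.
by apply: optimal_time.
Qed.

Lemma U_ge0 (p alpha : R) f : (0 <= U p alpha f)%E.
Proof.
apply: le_trans (ereal_sup_ubound _); last by exists 1 => //; exact: ltr01.
by rewrite mule_ge0 ?lee_fin ?powR_ge0// Lp_norm_ge0.
Qed.

(** A finite [U] supplies an admissible constant; an infinite one makes the bound trivial because
    the factor is positive. *)
Lemma V_le_U (p alpha : R) f : 1 <= p -> 0 < alpha -> alpha <= 1 -> f \in Lfun mu p%:E ->
  (V p alpha f <= (4 * Num.sqrt n%:R * alpha^-1 + 1)%:E * U p alpha f)%E.
Proof.
move=> p1 al0 al1 fLp.
have c0 : 0 < 4 * Num.sqrt n%:R * alpha^-1 + 1.
  by rewrite ltr_wpDl// mulr_ge0 ?invr_ge0 ?(ltW al0)// mulr_ge0.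
case UM : (U p alpha f) (U_ge0 p alpha f) => [M| |] // _.
  rewrite -EFinM; apply: ereal_inf_lbound.
  by exists ((4 * Num.sqrt n%:R * alpha^-1 + 1) * M) => //; exact: admissible_of_U.
by rewrite gt0_muley ?lte_fin// leey.
Qed.

End second_inequality.

Theorem theorem3p8 (R : realType) (n : nat) (n_gt0 : (0 < n)%N)
  (p alpha : R) (p_ge1 : 1 <= p) (alpha_gt0 : 0 < alpha) (alpha_le1 : alpha <= 1)
  (f : 'rV[R]_n -> R) (fLp : f \in Lfun (lebesgue_rV R n) p%:E) :
  ((V p alpha f < +oo)%E <-> (U p alpha f < +oo)%E) /\
  (U p alpha f <= (n%:R `^ ((1 - alpha) / 2))%:E * V p alpha f)%E /\
  (V p alpha f <= (4 * Num.sqrt n%:R * alpha^-1 + 1)%:E * U p alpha f)%E.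
Proof.
have UV := U_le_V n_gt0 p_ge1 alpha_gt0 alpha_le1 (tame_Lfun p_ge1 fLp).
have VU := V_le_U p_ge1 alpha_gt0 alpha_le1 fLp.
split; last by [].
split=> [Voo|Uoo].
  by apply: le_lt_trans UV _; rewrite lte_mul_pinfty// lee_fin powR_ge0.
apply: le_lt_trans VU _; rewrite lte_mul_pinfty// lee_fin addr_ge0// mulr_ge0//.
by rewrite invr_ge0 ltW.
Qed.
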